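(* Let $0<r_0<r<+\infty$ and $k>1$ be real numbers, let $E\subset[0,r]$ be a Lebesgue measurable set, let $1<p\le\infty$ and let $q\in[1,+\infty)$ be the conjugate exponent ($\frac1p+\frac1q=1$ if $p<\infty$, $q=1$ if $p=\infty$), and let $g\in L^p(E)$. Let $U\not\equiv\pm\infty$ be a (non-trivial) $\delta$-subharmonic function on $\mathbb C$, and let $u\not\equiv-\infty$ be a subharmonic function on $\mathbb C$. Then $$\frac1r\int_E \mathsf M_U^+(t)\,g(t)\,dt\le 4q\,\frac{k}{k-1}\Bigl(\mathsf T_U(r_0,kr)+\mathsf C_{U^+}(r_0)\Bigr)\|g\|_{L^p(E)}\,\frac{(\operatorname{mes}E)^{1/q}}{r}\,\ln\frac{4kr}{\operatorname{mes}E},$$ and $$\frac1r\int_E \mathsf M_{|u|}(t)\,g(t)\,dt\le 5q\,\frac{k}{k-1}\Bigl(\mathsf M_{u^+}(kr)+\mathsf C_{u^-}(r_0)\Bigr)\|g\|_{L^p(E)}\,\frac{(\operatorname{mes}E)^{1/q}}{r}\,\ln\frac{4kr}{\operatorname{mes}E}.$$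
   Context: $\operatorname{mes}E$ denotes the linear Lebesgue measure of $E\subset\mathbb R$; conventions: $0\cdot(\pm\infty)=0$, $x/0=+\infty$ for $x>0$ (so if $\operatorname{mes}E=0$ the right-hand sides are $0$). For $x\in[-\infty,+\infty]$, $x^+=\max\{0,x\}$, $x^-=(-x)^+$; for a function $f$, $f^+=\max\{0,f\}$, $f^-=(-f)^+$, $|f|=f^++f^-$. $\|g\|_{L^p(E)}=(\int_E|g|^p\,d\lambda)^{1/p}$ for $p<\infty$ and $=\operatorname{ess\,sup}_E|g|$ for $p=\infty$. For $r\ge0$ and a function $v$ on the circle $\{|z|=r\}$: $\mathsf M_v(r)=\sup_{|z|=r}v(z)$, $\mathsf C_v(r)=\frac1{2\pi}\int_0^{2\pi}v(re^{is})\,ds$ (with $\mathsf M_v(0)=\mathsf C_v(0)=v(0)$), $\mathsf C_v(r,R)=\mathsf C_v(R)-\mathsf C_v(r)$; $\mathsf M_U^+(t)$ means $(\mathsf M_U(t))^+$. A $\delta$-subharmonic function $U$ on $\mathbb C$ is a difference $U=u-v$ of subharmonic functions $u,v\not\equiv-\infty$; its Riesz charge is $\Delta_U=\Delta_u-\Delta_v$, where $\Delta_w=\frac1{2\pi}\triangle w$ (Laplacian in the distributional sense) is the Riesz measure of a subharmonic $w$. The canonical representation $U=u_U-v_U$ is the one in which the Riesz measure of $u_U$ is the positive variation $\Delta_U^+$ and that of $v_U$ is the negative variation $\Delta_U^-$ of $\Delta_U$. For a positive Borel measure $\mu$, $\mu^{\mathrm{rad}}(t)=\mu(\{|z|\le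 t\})$ and $\mathsf N_\mu(r,R)=\int_r^R\frac{\mu^{\mathrm{rad}}(t)}{t}\,dt$. The characteristic function of $U$ is $\mathsf T_U(r,R)=\mathsf C_{\max\{u_U,v_U\}}(r,R)=\mathsf C_{U^+}(r,R)+\mathsf N_{\Delta_U^-}(r,R)$ for $0<r\le R<\infty$. *)

(* Defs.v *)
(* R : realType, the complex plane is modelled as R * R. *)
From HB Require Import structures.
From mathcomp Require Import all_boot all_order all_algebra.
From mathcomp Require Import all_classical all_reals all_analysis.
Set Implicit Arguments. Unset Strict Implicit. Unset Printing Implicit Defensive.
Import Order.TTheory GRing.Theory Num.Theory.
Import numFieldNormedType.Exports.
Local Open Scope classical_set_scope.
Local Open Scope ring_scope.

(* Lebesgue measure on R: the (Borel) Lebesgue measure [lebesgue_measure]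
   and the completed Lebesgue measure [cmu], whose measurable sets are the
   Lebesgue measurable sets.  [LebT R] is R with the Lebesgue sigma-algebra. *)
Definition LebT (R : realType) :=
  caratheodory_type (R:=R) (wlength (R:=R) idfun)^*%mu.
Definition cmu {R : realType} := @completed_lebesgue_measure R.

(* mes E, as a real number (E will always be a bounded set) *)
Definition mes {R : realType} (E : set (LebT R)) : R := fine (cmu E).

Definition circ_dom (R : realType) : set R := `[0, 2 * pi].

Definition Msup {R : realType} (f : R * R -> \bar R) (t : R) : \bar R :=
  ereal_sup [set f (t * cos s, t * sin s) | s in [set: R]].

Definition Cmean {R : realType} (f : R * R -> \bar R) (t : R) : \bar R :=
  if t == 0 then f (0, 0)
  else (((2 * pi)^-1)%:E * \int[lebesgue_measure]_(s in @circ_dom R)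
          f ((t * cos s)%R, (t * sin s)%R))%E.

Definition eplus {R : realType} (x : \bar R) : \bar R := maxe x 0%E.
Definition eminus {R : realType} (x : \bar R) : \bar R := maxe (- x)%E 0%E.

(* Subharmonic functions on C (Ransford's definition): upper semicontinuous,
   values in [-oo, +oo), local sub-mean-value inequality; moreover not
   identically -oo. *)
Definition subharmonic {R : realType} (u : R * R -> \bar R) : Prop :=
  [/\ (forall z, u z != +oo%E),
      (exists z, u z != -oo%E),
      (forall z (c : R), (u z < c%:E)%E -> \forall w \near z, (u w < c%:E)%E)
    & (forall z, exists2 rho : R, 0 < rho & forall s : R, 0 < s < rho ->
         (u z <= ((2 * pi)^-1)%:E * \int[lebesgue_measure]_(x in @circ_dom R)
                  u ((z.1 + s * cos x)%R, (z.2 + s * sin x)%R))%E)].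

Definition pd {R : realType} (b : bool) (f : R * R -> R) : R * R -> R :=
  fun z => if b then derive1 (fun y => f (z.1, y)) z.2
           else derive1 (fun x => f (x, z.2)) z.1.

Definition pd_exists {R : realType} (b : bool) (f : R * R -> R) (z : R * R) :=
  if b then derivable (fun y => f (z.1, y)) z.2 1
  else derivable (fun x => f (x, z.2)) z.1 1.

Definition iter_pd {R : realType} (l : seq bool) (f : R * R -> R) :=
  foldr pd f l.

Definition smooth {R : realType} (f : R * R -> R) : Prop :=
  forall l : seq bool,
    continuous (iter_pd l f) /\ forall b z, pd_exists b (iter_pd l f) z.

Definition test_function {R : realType} (f : R * R -> R) : Prop :=
  smooth f /\ exists M : R, forall z, M < z.1 ^+ 2 + z.2 ^+ 2 -> f z = 0.

Definition laplacian {R : realType} (f : R * R -> R) : R * R -> R :=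
  fun z => pd false (pd false f) z + pd true (pd true f) z.

Definition leb2 {R : realType} :=
  ((@lebesgue_measure R) \x (@lebesgue_measure R))%E.

(* mu is the Riesz measure Delta_u = (1/2pi) (Laplacian of u) in the sense of
   distributions: a locally finite positive Borel measure with
   int u (Lap phi) dm2 = 2 pi int phi dmu for all test functions phi. *)
Definition riesz_measure {R : realType} (u : R * R -> \bar R)
  (mu : {measure set (R * R) -> \bar R}) : Prop :=
  (forall t : R, (mu [set z : R * R | (z.1 ^+ 2 + z.2 ^+ 2 <= t ^+ 2)%R] < +oo)%E) /\
  forall phi : R * R -> R, test_function phi ->
    (\int[leb2]_z (u z * (laplacian phi z)%:E) =
     (2 * pi)%:E * \int[mu]_z (phi z)%:E)%E.

(* (u, v) is the canonical representation of U = u - v: u, v subharmonic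
   whose Riesz measures are the positive and negative variations of the
   Riesz charge Delta_u - Delta_v, i.e. are carried by the two parts of a
   Hahn decomposition (mutually singular). U is the difference u - v at every
   point where u and v are not both -oo. *)
Definition canonical_rep {R : realType} (U u v : R * R -> \bar R) : Prop :=
  [/\ subharmonic u, subharmonic v,
      (exists (mu nu : {measure set (R * R) -> \bar R}),
         [/\ riesz_measure u mu, riesz_measure v nu &
             exists P : set (R * R), [/\ measurable P, mu (~` P) = 0%E
                                                     & nu P = 0%E]])
    & (forall z, u z != -oo%E \/ v z != -oo%E -> U z = (u z - v z)%E)].

Definition charT {R : realType} (u v : R * R -> \bar R) (s t : R) : \bar R :=
  (Cmean (fun z => maxe (u z) (v z)) t - Cmean (fun z => maxe (u z) (v z)) s)%E.

Definition factorE {R : realType} (E : set (LebT R)) (q r k : R) : R :=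
  if mes E == 0 then 0
  else (mes E) `^ (q^-1) / r * ln (4 * k * r / mes E).

(* Main.v *)
(** Put [b = k r].  For subharmonic [v <= V] the core estimate bounds the
    integral over [E] of [|g| sup_{|z|=t} (V - v)] by a constant times
    [C_V(b) - C_v(r0)].  The first inequality is the case [V = max(u, v)], where
    [U^+ <= V - v]; the second is the case [V = w^+], [v = w], since
    [|w| = (V - v) + w^+] and the maximum principle controls [w^+].

    The core estimate avoids Riesz measures.  Let [M_d] be the mean over circles
    of radius [d] and [ell d = ln^+ (d / |.|)].  For the Green function of the
    disc of radius [b] one has
    [M_d G_z + ell d (. - z) <= G_z + C M_b (ell d)], and [M_d] is self-adjoint for
    plane measure; so the gap between two bounded submean functions
    [f <= g], weighted by [ell d (. - z)], is at most the integral of [G_z] against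
    the nonnegative defect [M_d f - f] plus a boundary term.  Likewise the
    integral of [ln (b / max(|.|, r0))] against the defect is a difference of
    circle means.  Now [G_z] is dominated by a kernel in [|z|] and [|y|], whose
    integral over [E] against [|g|] is at most a constant times
    [ln (b / max(|y|, r0))], by Holder's inequality.  Apply this to truncations of
    [v] and [V], let [d -> 0], and remove the truncation by Fatou's lemma. *)

Require Import Defs.
From HB Require Import structures.
From mathcomp Require Import all_boot all_order all_algebra.
From mathcomp Require Import all_classical all_reals all_analysis.
From mathcomp Require Import measurable_realfun ring lra zify.
Import Order.TTheory GRing.Theory Num.Theory.
Import numFieldNormedType.Exports.
Local Open Scope classical_set_scope.
Local Open Scope ring_scope.
Set Implicit Arguments. Unset Strict Implicit. Unset Printing Implicit Defensive.

(** * Plane and circle measures *)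

(** Two features of the statement shape the proof. [U] is prescribed only where [u] and [v] are not
    both -oo, and on a circle that meets the set [v = -oo] the gap [V - v] bounds nothing; the radii
    of such circles must be shown negligible in [E]. This comes from the core estimate itself,
    applied to the pair [v <= max(v, 0)], whose gap is +oo at those points. Moreover circle suprema
    of [U] need not be measurable, so their integrals are only ever compared with those of
    measurable majorants. At a positive scale [d] the distributional Laplacian becomes the
    difference [M_d f - f] of bounded functions. The function [ell d] is what a logarithmic pole
    loses under [M_d]; divided by its mass it is an approximate identity, so the smoothed gap
    controls [V - v] in the limit. The factor 4 serves both the boundary behaviour of the Green
    function, at most [4 b / (b - r)] times [ln (b / |y|)] near the circle, and the kernel integral,
    where numerical bounds for logarithms just suffice. In the second inequality 5 is 4 + 1, the 1
    paying for the extra [w^+]. *)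

Section nonmeasurable.
Local Open Scope ereal_scope.

Import HBNNSimple.
(** The integral of a nonnegative function is a supremum over simple minorants, so monotonicity
    needs no measurability. Circle suprema of an arbitrary [U] require this form. *)
Lemma ge0_le_integral_nonmeasurable d (T : measurableType d) (R : realType)
    (mu : {measure set T -> \bar R}) (D : set T) (f g : T -> \bar R) :
  (forall x, D x -> 0 <= f x) -> (forall x, D x -> f x <= g x) ->
  \int[mu]_(x in D) f x <= \int[mu]_(x in D) g x.
Proof.
move=> f0 fg; rewrite !ge0_integralE//; last by move=> x Dx; exact/(le_trans (f0 _ Dx))/fg.
apply: ereal_sup_le => _ [h /= hf <-] /=.
exists h => // x; apply: (le_trans (hf x)).
by rewrite !patchE; case: ifPn => // /set_mem; exact: fg.
Qed.

End nonmeasurable.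

Section transport.
Local Open Scope ereal_scope.
Context d1 d2 (T1 : measurableType d1) (T2 : measurableType d2) (R : realType).
Variables (m1 : {measure set T1 -> \bar R}) (m2 : {measure set T2 -> \bar R}).
Variables (phi : T1 -> T2) (mphi : measurable_fun setT phi).

Lemma ge0_integral_transport (c : {nonneg R}) (f : T2 -> \bar R) :
  (forall A, measurable A -> m2 A = c%:num%:E * m1 (phi @^-1` A)) ->
  measurable_fun setT f -> (forall x, 0 <= f x) ->
  \int[m2]_x f x = c%:num%:E * \int[m1]_x f (phi x).
Proof.
move=> m21 mf f0.
pose phi' : {mfun T1 >-> T2} := HB.pack phi (isMeasurableFun.Build _ _ _ _ phi mphi).
rewrite -(preimage_setT phi) -[in RHS](ge0_integral_pushforward mphi)//.
rewrite (eq_measure_integral (mscale c (pushforward m1 phi')))//.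
  by rewrite ge0_integral_mscale.
by move=> A mA _; exact: m21.
Qed.

End transport.

Section line.
Local Open Scope ereal_scope.
Context {R : realType}.
Local Notation mu := (@lebesgue_measure R).
Local Notation mR := (measurableTypeR R).

Lemma measurable_cos : measurable_fun setT (@cos R).
Proof. by apply: continuous_measurable_fun => ?; exact: continuous_cos. Qed.

Lemma measurable_sin : measurable_fun setT (@sin R).
Proof. by apply: continuous_measurable_fun => ?; exact: continuous_sin. Qed.

Lemma lebesgue_affine (k b : R) (f : R -> \bar R) : (0 < k)%R ->
  measurable_fun setT f -> (forall x, 0 <= f x) ->
  \int[mu]_x f x = k%:E * \int[mu]_x f (k * x + b)%R.
Proof.
move=> k0 mf f0.
have mphi : measurable_fun setT (fun x : mR => (k * x + b)%R : mR).
  by apply: measurable_funD => //; exact: measurable_funM.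
pose phi : {mfun mR >-> mR} := HB.pack (fun x : mR => (k * x + b)%R : mR) (isMeasurableFun.Build _ _ _ _ _ mphi).
apply: (@ge0_integral_transport _ _ mR mR R mu mu (fun x => (k * x + b)%R) mphi (NngNum (ltW k0))) => //= A mA.
apply: (@lebesgue_measure_unique R (mscale (NngNum (ltW k0)) (pushforward mu phi))) => //.
move=> _ [[x y]] _ <-; rewrite /mscale/= /pushforward /=.
rewrite [X in _ = _ * mu X](_ : _ = [set` `]((x - b) / k)%R, ((y - b) / k)%R]%R]); last first.
  by apply/seteqP; split=> z /=; rewrite !in_itv/= ltr_pdivrMr// ler_pdivlMr// (mulrC z) ltrBlDr lerBrDr.
rewrite !lebesgue_measure_itv/= !lte_fin ltr_pM2r ?invr_gt0// ltrD2r.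
case: ifPn => xy; last by rewrite mule0.
by rewrite -!EFinD -EFinM -mulrBl opprB addrA subrK mulrCA divff ?gt_eqF// mulr1.
Qed.

Lemma lebesgue_translation (b : R) (f : R -> \bar R) :
  measurable_fun setT f -> (forall x, 0 <= f x) ->
  \int[mu]_x f (x + b)%R = \int[mu]_x f x.
Proof.
move=> mf f0; rewrite [RHS](@lebesgue_affine 1 b)// mul1e.
by under [RHS]eq_integral do rewrite mul1r.
Qed.

End line.

Section plane.
Local Open Scope ereal_scope.
Context {R : realType}.
Local Notation mu := (@lebesgue_measure R).
Local Notation mR := (measurableTypeR R).

(** A separate name lets the product measure carry a sigma-finite instance, so that Fubini applies
    to products of the plane with the circle or with the space of radii. *)
Definition plane : set (mR * mR) -> \bar R := (mu \x mu).
HB.instance Definition _ := Measure.on plane.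

Lemma plane_box (A B : set mR) : measurable A -> measurable B ->
  plane (A `*` B) = mu A * mu B.
Proof. by move=> mA mB; rewrite /plane product_measure1E. Qed.

Let plane_sigma_finite : sigma_finite setT plane.
Proof.
exists (fun n : nat => `[(- n%:R)%R, n%:R] `*` `[(- n%:R)%R, n%:R]).
  rewrite predeqE => -[x y]; split=> // _.
  have h (z : R) : exists n : nat, forall m, (n <= m)%N -> (- m%:R <= z <= m%:R)%R.
    exists (Num.truncn `|z|%R).+1 => m nm; rewrite -ler_norml.
    by rewrite (le_trans (ltW (truncnS_gt _)))// ler_nat.
  have [n hn] := h x; have [m hm] := h y.
  exists (maxn n m) => //=; split => /=; rewrite in_itv/=.
    exact/hn/leq_maxl.
  exact/hm/leq_maxr.
move=> n; split; first exact: measurableX.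
by rewrite plane_box//= lebesgue_measure_itv/=; case: ifP => _; rewrite ?mul0e// -EFinD -EFinM ltry.
Qed.

HB.instance Definition _ := Measure_isSigmaFinite.Build _ _ _ plane plane_sigma_finite.

Lemma two_pi_gt0 : (0 < 2 * @pi R)%R.
Proof. by rewrite mulr_gt0// pi_gt0. Qed.

(* Normalized arc length on the unit circle, parametrized by the angle. *)
Definition circ_prob : set mR -> \bar R := uniform_prob two_pi_gt0.
HB.instance Definition _ := Measure.on circ_prob.
HB.instance Definition _ := @Measure_isProbability.Build _ _ R circ_prob (@probability_setT _ _ _ (uniform_prob two_pi_gt0)).

Lemma circ_prob_setT : circ_prob setT = 1. Proof. exact: probability_setT. Qed.

(** The sigma-algebra is generated by rectangles, so an open set has to be exhausted by countably
    many of them: the squares with rational centre and half-side [1/(n+1)] that it contains. *)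
Lemma open_plane_measurable (A : set (R * R)) : open A -> measurable A.
Proof.
move=> oA.
pose bx (i : rat * rat * nat) : set (R * R) :=
  [set z | `|z.1 - ratr i.1.1| < i.2.+1%:R^-1 /\ `|z.2 - ratr i.1.2| < i.2.+1%:R^-1]%R.
have mbx i : measurable (bx i).
  have m1 (q : R) (e : R) : measurable [set x : R | `|x - q| < e]%R.
    rewrite [X in measurable X](_ : _ = `](q - e)%R, (q + e)%R[%classic)//.
    by apply/seteqP; split => x /=; rewrite in_itv/= ltr_distl.
  rewrite [X in measurable X](_ : _ = [set x : R | `|x - ratr i.1.1| < i.2.+1%:R^-1]%R
     `*` [set x : R | `|x - ratr i.1.2| < i.2.+1%:R^-1]%R)//.
  by apply: measurableX.
rewrite (_ : A = \bigcup_(i : rat * rat * nat) (if `[< bx i `<=` A >] then bx i else set0)).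
  apply: countable_bigcupT_measurable => [|i]; first exact: countableP.
  by case: ifP.
apply/seteqP; split => [z Az|z [i _]]; last by case: ifP => [/asboolP sub /sub|].
have /nbhs_ballP[e /= e0 eA] : nbhs z A by move: oA; rewrite openE; apply.
have [n ne] : exists n : nat, (n.+1%:R^-1 < e / 2 :> R)%R.
  exists (Num.truncn (e / 2)^-1)%R; rewrite invf_plt ?posrE ?divr_gt0//; exact: truncnS_gt.
have hq (x : R) : exists q : rat, (`|x - ratr q| < n.+1%:R^-1)%R.
  have /rat_in_itvoo[q] : (x - n.+1%:R^-1 < x + n.+1%:R^-1)%R by rewrite ltrD2l gtrN ?invr_gt0.
  by rewrite in_itv/= => hq; exists q; rewrite ltr_distlC.
have [q1 hq1] := hq z.1; have [q2 hq2] := hq z.2.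
exists (q1, q2, n) => //; rewrite ifT; first by split.
apply/asboolP => w [/= w1 w2]; apply: eA; split; rewrite /ball/=.
  by rewrite (le_lt_trans (ler_distD (ratr q1) _ _))// (splitr e) ltrD ?(lt_trans hq1)// distrC (lt_trans w1).
by rewrite (le_lt_trans (ler_distD (ratr q2) _ _))// (splitr e) ltrD ?(lt_trans hq2)// distrC (lt_trans w2).
Qed.

Lemma usc_measurable (f : R * R -> \bar R) :
  (forall z (c : R), f z < c%:E -> \forall w \near z, f w < c%:E) ->
  measurable_fun setT f.
Proof.
move=> uf; apply: (measurability _ (ErealGenInftyO.measurableE R)).
move=> /= _ [_ [a ->]] <-; rewrite setTI; apply: open_plane_measurable.
rewrite openE => z /=; rewrite in_itv/= => /uf.
by apply: filterS => w /=; rewrite in_itv.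
Qed.

Lemma ge0_plane_integral (f : R * R -> \bar R) :
  measurable_fun setT f -> (forall x, 0 <= f x) ->
  \int[plane]_z f z = \int[mu]_x \int[mu]_y f (x, y).
Proof. by move=> mf f0; exact: (@fubini_tonelli1 _ _ mR mR R mu mu f). Qed.

Lemma ge0_plane_integral2 (f : R * R -> \bar R) :
  measurable_fun setT f -> (forall x, 0 <= f x) ->
  \int[plane]_z f z = \int[mu]_y \int[mu]_x f (x, y).
Proof. by move=> mf f0; exact: (@fubini_tonelli2 _ _ mR mR R mu mu f). Qed.

(** A shear only translates each slice. Shears are the building blocks of translations and rotations
    below. *)
Lemma plane_skew1 (h : R -> R) (f : R * R -> \bar R) :
  measurable_fun setT h ->
  measurable_fun setT f -> (forall x, 0 <= f x) ->
  \int[plane]_z f (z.1 + h z.2, z.2)%R = \int[plane]_z f z.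
Proof.
move=> mh mf f0.
rewrite !ge0_plane_integral2//; last first.
  apply: (measurableT_comp mf); apply: measurable_fun_pair => //.
  by apply: measurable_funD => //; exact: measurableT_comp.
apply: eq_integral => y _ /=; rewrite (@lebesgue_translation R (h y) (fun x => f (x, y)))//.
exact: (measurableT_comp mf (pair2_measurable _)).
Qed.

Lemma plane_skew2 (h : R -> R) (f : R * R -> \bar R) :
  measurable_fun setT h ->
  measurable_fun setT f -> (forall x, 0 <= f x) ->
  \int[plane]_z f (z.1, z.2 + h z.1)%R = \int[plane]_z f z.
Proof.
move=> mh mf f0.
rewrite !ge0_plane_integral//; last first.
  apply: (measurableT_comp mf); apply: measurable_fun_pair => //.
  by apply: measurable_funD => //; exact: measurableT_comp.
apply: eq_integral => x _ /=; rewrite (@lebesgue_translation R (h x) (fun y => f (x, y)))//.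
exact: (measurableT_comp mf (pair1_measurable _)).
Qed.

End plane.

Section circle.
Local Open Scope ereal_scope.
Context {R : realType}.
Local Notation mu := (@lebesgue_measure R).
Local Notation mR := (measurableTypeR R).
Implicit Types (f g : R * R -> \bar R) (z w : R * R).

Lemma plane_translation (a : R * R) f :
  measurable_fun setT f -> (forall x, 0 <= f x) ->
  \int[plane]_z f (z.1 + a.1, z.2 + a.2)%R = \int[plane]_z f z.
Proof.
move=> mf f0; rewrite (@plane_skew1 R (cst a.1) (fun z => f (z.1, z.2 + a.2)%R))//=.
  by rewrite (@plane_skew2 R (cst a.2)).
apply: (measurableT_comp mf); apply: measurable_fun_pair => //.
by apply: measurable_funD.
Qed.

Definition rotp (t : R) z : R * R :=
  (z.1 * cos t - z.2 * sin t, z.1 * sin t + z.2 * cos t)%R.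

Lemma measurable_rot t : measurable_fun setT (rotp t).
Proof.
apply: measurable_fun_pair.
  by apply: measurable_funB; apply: measurable_funM.
by apply: measurable_funD; apply: measurable_funM.
Qed.

(** A rotation is a product of three shears: horizontal by [a], vertical by [sin t], horizontal by
    [a], where [a = (cos t - 1) / sin t = - tan (t/2)]. No Jacobian is involved. *)
Let plane_rot_sin t f : sin t != 0%R ->
  measurable_fun setT f -> (forall x, 0 <= f x) ->
  \int[plane]_z f (rotp t z) = \int[plane]_z f z.
Proof.
move=> st mf f0; pose a := ((cos t - 1) / sin t)%R.
have mL (c : R) : measurable_fun setT (fun x : R => c * x)%R by exact: measurable_funM.
pose f1 z := f (z.1 + a * z.2, z.2)%R.
have mf1 : measurable_fun setT f1.
  by apply: (measurableT_comp mf); apply: measurable_fun_pair => //; apply: measurable_funD => //; exact: measurable_funM.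
pose f2 z := f1 (z.1, z.2 + sin t * z.1)%R.
have mf2 : measurable_fun setT f2.
  by apply: (measurableT_comp mf1); apply: measurable_fun_pair => //; apply: measurable_funD => //; exact: measurable_funM.
transitivity (\int[plane]_z f2 (z.1 + a * z.2, z.2)%R).
  apply: eq_integral => z _; rewrite /f2 /f1/= /rotp/=; congr (f (_, _)).
    have h : (a * sin t = cos t - 1)%R by rewrite /a divfK.
    have h2 : (a * (1 + cos t) = - sin t)%R.
      apply: (mulfI st); rewrite mulrA (mulrC _ a) h.
      by rewrite mulrN -expr2 sin2cos2; ring.
    transitivity (z.1 * (1 + a * sin t) + z.2 * (a * (1 + (1 + a * sin t))))%R; last by ring.
    by rewrite h !(addrC 1%R) !subrK (addrC (cos t)) h2 mulrN.
  have h : (sin t * a = cos t - 1)%R by rewrite /a mulrC divfK.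
  by rewrite mulrDr mulrA h; ring.
etransitivity; first exact: (@plane_skew1 R (fun y => a * y)%R f2 (mL a) mf2 (fun z => f0 _)).
etransitivity; first exact: (@plane_skew2 R (fun y => sin t * y)%R f1 (mL _) mf1 (fun z => f0 _)).
exact: (@plane_skew1 R (fun y => a * y)%R f (mL a) mf f0).
Qed.

Lemma plane_rot t f :
  measurable_fun setT f -> (forall x, 0 <= f x) ->
  \int[plane]_z f (rotp t z) = \int[plane]_z f z.
Proof.
move=> mf f0; have [st|] := eqVneq (sin t) 0%R; last by move=> st; exact: plane_rot_sin.
have : (cos t ^+ 2 = 1)%R by rewrite cos2sin2 st expr0n/= subr0.
move/eqP; rewrite sqrf_eq1 => /orP[|] /eqP ct.
  by apply: eq_integral => -[x y] _; rewrite /rotp/= st ct !mulr1 !mulr0 subr0 add0r.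
(* What is left is the half-turn, the square of a quarter-turn. *)
have s2 : sin (pi / 2 : R) != 0%R by rewrite sin_pihalf oner_neq0.
transitivity (\int[plane]_z (f \o rotp (pi / 2)) (rotp (pi / 2) z)).
  apply: eq_integral => -[x y] _; rewrite /rotp/= st ct cos_pihalf sin_pihalf/=.
  by congr (f (_, _)); ring.
rewrite (plane_rot_sin s2)//; first exact: plane_rot_sin.
- exact: (measurableT_comp mf (measurable_rot _)).
- by move=> x; exact: f0.
Qed.

Definition per2pi (T : Type) (f : R -> T) := forall x, f (x + 2 * pi)%R = f x.

Lemma circ_probE (f : R -> \bar R) : measurable_fun setT f -> (forall x, 0 <= f x) ->
  \int[circ_prob]_x f x = ((2 * pi)^-1)%:E * \int[mu]_(x in @circ_dom R) f x.
Proof.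
move=> mf f0; rewrite /circ_prob integral_uniform// subr0.
by rewrite /circ_dom.
Qed.

Let shift_itv (a c d : R) (f : R -> \bar R) : measurable_fun setT f -> (forall x, 0 <= f x) ->
  \int[mu]_(x in `[c, d[%classic) f (x + a)%R = \int[mu]_(x in `[(c + a)%R, (d + a)%R[%classic) f x.
Proof.
move=> mf f0; rewrite integral_mkcond [RHS]integral_mkcond.
rewrite -(@lebesgue_translation R a (f \_ `[(c + a)%R, (d + a)%R[))//.
- apply: eq_integral => x _; rewrite !patchE.
  rewrite (_ : (x + a \in `[(c + a), (d + a)[%classic)%R = (x \in `[c, d[%classic))//.
  by apply/idP/idP; rewrite !inE/= !in_itv/= lerD2r ltrD2r.
- by apply/(measurable_restrictT _ _).1 => //; exact: measurable_funTS.
- by move=> x; exact: erestrict_ge0.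
Qed.

Let circ_co (f : R -> \bar R) : measurable_fun setT f -> (forall x, 0 <= f x) ->
  \int[circ_prob]_x f x = ((2 * pi)^-1)%:E * \int[mu]_(x in `[0%R, (2 * pi)%R[%classic) f x.
Proof.
move=> mf f0; rewrite circ_probE// /circ_dom; congr (_ * _).
by rewrite -integral_itv_bndo_bndc//; exact: measurable_funTS.
Qed.

Let circ_shift0 (a : R) (f : R -> \bar R) : (0 <= a <= 2 * pi)%R -> per2pi f ->
  measurable_fun setT f -> (forall x, 0 <= f x) ->
  \int[circ_prob]_x f (x + a)%R = \int[circ_prob]_x f x.
Proof.
move=> /andP[a0 a2] pf mf f0.
rewrite !circ_co//; last by apply: (measurableT_comp mf); exact: measurable_funD.
congr (_ * _); rewrite shift_itv// add0r.
have U (x y z : R) : (x <= y)%R -> (y <= z)%R -> \int[mu]_(x in `[x, z[%classic) f x =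
   \int[mu]_(x in `[x, y[%classic) f x + \int[mu]_(x in `[y, z[%classic) f x.
  move=> xy yz; rewrite -ge0_integral_setU//.
  - by congr integral; apply: (@itv_bndbnd_setU _ _ (BLeft x) (BLeft y) (BLeft z)).
  - exact: measurable_funTS.
  - by apply/disj_setPS => t [/=]; rewrite !in_itv/= => /andP[_ h1] /andP[h2 _]; move: (lt_le_trans h1 h2); rewrite ltxx.
rewrite (U a (2 * pi)%R)//; last by rewrite lerDl.
rewrite [RHS](U 0%R a)// addeC; congr (_ + _).
rewrite -{1}(add0r (2 * pi)%R) (addrC (2 * pi)%R a) -shift_itv//.
by apply: eq_integral => x _; rewrite pf.
Qed.

Lemma circ_shift (a : R) (f : R -> \bar R) : per2pi f ->
  measurable_fun setT f -> (forall x, 0 <= f x) ->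
  \int[circ_prob]_x f (x + a)%R = \int[circ_prob]_x f x.
Proof.
have pos (b : R) (g : R -> \bar R) : (0 <= b)%R -> per2pi g ->
    measurable_fun setT g -> (forall x, 0 <= g x) ->
    \int[circ_prob]_x g (x + b)%R = \int[circ_prob]_x g x.
  move=> b0 pg mg g0.
  have [n hn] : exists n : nat, (b <= n%:R * (2 * pi))%R.
    exists (Num.truncn (b / (2 * pi))).+1.
    by rewrite -ler_pdivrMr ?two_pi_gt0// ltW// truncnS_gt.
  elim: n b b0 hn => [b b0|n IH b b0 hn].
    by rewrite mul0r => b1; have -> : b = 0%R; [apply/eqP; rewrite eq_le b0 b1|under eq_integral do rewrite addr0].
  have [b2|b2] := leP b (2 * pi)%R; first by apply: circ_shift0 => //; apply/andP.
  have b0' : (0 <= b - 2 * pi)%R by rewrite subr_ge0 ltW.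
  have b2' : (b - 2 * pi <= n%:R * (2 * pi))%R by move: hn; rewrite -natr1 mulrDl mul1r -lerBlDr.
  rewrite -(IH _ b0' b2').
  by apply: eq_integral => x _; rewrite -[RHS]pg -addrA subrK.
move=> pf mf f0; have [a0|a0] := leP 0%R a; first exact: pos.
rewrite -(pos (- a)%R (fun x => f (x + a)%R)) ?oppr_ge0 1?ltW//.
- by apply: eq_integral => x _; rewrite subrK.
- by move=> x; rewrite addrAC pf.
- by apply: (measurableT_comp mf); exact: measurable_funD.
Qed.

(** Doubling the angle runs twice through the circle. This drives the duplication argument for the
    logarithmic mean. *)
Lemma circ_double (f : R -> \bar R) : per2pi f ->
  measurable_fun setT f -> (forall x, 0 <= f x) ->
  \int[circ_prob]_x f (2 * x)%R = \int[circ_prob]_x f x.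
Proof.
move=> pf mf f0.
have m2 : measurable_fun setT (fun x : R => f (2 * x)%R) by apply: (measurableT_comp mf); exact: measurable_funM.
rewrite !circ_co//; congr (_ * _).
have tp := @two_pi_gt0 R.
have -> : \int[mu]_(x in `[0%R, (2 * pi)%R[%classic) f (2 * x)%R = 2^-1%:E * \int[mu]_(x in `[0%R, (2 * (2 * pi))%R[%classic) f x.
  rewrite integral_mkcond [in RHS]integral_mkcond.
  rewrite (@lebesgue_affine R 2 0%R (f \_ _))//.
  - rewrite muleA -EFinM mulVf// mul1e.
    apply: eq_integral => x _; rewrite !patchE addr0.
    rewrite (_ : (2 * x \in `[0, (2 * (2 * pi))[%classic)%R = (x \in `[0%R, (2 * pi)%R[%classic))//.
    by apply/idP/idP; rewrite !inE/= !in_itv/= pmulr_rge0// ltr_pM2l.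
  - by apply/(measurable_restrictT _ _).1 => //; exact: measurable_funTS.
  - by move=> x; exact: erestrict_ge0.
rewrite (_ : `[0%R, (2 * (2 * pi))%R[%classic = `[0%R, (2 * pi)%R[%classic `|` `[(2 * pi)%R, (2 * pi + 2 * pi)%R[%classic); last first.
  rewrite [RHS](_ : _ = `[0%R, (2 * pi + 2 * pi)%R[%classic); last first.
    apply/esym/(@itv_bndbnd_setU _ _ (BLeft 0%R) (BLeft (2 * pi)%R) (BLeft (2 * pi + 2 * pi)%R)); first exact: ltW.
    have h : (2 * pi <= 2 * pi + 2 * pi :> R)%R by rewrite lerDl ltW.
    exact: h.
  by rewrite (_ : (2 * (2 * pi) = 2 * pi + 2 * pi :> R)%R)//; ring.
rewrite ge0_integral_setU//; last 2 first.
- exact: measurable_funTS.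
- by apply/disj_setPS => t [/=]; rewrite !in_itv/= => /andP[_ h1] /andP[h2 _]; move: (lt_le_trans h1 h2); rewrite ltxx.
have -> : \int[mu]_(x in `[(2 * pi)%R, (2 * pi + 2 * pi)%R[%classic) f x = \int[mu]_(x in `[0%R, (2 * pi)%R[%classic) f x.
  rewrite -{1}(add0r (2 * pi)%R) -shift_itv//.
  by apply: eq_integral => x _; rewrite pf.
rewrite -[X in X + X]mul1e -ge0_muleDl ?lee01//.
by rewrite muleA -EFinD -EFinM mulVf ?mul1e// pnatr_eq0.
Qed.

End circle.

(** * Logarithmic means *)

Section liminf.
Local Open Scope ereal_scope.

Lemma le_from_reals_below (R : realType) (x y : \bar R) :
  (forall c : R, c%:E < x -> c%:E <= y) -> x <= y.
Proof.
move=> h; rewrite leNgt; apply/negP.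
case: x y h => [r||] [s||]//= h; rewrite ?lte_fin => sr.
- have /h : ((s + r) / 2)%:E < r%:E by rewrite lte_fin midf_lt.
  by rewrite lee_fin leNgt midf_lt.
- by have := h (r - 1)%R; rewrite lte_fin ltrBlDr ltrDl ltr01 => /(_ isT).
- by have := h (s + 1)%R (ltry _); rewrite lee_fin leNgt ltrDl ltr01.
- by have := h 0%R (ltry _).
Qed.

Lemma limn_einf_ge (R : realType) (u : (\bar R)^nat) (x : \bar R) :
  (forall c : R, c%:E < x -> \forall n \near \oo, c%:E <= u n) -> x <= limn_einf u.
Proof.
move=> h; apply: le_from_reals_below => c /h[N _ hN].
rewrite limn_einf_lim (cvg_lim _ (@cvg_einfs_sup _ _))//.
apply: (@le_trans _ _ (einfs u N)); last by apply: ereal_sup_ubound; exists N.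
by apply: le_ereal_inf_tmp => _ [m /= Nm <-]; exact: hN.
Qed.

Lemma limn_einf_le (R : realType) (u : (\bar R)^nat) (x : \bar R) :
  (forall n, exists2 m, (n <= m)%N & u m <= x) -> limn_einf u <= x.
Proof.
move=> h; rewrite limn_einf_lim (cvg_lim _ (@cvg_einfs_sup _ _))//.
apply: ge_ereal_sup => _ [n _ <-]; have [m nm um] := h n.
by rewrite (le_trans _ um)//; apply: ereal_inf_lbound; exists m.
Qed.

End liminf.

Section modulus.
Local Open Scope ereal_scope.
Context {R : realType}.
Implicit Types (z w : R * R).

Definition nrm z : R := Num.sqrt (z.1 ^+ 2 + z.2 ^+ 2)%R.

Lemma nrm_ge0 z : (0 <= nrm z)%R. Proof. exact: sqrtr_ge0. Qed.

Lemma nrm_sqr z : (nrm z ^+ 2 = z.1 ^+ 2 + z.2 ^+ 2)%R.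
Proof. by rewrite sqr_sqrtr// addr_ge0 ?sqr_ge0. Qed.

Lemma nrm_eq0 z : (nrm z == 0)%R = (z == (0, 0)%R).
Proof.
rewrite -sqrf_eq0 nrm_sqr paddr_eq0 ?sqr_ge0// !sqrf_eq0.
by case: z => x y; rewrite xpair_eqE.
Qed.

Lemma nrm_polar (t a : R) : nrm (t * cos a, t * sin a)%R = `|t|%R.
Proof.
by rewrite /nrm/= !exprMn -mulrDr cos2Dsin2 mulr1 sqrtr_sqr.
Qed.

Lemma polar z : exists a : R, z = (nrm z * cos a, nrm z * sin a)%R.
Proof.
have [z0|z0] := eqVneq (nrm z) 0%R.
  by exists 0%R; rewrite z0 !mul0r; apply/eqP; rewrite -nrm_eq0 z0.
have n0 : (0 < nrm z)%R by rewrite lt0r z0 nrm_ge0.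
have h1 : (`|z.1 / nrm z| <= 1)%R.
  rewrite normrM normfV (ger0_norm (nrm_ge0 z)) ler_pdivrMr// mul1r.
  by rewrite -ler_sqr ?nnegrE ?nrm_ge0// nrm_sqr real_normK ?num_real// lerDl sqr_ge0.
have hc : (-1 <= z.1 / nrm z <= 1)%R by rewrite -ler_norml.
have c1 : z.1 = (nrm z * cos (acos (z.1 / nrm z)))%R.
  by rewrite acosK// mulrC divfK.
have s1 : (`|z.2| = nrm z * sin (acos (z.1 / nrm z)))%R.
  rewrite sin_acos//.
  rewrite -[X in _ = (X * _)%R](ger0_norm (nrm_ge0 z)) -(sqrtr_sqr (nrm z)) -sqrtrM ?sqr_ge0//.
  rewrite mulrBr mulr1 -exprMn mulrCA divff// mulr1 nrm_sqr addrAC subrr add0r.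
  by rewrite sqrtr_sqr.
have [z2|z2] := leP 0%R z.2.
  exists (acos (z.1 / nrm z)); rewrite -s1 -c1 ger0_norm//; by case: z {z0 n0 h1 hc c1 s1 z2}.
exists (- acos (z.1 / nrm z))%R; rewrite cosN sinN mulrN -s1 -c1 ltr0_norm// opprK.
by case: z {z0 n0 h1 hc c1 s1 z2}.
Qed.

Lemma nrm_triangle z w : (nrm (z + w)%R <= nrm z + nrm w)%R.
Proof.
rewrite -ler_sqr ?nnegrE ?addr_ge0 ?nrm_ge0//.
rewrite sqrrD !nrm_sqr/=.
have cs : (z.1 * w.1 + z.2 * w.2 <= nrm z * nrm w)%R.
  rewrite -[leLHS]mul1r; apply: (le_trans (ler_norm _)).
  rewrite mul1r -(ger0_norm (mulr_ge0 (nrm_ge0 z) (nrm_ge0 w))) -ler_sqr ?nnegrE//.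
  rewrite !real_normK ?num_real// exprMn !nrm_sqr.
  have := sqr_ge0 (z.1 * w.2 - z.2 * w.1)%R; rewrite -subr_ge0 => h.
  rewrite -subr_ge0 (le_trans h)// le_eqVlt; apply/orP; left; apply/eqP; ring.
rewrite -mulr_natr; move: cs; set p := (nrm z * nrm w)%R => cs.
rewrite -subr_ge0.
have -> : (z.1 ^+ 2 + z.2 ^+ 2 + p * 2 + (w.1 ^+ 2 + w.2 ^+ 2) - ((z.1 + w.1) ^+ 2 + (z.2 + w.2) ^+ 2) = 2 * (p - (z.1 * w.1 + z.2 * w.2)))%R by ring.
by rewrite mulr_ge0// subr_ge0.
Qed.

Lemma nrmN z : nrm (- z)%R = nrm z.
Proof. by rewrite /nrm/= !sqrrN. Qed.

Lemma nrm_distl z w : (nrm z - nrm w <= nrm (z - w))%R.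
Proof. by rewrite lerBlDr -{1}(subrK w z) nrm_triangle. Qed.

Lemma nrm_dist z w : (`|nrm z - nrm w| <= nrm (z - w))%R.
Proof.
rewrite ler_norml nrm_distl andbT lerNl opprB (le_trans (nrm_distl _ _))//.
by rewrite -nrmN opprB.
Qed.

Lemma nrm_rot t z : nrm (rotp t z) = nrm z.
Proof.
rewrite /nrm /rotp/=; congr Num.sqrt.
have /eqP := cos2Dsin2 t; rewrite eq_sym => /eqP h.
transitivity ((z.1 ^+ 2 + z.2 ^+ 2) * (cos t ^+ 2 + sin t ^+ 2))%R; last by rewrite -h mulr1.
ring.
Qed.

Lemma measurable_nrm : measurable_fun setT nrm.
Proof.
apply: (measurableT_comp (f := @Num.sqrt R)).
  by apply: continuous_measurable_fun => x; exact: sqrt_continuous.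
by apply: measurable_funD; apply: measurable_funX.
Qed.

End modulus.

Section log_mean.
Local Open Scope ereal_scope.
Context {R : realType}.
Local Notation mu := (@lebesgue_measure R).
Implicit Types (z w : R * R).

(* [phi0 b y] is [ln 4 - ln |1 + b e^{iy}|^2], with its true value +oo at a zero *)
Let sq (b y : R) : R := (1 + b ^+ 2 + 2 * b * cos y)%R.
Let phi0 (b y : R) : \bar R := if (sq b y == 0)%R then +oo else (ln 4 - ln (sq b y))%:E.

Let sq_ge0 b y : (`|b| <= 1 -> 0 <= sq b y)%R.
Proof.
move=> b1; rewrite /sq.
have -> : (1 + b ^+ 2 + 2 * b * cos y = (1 + b * cos y) ^+ 2 + b ^+ 2 * (1 - cos y ^+ 2))%R by ring.
by rewrite addr_ge0 ?sqr_ge0// mulr_ge0 ?sqr_ge0// subr_ge0.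
Qed.

Let sq_le4 b y : (`|b| <= 1 -> sq b y <= 4)%R.
Proof.
move=> b1; rewrite /sq.
have h1 : (b ^+ 2 <= 1)%R by rewrite -(real_normK (num_real b)) expr_le1.
have h2 : (b * cos y <= 1)%R.
  rewrite (le_trans (ler_norm _))// normrM mulr_ile1//.
  by rewrite ler_norml cos_geN1 cos_le1.
lra.
Qed.

Let phi0_ge0 b y : (`|b| <= 1)%R -> 0 <= phi0 b y.
Proof.
move=> b1; rewrite /phi0; case: ifPn => // s0; rewrite lee_fin subr_ge0.
by rewrite ler_ln ?posrE// ?sq_le4// lt0r s0 sq_ge0.
Qed.

Let measurable_phi0 b : measurable_fun setT (phi0 b).
Proof.
have ms : measurable_fun setT (sq b).
  apply: measurable_funD => //; apply: measurable_funM => //; exact: measurable_cos.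
apply: measurable_fun_if => //=.
- exact: (measurable_fun_eqr).
- apply: measurable_funTS; apply/measurable_EFinP; apply: measurable_funB => //.
  exact: (measurableT_comp (@measurable_ln R)).
Qed.

(** This is [(1 + b e^{iy}) (1 - b e^{iy}) = 1 - b^2 e^{2iy}] in logarithmic form; at a zero both
    sides are +oo. *)
Let phi0_double b y : (`|b| <= 1)%R ->
  phi0 b y + phi0 (- b) y = (ln 4)%:E + phi0 (- b ^+ 2) (2 * y).
Proof.
move=> b1.
have nb : (`|- b| <= 1)%R by rewrite normrN.
have E : (sq b y * sq (- b) y = sq (- b ^+ 2) (2 * y))%R.
  have -> : sq (- b ^+ 2) (2 * y) = (1 + (- b ^+ 2) ^+ 2 + 2 * (- b ^+ 2) * (2 * cos y ^+ 2 - 1))%R.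
    have c2 : cos (2 * y) = (2 * cos y ^+ 2 - 1)%R by rewrite mulr_natl mulr2n cosD -!expr2 sin2cos2; ring.
    by rewrite /sq c2.
  by rewrite /sq; ring.
rewrite /phi0 -E mulf_eq0.
have [s1|s1] := eqVneq (sq b y) 0%R; first by rewrite /= addye// ; case: ifP.
have [s2|s2] /= := eqVneq (sq (- b) y) 0%R; first by rewrite addey.
rewrite -!EFinD lnM ?posrE ?lt0r ?s1 ?s2 ?sq_ge0//.
by congr EFin; ring.
Qed.

Let A b : \bar R := \int[circ_prob]_y phi0 b y.

Let A_ge0 b : (`|b| <= 1)%R -> 0 <= A b.
Proof. by move=> b1; apply: integral_ge0 => y _; exact: phi0_ge0. Qed.

Let per_phi0 b : per2pi (phi0 b).
Proof.
move=> x; have e : cos (x + 2 * pi) = cos x by rewrite mulr_natl cosD2pi.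
by rewrite /phi0 /sq e.
Qed.

Let A_opp b : (`|b| <= 1)%R -> A (- b) = A b.
Proof.
move=> b1; rewrite /A -[RHS](@circ_shift R pi _ (@per_phi0 b) (@measurable_phi0 b) (fun y => phi0_ge0 y b1)).
apply: eq_integral => y _; rewrite /phi0.
by have -> : sq b (y + pi) = sq (- b) y by rewrite /sq cosDpi; ring.
Qed.

Let A_double b : (`|b| <= 1)%R -> A b + A b = (ln 4)%:E + A (b ^+ 2).
Proof.
move=> b1; have b2 : (`|b ^+ 2| <= 1)%R by rewrite normrX expr_le1.
have nb : (`|- b| <= 1)%R by rewrite normrN.
have nb2 : (`|- b ^+ 2| <= 1)%R by rewrite normrN.
rewrite -{2}(A_opp b1) -[in RHS](A_opp b2) /A -ge0_integralD//; last 4 first.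
- by move=> y _; exact: phi0_ge0.
- exact: measurable_phi0.
- by move=> y _; exact: phi0_ge0.
- exact: measurable_phi0.
under eq_integral do rewrite phi0_double//.
rewrite ge0_integralD//.
- rewrite integral_cst//= circ_prob_setT mule1; congr (_ + _).
  by apply: (@circ_double R (phi0 (- b ^+ 2))) => // y; exact: phi0_ge0.
- by move=> y _; rewrite lee_fin ln_ge0// ler1n.
- by move=> y _; exact: phi0_ge0.
- by apply: (measurableT_comp (measurable_phi0 _)); exact: measurable_funM.
Qed.

Let A_bound b : (`|b| < 1)%R -> A b <= (ln 4 - ln ((1 - `|b|) ^+ 2))%:E.
Proof.
move=> b1.
have b0 : (0 < (1 - `|b|) ^+ 2)%R by rewrite exprn_gt0// subr_gt0.
apply: (@le_trans _ _ (\int[circ_prob]_(y in [set: R]) (ln 4 - ln ((1 - `|b|) ^+ 2))%:E)).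
  apply: ge0_le_integral_nonmeasurable => y _; first exact/phi0_ge0/ltW.
  have h : ((1 - `|b|) ^+ 2 <= sq b y)%R.
    rewrite /sq sqrrB real_normK ?num_real// expr1n mul1r.
    have : (- `|b| <= b * cos y)%R.
      rewrite lerNl (le_trans (ler_norm _))// normrN normrM ler_piMr// ler_norml cos_geN1 cos_le1//.
    by rewrite -mulr_natr => ?; lra.
  have s0 : (0 < sq b y)%R by exact: lt_le_trans h.
  by rewrite /phi0 gt_eqF// lee_fin lerB// ler_ln// posrE.
by rewrite integral_cst//= circ_prob_setT mule1.
Qed.

(** The excess [E b = A b - ln 4] satisfies [E b = E (b^2) / 2] and is bounded for arguments of
    modulus at most [|b|]; iterating shows that it vanishes. Thus the mean of [ln |1 + b e^{iy}|] is
    0, without power series or Cauchy's formula. *)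
Let A_lt1 b : (`|b| < 1)%R -> A b = (ln 4)%:E.
Proof.
move=> b1.
have fA c : (`|c| < 1)%R -> A c \is a fin_num.
  by move=> c1; rewrite ge0_fin_numE ?A_ge0 1?ltW// (le_lt_trans (A_bound c1))// ltry.
pose E (c : R) : R := (fine (A c) - ln 4)%R.
have EA c : (`|c| < 1)%R -> A c = (E c + ln 4)%:E.
  by move=> c1; rewrite /E subrK fineK// fA.
pose K : R := (ln 4 - ln ((1 - `|b|) ^+ 2))%R.
have ln4 : (0 <= ln 4 :> R)%R by rewrite ln_ge0// ler1n.
have b0 : (0 < (1 - `|b|) ^+ 2)%R by rewrite exprn_gt0// subr_gt0.
have KE c : (`|c| <= `|b|)%R -> (`|E c| <= K)%R.
  move=> cb; have c1 := le_lt_trans cb b1.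
  have c0 : (0 < (1 - `|c|) ^+ 2)%R by rewrite exprn_gt0// subr_gt0.
  have := A_bound c1; rewrite EA// lee_fin => h1.
  have := A_ge0 (ltW c1); rewrite EA// lee_fin => h2.
  have : (ln ((1 - `|b|) ^+ 2) <= ln ((1 - `|c|) ^+ 2))%R.
    by rewrite ler_ln ?posrE//; apply: lerXn2r; rewrite ?nnegrE; lra.
  have : (ln ((1 - `|b|) ^+ 2) <= 0)%R.
    apply: ln_le0; rewrite expr_le1//; last by rewrite subr_ge0 ltW.
  by rewrite /K ler_norml => ? ?; apply/andP; split; lra.
have ED c : (`|c| < 1)%R -> (E c = E (c ^+ 2) / 2)%R.
  move=> c1; have c2 : (`|c ^+ 2| < 1)%R by rewrite normrX exprn_ilt1.
  by have := A_double (ltW c1); rewrite !EA// -!EFinD => -[h]; lra.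
have En n c : (`|c| <= `|b|)%R -> (`|E c| <= K / 2 ^+ n)%R.
  elim: n c => [|n IH] c cb; first by rewrite expr0 divr1 KE.
  have c1 : (`|c| < 1)%R by exact: le_lt_trans b1.
  rewrite ED// (_ : K / 2 ^+ n.+1 = K / 2 ^+ n / 2)%R; last by rewrite exprSr invfM mulrA.
  rewrite normrM normfV (ger0_norm (ler0n _ 2)) ler_wpM2r ?invr_ge0//; apply: IH.
  by rewrite normrX (le_trans _ cb)// expr2 ler_piMr// ltW.
suff E0 : E b = 0%R by rewrite EA// E0 add0r.
apply/eqP; rewrite -normr_eq0 eq_le normr_ge0 andbT; apply/ler_addgt0Pl => e e0; rewrite addr0.
have K0 : (0 <= K)%R by apply: le_trans (KE b _).
have [n hn] : exists n : nat, (K / e < 2 ^+ n)%R.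
  exists (Num.truncn (K / e)).+1; apply: (lt_trans (truncnS_gt _)).
  by rewrite -natrX ltr_nat ltn_expl.
rewrite (le_trans (En n b (lexx _)))// ler_pdivrMr ?exprn_gt0// mulrC.
by rewrite -ler_pdivrMr// ltW.
Qed.

(** For [|b| = 1] the integrand is unbounded. Fatou's lemma along [b (1 - 1/(n+1))] gives an upper
    bound, hence finiteness, and then the duplication identity with [A (b^2) = A b] forces the
    value. *)
Let A_eq b : (`|b| <= 1)%R -> A b = (ln 4)%:E.
Proof.
rewrite le_eqVlt => /orP[/eqP b1|]; last exact: A_lt1.
have le_A : A b <= (ln 4)%:E.
  pose bn (n : nat) : R := (b * (1 - n.+1%:R^-1))%R.
  have bn1 n : (`|bn n| < 1)%R.
    have h0 : (0 < n.+1%:R^-1 :> R)%R by rewrite invr_gt0.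
    have h1 : (n.+1%:R^-1 <= 1 :> R)%R by rewrite invf_le1 ?ler1n.
    by rewrite /bn normrM b1 mul1r; move: (_^-1)%R h0 h1 => e h0 h1; rewrite ger0_norm; lra.
  have cvb : bn @ \oo --> b.
    rewrite -[X in _ --> X]mulr1; apply: cvgMr.
    rewrite -[X in _ --> X]subr0; apply: cvgB; [exact: cvg_cst|exact: cvg_harmonic].
  apply: (@le_trans _ _ (\int[circ_prob]_y limn_einf (fun n => phi0 (bn n) y))).
    apply: ge0_le_integral_nonmeasurable => y _; first by apply: phi0_ge0; rewrite b1.
    apply: limn_einf_ge => c cphi.
    have cs : (fun n => sq (bn n) y) @ \oo --> sq b y.
      apply: cvgD; first by apply: cvgD; [exact: cvg_cst|exact: (cvgM cvb cvb)].
      by apply: cvgMl; apply: cvgMr.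
    have h : (sq b y < 4 * expR (- c))%R.
      move: cphi; rewrite /phi0; case: ifPn => [/eqP -> _|s0].
        by rewrite mulr_gt0// expR_gt0.
      have s0' : (0 < sq b y)%R by rewrite lt0r s0 sq_ge0// b1.
      rewrite lte_fin => h; rewrite -ltr_ln ?posrE ?mulr_gt0 ?expR_gt0//.
      by rewrite lnM ?posrE ?expR_gt0// expRK; lra.
    have : \forall n \near \oo, (sq (bn n) y < 4 * expR (- c))%R.
      exact: (cvgr_lt (sq b y)).
    apply: filterS => n hn; rewrite /phi0.
    have s0' : (0 <= sq (bn n) y)%R by rewrite sq_ge0// ltW.
    case: ifPn => [_|s0]; first by rewrite leey.
    have s1 : (0 < sq (bn n) y)%R by rewrite lt0r s0.
    rewrite lee_fin; move: hn; rewrite -ltr_ln ?posrE ?mulr_gt0 ?expR_gt0//.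
    by rewrite lnM ?posrE ?expR_gt0// expRK => ?; lra.
  apply: (le_trans (fatou _ _ _ _)) => //.
  - by move=> n; exact: measurable_phi0.
  - by move=> n y _; apply: phi0_ge0; exact: ltW.
  - apply: limn_einf_le => n; exists n => //.
    by rewrite -/(A (bn n)) A_lt1.
have fA : A b \is a fin_num.
  by rewrite ge0_fin_numE ?A_ge0 ?b1// (le_lt_trans le_A)// ltry.
have b11 : (`|b| <= 1)%R by rewrite b1.
have b2 : (b ^+ 2 = 1)%R by rewrite -(real_normK (num_real b)) b1 expr1n.
have A1 : A (b ^+ 2) = A b.
  rewrite b2; have [b0|b0] := leP 0%R b; first by rewrite -b1 ger0_norm.
  have -> : b = (-1)%R by rewrite -[b]opprK -(ltr0_norm b0) b1.
  by rewrite A_opp// normr1.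
have := A_double b11; rewrite A1 -(fineK fA) -!EFinD => -[] /addIr ->.
by [].
Qed.

(* The value at [0] is [+oo]; the test is needed because [ln 0 = 0]. *)
Definition logpot (X : R) z : \bar R :=
  if nrm z == 0%R then +oo else (ln X - ln (nrm z))%:E.

Lemma logpot_ge0 X z : (nrm z <= X)%R -> 0 <= logpot X z.
Proof.
rewrite /logpot => zX; case: ifPn => // z0.
have n0 : (0 < nrm z)%R by rewrite lt0r z0 nrm_ge0.
by rewrite lee_fin subr_ge0 ler_ln ?posrE// (lt_le_trans n0).
Qed.

Lemma measurable_logpot X : measurable_fun setT (logpot X).
Proof.
apply: measurable_fun_if => //=.
- by apply: measurable_fun_eqr => //; exact: measurable_nrm.
- apply: measurable_funTS; apply/measurable_EFinP; apply: measurable_funB => //.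
  exact: (measurableT_comp (@measurable_ln R) measurable_nrm).
Qed.

Lemma logpot_mean X (a : R * R) (s c : R) :
  \int[circ_prob]_x logpot X (a.1 + s * cos (x + c), a.2 + s * sin (x + c))%R
  = if Num.max (nrm a) `|s|%R == 0%R then +oo
    else (ln X - ln (Num.max (nrm a) `|s|%R))%:E.
Proof.
set m := Num.max _ _; have m_ge0 : (0 <= m)%R by rewrite le_max nrm_ge0.
case: ifPn => [/eqP m0|m0].
  have /eqP : nrm a = 0%R by apply/eqP; rewrite eq_le nrm_ge0 andbT -m0 le_max lexx.
  rewrite nrm_eq0 => /eqP ->.
  have -> : s = 0%R by apply/eqP; rewrite -normr_eq0 eq_le normr_ge0 andbT -m0 le_max lexx orbT.
  under eq_integral do rewrite /= !mul0r !addr0.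
  rewrite /logpot (_ : nrm _ == 0%R) ?nrm_eq0// integral_cst//= circ_prob_setT mule1//.
have {m_ge0 m0} m0 : (0 < m)%R by rewrite lt0r m0.
have [al aE] := polar a.
have a1 : a.1 = (nrm a * cos al)%R by rewrite {1}aE.
have a2 : a.2 = (nrm a * sin al)%R by rewrite {1}aE.
(* Factoring [m] out of [|a + s e^{ix}|] leaves [|1 + b e^{iy}|] with a shifted angle. This formula
   for [b] is symmetric enough to cover both [m = |a|] and [m = |s|], and it gives [|b| <= 1]. *)
pose b := (nrm a * s / m ^+ 2)%R.
have am : (nrm a <= m)%R by rewrite le_max lexx.
have sm : (`|s| <= m)%R by rewrite le_max lexx orbT.
have b1 : (`|b| <= 1)%R.
  rewrite /b !normrM normfV (ger0_norm (nrm_ge0 a)) (ger0_norm (exprn_ge0 2 (ltW m0))).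
  by rewrite ler_pdivrMr ?exprn_gt0// mul1r expr2 ler_pM// nrm_ge0.
have mE : (nrm a ^+ 2 + s ^+ 2 = m ^+ 2 * (1 + b ^+ 2))%R.
  rewrite /b exprMn exprMn -exprVn -exprM -[X in _ = X]mulrC mulrDl mul1r.
  have : (nrm a = m \/ `|s| = m)%R.
    by rewrite /m; case: (leP (nrm a) `|s|%R); [right|left].
  move=> [h|h]; [rewrite h|rewrite -(real_normK (num_real s)) h addrC]; congr (_ + _)%R.
    by field; rewrite gt_eqF.
  by field; rewrite gt_eqF.
have key x : logpot X (a.1 + s * cos (x + c), a.2 + s * sin (x + c))%R =
   (ln X - ln m - ln 4 / 2)%:E + (2^-1)%:E * phi0 b (x + (c - al)).
  set w := (_, _).
  have w2 : (nrm w ^+ 2 = m ^+ 2 * sq b (x + (c - al)))%R.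
    rewrite nrm_sqr /w/= /sq.
    transitivity (nrm a ^+ 2 + s ^+ 2 + 2 * (nrm a * s) * cos (x + (c - al)))%R; last first.
      by rewrite mE /b; field; rewrite gt_eqF.
    have -> : (x + (c - al) = (x + c) - al)%R by rewrite addrA.
    rewrite cosB a1 a2.
    transitivity (nrm a ^+ 2 * (cos al ^+ 2 + sin al ^+ 2) + s ^+ 2 * (cos (x + c) ^+ 2 + sin (x + c) ^+ 2) + 2 * (nrm a * s) * (cos (x + c) * cos al + sin (x + c) * sin al))%R.
      ring.
    by rewrite !cos2Dsin2 !mulr1.
  rewrite /logpot /phi0.
  have -> : (nrm w == 0)%R = (sq b (x + (c - al)) == 0)%R.
    by rewrite -sqrf_eq0 w2 mulf_eq0 expf_eq0/= gt_eqF.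
  case: ifPn => s0; first by rewrite gt0_muley ?lte_fin// addey.
  have s1 : (0 < sq b (x + (c - al)))%R by rewrite lt0r s0 sq_ge0.
  have w0 : (0 < nrm w)%R.
    by rewrite lt0r nrm_ge0 andbT -sqrf_eq0 w2 mulf_eq0 expf_eq0/= gt_eqF.
  rewrite -EFinM -EFinD; congr EFin.
  have : (ln (nrm w ^+ 2) = ln (m ^+ 2 * sq b (x + (c - al))))%R by rewrite w2.
  have h1 : (ln (nrm w ^+ 2) = 2 * ln (nrm w))%R by rewrite lnXn// mulr_natl.
  have h2 : (ln (m ^+ 2) = 2 * ln m)%R by rewrite lnXn// mulr_natl.
  rewrite (@lnM _ (m ^+ 2)%R) ?posrE ?exprn_gt0// h1 h2 => h; lra.
under eq_integral do rewrite key.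
have ip : circ_prob.-integrable setT (fun x => phi0 b (x + (c - al))).
  apply/integrableP; split; first by apply: (measurableT_comp (measurable_phi0 b)); exact: measurable_funD.
  under eq_integral => y _ do rewrite gee0_abs ?phi0_ge0//.
  rewrite (@circ_shift R _ _ (@per_phi0 b) (@measurable_phi0 b) (fun y => phi0_ge0 y b1)).
  by rewrite -/(A b) A_eq// ltry.
rewrite integralD//; last 2 first.
- exact: finite_measure_integrable_cst.
- exact: integrableZl.
rewrite integral_cst//= circ_prob_setT mule1 integralZl//.
rewrite (@circ_shift R _ _ (@per_phi0 b) (@measurable_phi0 b) (fun y => phi0_ge0 y b1)).
by rewrite -/(A b) A_eq// -EFinM -EFinD; congr EFin; lra.
Qed.

End log_mean.

(** * Semicontinuous functions and circle averages *)

Section average.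
Local Open Scope ereal_scope.
Context {R : realType}.
Implicit Types F G : R -> R.

Definition bmf F := measurable_fun setT F /\ exists M : R, forall x, (`|F x| <= M)%R.

Definition avg F : R := fine (\int[circ_prob]_x (F x)%:E).

Lemma bmf_integrable F : bmf F -> circ_prob.-integrable setT (EFin \o F).
Proof.
move=> [mF [M FM]]; apply: measurable_bounded_integrable => //.
  by apply: (@le_lt_trans _ _ 1); [rewrite -[X in _ <= X](@circ_prob_setT R)|exact: ltry].
exists M; split; first exact: num_real.
by move=> x Mx y _ /=; rewrite (le_trans (FM y))// ltW.
Qed.

Lemma avgE F : bmf F -> \int[circ_prob]_x (F x)%:E = (avg F)%:E.
Proof.
move=> bF; rewrite /avg fineK//; exact: (integrable_fin_num measurableT (bmf_integrable bF)).
Qed.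

Lemma bmf_cst (c : R) : bmf (fun=> c).
Proof. by split => //; exists `|c|%R. Qed.

Lemma bmfD F G : bmf F -> bmf G -> bmf (fun x => F x + G x)%R.
Proof.
move=> [mF [M FM]] [mG [N GN]]; split; first exact: measurable_funD.
by exists (M + N)%R => x; rewrite (le_trans (ler_normD _ _))// lerD.
Qed.

Lemma bmfM F G : bmf F -> bmf G -> bmf (fun x => F x * G x)%R.
Proof.
move=> [mF [M FM]] [mG [N GN]]; split; first exact: measurable_funM.
by exists (M * N)%R => x; rewrite normrM ler_pM.
Qed.

Lemma bmfZ (c : R) F : bmf F -> bmf (fun x => c * F x)%R.
Proof. by move=> bF; apply: bmfM => //; exact: bmf_cst. Qed.

Lemma bmfN F : bmf F -> bmf (fun x => - F x)%R.
Proof.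
move=> [mF [M FM]]; split; last by exists M => x; rewrite normrN.
exact: measurableT_comp.
Qed.

Lemma bmfB F G : bmf F -> bmf G -> bmf (fun x => F x - G x)%R.
Proof. by move=> bF bG; apply: bmfD => //; exact: bmfN. Qed.

Lemma avg_cst (c : R) : avg (fun=> c) = c.
Proof. by rewrite /avg integral_cst//= circ_prob_setT mule1. Qed.

Lemma avgD F G : bmf F -> bmf G -> avg (fun x => F x + G x)%R = (avg F + avg G)%R.
Proof.
move=> bF bG; apply: EFin_inj; rewrite EFinD -!avgE//; last exact: bmfD.
under eq_integral do rewrite EFinD.
by rewrite integralD//; exact: bmf_integrable.
Qed.

Lemma avgZ (c : R) F : bmf F -> avg (fun x => c * F x)%R = (c * avg F)%R.
Proof.
move=> bF; apply: EFin_inj; rewrite EFinM -!avgE//; last exact: bmfZ.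
under eq_integral do rewrite EFinM.
by rewrite integralZl//; exact: bmf_integrable.
Qed.

Lemma avgB F G : bmf F -> bmf G -> avg (fun x => F x - G x)%R = (avg F - avg G)%R.
Proof.
move=> bF bG; rewrite avgD//; last exact: bmfN.
congr (_ + _)%R; rewrite -mulN1r -avgZ//; congr avg; apply/funext => x.
by rewrite mulN1r.
Qed.

Lemma le_avg F G : bmf F -> bmf G -> (forall x, F x <= G x)%R -> (avg F <= avg G)%R.
Proof.
move=> bF bG FG; rewrite -lee_fin -!avgE//; apply: le_integral => //.
- exact: bmf_integrable.
- exact: bmf_integrable.
- by move=> x _; rewrite /= lee_fin.
Qed.

End average.

Section usc.
Local Open Scope ereal_scope.
Context {R : realType}.
Implicit Types (z w : R * R) (V : R * R -> \bar R).

Definition cpt z (s x : R) : R * R := (z.1 + s * cos x, z.2 + s * sin x)%R.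

Lemma measurable_cpt z s : measurable_fun setT (cpt z s).
Proof.
apply: measurable_fun_pair; apply: measurable_funD => //; apply: measurable_funM => //.
  exact: measurable_cos.
exact: measurable_sin.
Qed.

Lemma nrm_cptB z s x : nrm (cpt z s x - z)%R = `|s|%R.
Proof.
rewrite (_ : (cpt z s x - z)%R = (s * cos x, s * sin x)%R) ?nrm_polar//.
by rewrite /cpt; case: z => a b /=; congr (_, _); rewrite /= addrAC subrr add0r.
Qed.

Lemma per_cpt z s : per2pi (cpt z s).
Proof. by move=> x; rewrite /cpt mulr_natl cosD2pi sinD2pi. Qed.

Definition usc V := forall z (c : R), V z < c%:E -> \forall w \near z, V w < c%:E.

(** Neighbourhoods in the product come from the sup norm, whereas all the geometry is Euclidean. *)
Lemma near_nrmP z (P : R * R -> Prop) :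
  (\forall w \near z, P w) <-> exists2 e : R, (0 < e)%R & forall w, (nrm (w - z)%R < e)%R -> P w.
Proof.
split.
  move/nbhs_ballP => [e /= e0 eP]; exists e => // w we; apply: eP.
  have h1 : (`|(w - z).1| <= nrm (w - z)%R)%R.
    by rewrite -(ger0_norm (nrm_ge0 _)) -ler_sqr ?nnegrE// !real_normK ?num_real// nrm_sqr lerDl sqr_ge0.
  have h2 : (`|(w - z).2| <= nrm (w - z)%R)%R.
    by rewrite -(ger0_norm (nrm_ge0 _)) -ler_sqr ?nnegrE// !real_normK ?num_real// nrm_sqr lerDr sqr_ge0.
  split; rewrite /ball/= distrC.
    exact: le_lt_trans h1 we.
  exact: le_lt_trans h2 we.
move=> [e e0 eP]; apply/nbhs_ballP; exists (e / 2)%R => /=; first by rewrite divr_gt0.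
move=> w [/= w1 w2]; apply: eP.
rewrite /ball/= distrC in w1; rewrite /ball/= distrC in w2.
rewrite -ltr_sqr ?nnegrE ?nrm_ge0 ?ltW// nrm_sqr/=.
rewrite -(real_normK (num_real (w.1 - z.1))) -(real_normK (num_real (w.2 - z.2))).
have n1 := normr_ge0 (w.1 - z.1)%R; have n2 := normr_ge0 (w.2 - z.2)%R.
have : (`|w.1 - z.1| ^+ 2 <= (e / 2) ^+ 2)%R by rewrite !expr2; apply: ler_pM => //; lra.
have : (`|w.2 - z.2| ^+ 2 <= (e / 2) ^+ 2)%R by rewrite !expr2; apply: ler_pM => //; lra.
have : (0 < e ^+ 2)%R by rewrite exprn_gt0.
rewrite expr_div_n (_ : (2 ^+ 2 = 4 :> R)%R); last by rewrite -natrX.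
lra.
Qed.

Lemma disc_compact z (X : R) : compact [set w : R * R | nrm (w - z)%R <= X]%R.
Proof.
have h1 w : (`|(w - z).1| <= nrm (w - z)%R)%R.
  by rewrite -(ger0_norm (nrm_ge0 _)) -ler_sqr ?nnegrE// !real_normK ?num_real// nrm_sqr lerDl sqr_ge0.
have h2 w : (`|(w - z).2| <= nrm (w - z)%R)%R.
  by rewrite -(ger0_norm (nrm_ge0 _)) -ler_sqr ?nnegrE// !real_normK ?num_real// nrm_sqr lerDr sqr_ge0.
pose K := (`[(z.1 - X)%R, (z.1 + X)%R]%classic `*` `[(z.2 - X)%R, (z.2 + X)%R]%classic)%classic.
apply: (@subclosed_compact _ _ K).
- rewrite -[X in closed X]setCK; apply: open_closedC; rewrite openE => w /=.
  move/negP; rewrite -ltNge => Xw; apply/near_nrmP.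
  exists (nrm (w - z)%R - X)%R; first by rewrite subr_gt0.
  move=> y yw; apply/negP; rewrite -ltNge.
  have := nrm_triangle (w - y)%R (y - z)%R; rewrite addrA subrK -[nrm (w - y)%R]nrmN opprB.
  lra.
- by apply: compact_setX; exact: segment_compact.
- move=> w /= wX; split => /=; rewrite in_itv/= -ler_distl.
    exact: le_trans (h1 w) wX.
  exact: le_trans (h2 w) wX.
Qed.

(** The sets where [V] is at least [V w] form a filter base on [K]. A cluster point is a maximum,
    for otherwise upper semicontinuity would separate it from one of these sets. *)
Lemma usc_max V (K : set (R * R)) : usc V -> compact K -> K !=set0 ->
  exists2 z, K z & forall w, K w -> V w <= V z.
Proof.
move=> uV cK [k0 Kk0].
pose S w := [set y | K y /\ V w <= V y].
have FF : ProperFilter (filter_from K S).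
  apply: filter_from_proper; first last.
    by move=> w Kw; exists w; split.
  apply: filter_from_filter; first by exists k0.
  move=> a b Ka Kb; have [ab|/ltW ba] := leP (V a) (V b).
    exists b => // y [Ky by_]; split; split => //; exact: le_trans by_.
  exists a => // y [Ky ay]; split; split => //; exact: le_trans ay.
have [|z [Kz zF]] := cK _ FF; first by exists k0 => // y [].
exists z => // w Kw; rewrite leNgt; apply/negP => zw.
have [c zc cw] : exists2 c : R, V z < c%:E & c%:E <= V w.
  move: zw; case: (V z) => [a||]; case: (V w) => [b||]//=.
  + by rewrite lte_fin => ab; exists b; rewrite ?lte_fin.
  + by exists (a + 1)%R; rewrite ?lte_fin ?ltrDl ?leey.
  + by exists b; rewrite ?ltNyr.
  + by exists 0%R; rewrite ?ltNyr ?leey.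
have Sw : filter_from K S (S w) by exists w.
have [y [[_ wy] yc]] := zF _ _ Sw (uV z c zc).
by have := lt_le_trans yc (le_trans cw wy); rewrite ltxx.
Qed.

Lemma usc_bounded V z (X : R) : usc V -> (forall w, V w != +oo) ->
  exists B : R, forall w, (nrm (w - z)%R <= X)%R -> V w <= B%:E.
Proof.
move=> uV Vfin; have [X0|X0] := leP 0%R X; last first.
  by exists 0%R => w wX; have := nrm_ge0 (w - z)%R; rewrite leNgt (le_lt_trans wX).
have [|m _ hm] := usc_max uV (@disc_compact z X).
  by exists z => /=; rewrite subrr /nrm/= expr0n/= addr0 sqrtr0.
case E : (V m) hm => [b||] hm.
- by exists b.
- by have := Vfin m; rewrite E.
- by exists 0%R => w /hm; rewrite leeNy_eq => /eqP ->; rewrite leNye.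
Qed.

Definition lipconst (L : R) (phi : R * R -> R) :=
  forall w y, (`|phi w - phi y| <= L * nrm (w - y)%R)%R.

Lemma lipschitz_usc (L : R) (phi : R * R -> R) : (0 <= L)%R -> lipconst L phi -> usc (EFin \o phi).
Proof.
move=> L0 lip w a; rewrite /= lte_fin => wa; apply/near_nrmP.
have j1 : (0 < L + 1 :> R)%R by rewrite ltr_wpDl.
exists ((a - phi w) / (L + 1))%R; first by rewrite divr_gt0// subr_gt0.
move=> y; rewrite ltr_pdivlMr// mulrDr mulr1 (mulrC _ L) => yw; rewrite lte_fin.
have := le_trans (ler_norm _) (lip y w); have := nrm_ge0 (y - w)%R; lra.
Qed.

Lemma lipschitz_measurable (L : R) (phi : R * R -> R) : (0 <= L)%R -> lipconst L phi -> measurable_fun setT phi.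
Proof.
by move=> L0 lip; apply/measurable_EFinP; apply: usc_measurable; exact: lipschitz_usc lip.
Qed.

(* The majorant is the sup-convolution [w |-> sup_y (V y - j |w - y|)] for a large [j]. *)
Lemma usc_majorant V z (X s c B : R) : usc V ->
  (`|s| <= X)%R -> (0 <= B)%R ->
  (forall w, (nrm (w - z)%R <= X)%R -> V w <= B%:E) ->
  c%:E < \int[circ_prob]_x (B%:E - V (cpt z s x)) ->
  exists L : R, exists phi : R * R -> R,
  [/\ (0 <= L)%R, lipconst L phi, (forall w, phi w <= B)%R,
     (forall w, (nrm (w - z)%R <= X)%R -> V w <= (phi w)%:E) &
     c%:E < \int[circ_prob]_x (B%:E - (phi (cpt z s x))%:E)].
Proof.
move=> uV sX B0 VB cint; have X0 : (0 <= X)%R by exact: le_trans sX.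
pose D := [set y : R * R | nrm (y - z)%R <= X]%R.
have Dz : D z by rewrite /D/= subrr /nrm/= expr0n/= addr0 sqrtr0.
pose T (j : nat) y : R := fine (maxe (V y) (- j%:R)%:E).
have TB j y : D y -> (T j y <= B)%R.
  move=> Dy; rewrite -lee_fin /T fineK; last first.
    by have := VB y Dy; case: (V y) => [a||]//= _; rewrite ?maxNye// -EFin_max.
  by rewrite ge_max VB//= lee_fin (@le_trans _ _ 0%R)// oppr_le0.
have VT j y : D y -> V y <= (T j y)%:E.
  move=> Dy; have := VB y Dy; rewrite /T; case: (V y) => [a||]//= _; last by rewrite leNye.
  by rewrite -EFin_max /= lee_fin le_max lexx.
pose S j w := [set (T j y - j%:R * nrm (w - y))%R | y in D]%classic.
pose phi j w : R := sup (S j w).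
have SB j w : ubound (S j w) B.
  by move=> _ [y Dy <-]; rewrite (le_trans _ (TB j y Dy))// gerBl mulr_ge0// nrm_ge0.
have S0 j w : S j w !=set0 by exists (T j z - j%:R * nrm (w - z))%R; exists z.
have phile j w y : D y -> (T j y - j%:R * nrm (w - y) <= phi j w)%R.
  by move=> Dy; apply: ub_le_sup; [exists B|exists y].
have lip j : lipconst j%:R (phi j).
  suff h w y : (phi j w - phi j y <= j%:R * nrm (w - y)%R)%R.
    by move=> w y; rewrite ler_norml h andbT lerNl opprB (le_trans (h _ _))// -nrmN opprB.
  rewrite lerBlDr; apply: ge_sup => // _ [u Du <-].
  rewrite -lerBlDl (le_trans _ (phile _ _ _ Du))// -addrA lerD2l -opprD lerN2 -mulrDr ler_wpM2l//.
  by have := nrm_triangle (y - w)%R (w - u)%R; rewrite addrA subrK -[nrm (y - w)%R]nrmN opprB; lra.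
have phiB j w : (phi j w <= B)%R by exact: ge_sup.
have Vphi j w : D w -> V w <= (phi j w)%:E.
  move=> Dw; rewrite (le_trans (VT j w Dw))// lee_fin (le_trans _ (phile _ _ _ Dw))//.
  by rewrite subrr /nrm/= expr0n/= addr0 sqrtr0 mulr0 subr0.
have Dc x : D (cpt z s x) by rewrite /D/= nrm_cptB.
have mphi j : measurable_fun setT (fun x => B%:E - (phi j (cpt z s x))%:E).
  apply: emeasurable_funB => //; apply/measurable_EFinP.
  have h := lipschitz_measurable (ler0n _ j) (lip j).
  exact: (measurableT_comp h (measurable_cpt z s)).
have : c%:E < limn_einf (fun j => \int[circ_prob]_x (B%:E - (phi j (cpt z s x))%:E)).
  apply: (lt_le_trans cint).
  apply: (@le_trans _ _ (\int[circ_prob]_x limn_einf (fun j => B%:E - (phi j (cpt z s x))%:E))); last first.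
    by apply: fatou => // j x _; rewrite -EFinB lee_fin subr_ge0.
  apply: ge0_le_integral_nonmeasurable => x _.
    by have := VB _ (Dc x); case: (V _) => [a||]//=; rewrite ?lee_fin ?subr_ge0// => _; rewrite /= ?leey.
  set w := cpt z s x; apply: limn_einf_ge => c' cV.
  have VBc : V w < (B - c')%:E.
    move: cV; have := VB w (Dc x); case: (V w) => [a||]//=; rewrite ?ltNyr// => _.
    by rewrite -EFinB !lte_fin ltrBrDr addrC -ltrBrDr.
  have /near_nrmP[e e0 He] := uV _ _ VBc.
  near=> j; rewrite -EFinB lee_fin lerBrDr addrC -lerBrDr.
  apply: ge_sup => // _ [y Dy <-].
  (* A competitor near [w] is controlled by upper semicontinuity; a distant one pays a penalty of at
     least [j e], which is at least [c'] for large [j]. *)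
  have [yw|yw] := ltP (nrm (y - w)%R) e.
    have : (T j y <= B - c')%R.
      have := He _ yw; have := VB y Dy; rewrite /T; case: (V y) => [a||]//= _ => [|_].
        rewrite -EFin_max/= lte_fin ge_max => /ltW ->/=; rewrite lerNl.
        by near: j; apply: nbhs_infty_ger.
      by rewrite maxNye/= lerNl; near: j; apply: nbhs_infty_ger.
    by move=> h; rewrite (le_trans _ h)// gerBl mulr_ge0// nrm_ge0.
  have h1 := TB j y Dy.
  have h2 : (c' / e <= j%:R)%R by near: j; apply: nbhs_infty_ger.
  rewrite ler_pdivrMr// in h2.
  have h3 : (j%:R * e <= j%:R * nrm (w - y))%R by rewrite ler_wpM2l// -nrmN opprB.
  lra.
move=> lim_gt.
have [j hj] : exists j, c%:E < \int[circ_prob]_x (B%:E - (phi j (cpt z s x))%:E).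
  apply: contrapT => /forallNP no; move: lim_gt; rewrite ltNge => /negP; apply.
  by apply: limn_einf_le => n; exists n => //; rewrite leNgt; apply/negP; exact: no.
by exists j%:R, (phi j); split; [exact: ler0n|exact: lip|exact: phiB|exact: Vphi|exact: hj].
Unshelve. all: by end_near. Qed.

End usc.

(** * From local to global submean inequalities *)

Section submean.
Context {R : realType}.
Implicit Types (z w : R * R) (f h phi : R * R -> R).

Lemma avg_shift (a : R) (F : R -> R) : bmf F -> per2pi F -> avg (fun x => F (x + a)) = avg F.
Proof.
move=> [mF [M FM]] pF; have bF : bmf F by split => //; exists M.
have mFa : measurable_fun setT (fun x : R => F (x + a)) by apply: (measurableT_comp mF); exact: measurable_funD.
have bFa : bmf (fun x => F (x + a)) by split => //; exists M => x; exact: FM.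
apply: (@addIr _ M); rewrite -{1 2}(avg_cst M) -!avgD//; [|exact: bmf_cst|exact: bmf_cst].
apply: EFin_inj; rewrite -!avgE; [|exact: bmfD (bmf_cst _)|exact: bmfD (bmf_cst _)].
apply: (@circ_shift R a (fun x => (F x + M)%:E)).
- by move=> x; rewrite pF.
- by apply/measurable_EFinP; exact: measurable_funD.
- by move=> x; rewrite lee_fin -lerBlDr sub0r; have := FM x; rewrite ler_norml => /andP[].
Qed.

Lemma bmf_cos : bmf (@cos R).
Proof. by split; [exact: measurable_cos|exists 1 => x; rewrite ler_norml cos_geN1 cos_le1]. Qed.

Lemma bmf_sin : bmf (@sin R).
Proof. by split; [exact: measurable_sin|exists 1 => x; rewrite ler_norml sin_geN1 sin_le1]. Qed.

Lemma avg_cos : avg (@cos R) = 0.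
Proof.
have p : per2pi (@cos R) by move=> x; rewrite mulr_natl cosD2pi.
have := avg_shift pi bmf_cos p.
have -> : (fun x : R => cos (x + pi)) = (fun x => -1 * cos x) by apply/funext => x; rewrite cosDpi mulN1r.
by rewrite avgZ; [lra|exact: bmf_cos].
Qed.

Lemma avg_sin : avg (@sin R) = 0.
Proof.
have p : per2pi (@sin R) by move=> x; rewrite mulr_natl sinD2pi.
have := avg_shift pi bmf_sin p.
have -> : (fun x : R => sin (x + pi)) = (fun x => -1 * sin x) by apply/funext => x; rewrite sinDpi mulN1r.
by rewrite avgZ; [lra|exact: bmf_sin].
Qed.

Definition cav f z (s : R) : R := avg (fun x => f (cpt z s x)).

Lemma nrm_cpt_sqr z s x : nrm (cpt z s x) ^+ 2 = nrm z ^+ 2 + s ^+ 2 + (2 * s * z.1) * cos x + (2 * s * z.2) * sin x.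
Proof.
rewrite !nrm_sqr /cpt/=.
transitivity (z.1 ^+ 2 + z.2 ^+ 2 + s ^+ 2 * (cos x ^+ 2 + sin x ^+ 2) + 2 * s * z.1 * cos x + 2 * s * z.2 * sin x); last by rewrite cos2Dsin2 mulr1.
ring.
Qed.

Lemma bmf_nrm2 z s : bmf (fun x => nrm (cpt z s x) ^+ 2).
Proof.
rewrite (_ : (fun x => _) = (fun x => nrm z ^+ 2 + s ^+ 2 + (2 * s * z.1) * cos x + (2 * s * z.2) * sin x)); last first.
  by apply/funext => x; exact: nrm_cpt_sqr.
apply: bmfD; last by apply: bmfZ; exact: bmf_sin.
by apply: bmfD; [exact: bmf_cst|apply: bmfZ; exact: bmf_cos].
Qed.

Lemma cav_nrm2 z s : cav (fun w => nrm w ^+ 2) z s = nrm z ^+ 2 + s ^+ 2.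
Proof.
rewrite /cav (_ : (fun x => _) = (fun x => nrm z ^+ 2 + s ^+ 2 + (2 * s * z.1) * cos x + (2 * s * z.2) * sin x)); last first.
  by apply/funext => x; exact: nrm_cpt_sqr.
have h1 : bmf (fun x => (2 * s * z.1) * cos x) by apply: bmfZ; exact: bmf_cos.
have h2 : bmf (fun x => (2 * s * z.2) * sin x) by apply: bmfZ; exact: bmf_sin.
have h3 := bmf_cst (nrm z ^+ 2 + s ^+ 2).
rewrite avgD//; last exact: bmfD.
rewrite avgD// avg_cst avgZ; last exact: bmf_cos.
by rewrite avgZ ?avg_cos ?avg_sin ?mulr0 ?addr0//; exact: bmf_sin.
Qed.

Definition loc_bounded f := forall X : R, exists M : R, forall w, nrm w <= X -> `|f w| <= M.

Lemma nrm_cpt_le z s x : nrm (cpt z s x) <= nrm z + `|s|.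
Proof.
have := nrm_triangle (cpt z s x - z) z; rewrite subrK nrm_cptB; lra.
Qed.

Lemma bmf_cpt f z s : measurable_fun setT f -> loc_bounded f -> bmf (fun x => f (cpt z s x)).
Proof.
move=> mf lf; split; first exact: (measurableT_comp mf (measurable_cpt z s)).
have [M hM] := lf (nrm z + `|s|); exists M => x; apply: hM; exact: nrm_cpt_le.
Qed.

Lemma lipschitz_loc_bounded (L : R) phi : 0 <= L -> lipconst L phi -> loc_bounded phi.
Proof.
move=> L0 lip X; exists (`|phi 0| + L * X) => w wX.
have := lip w 0; rewrite subr0 => h.
have -> : phi w = phi 0 + (phi w - phi 0) by rewrite addrC subrK.
by rewrite (le_trans (ler_normD _ _))// lerD2l (le_trans h)// ler_wpM2l.
Qed.

(** The term [e |w|^2] raises every circle mean strictly, so the maximum of [W] cannot be interior;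
    since [e r^2 = d / 2], it uses up only half of the supposed excess [d] on the boundary. *)
Lemma max_principle f h (L r eta : R) : 0 < r ->
  usc (EFin \o f) -> loc_bounded f -> 0 <= L -> lipconst L h ->
  (forall z, nrm z < r -> exists2 rho, 0 < rho & forall s, 0 < s < rho ->
     f z <= cav f z s /\ cav h z s = h z) ->
  (forall z, nrm z = r -> f z <= h z + eta) ->
  forall z, nrm z <= r -> f z <= h z + eta.
Proof.
move=> r0 uf lf L0 lh hin hbd z0 z0r; rewrite leNgt; apply/negP => hz0.
have mf : measurable_fun setT f by apply/measurable_EFinP; exact: usc_measurable.
have mh := lipschitz_measurable L0 lh.
have lbh := lipschitz_loc_bounded L0 lh.
pose d := f z0 - h z0 - eta; have d0 : 0 < d by rewrite /d; lra.
pose e := d / (2 * r ^+ 2); have e0 : 0 < e by rewrite divr_gt0// mulr_gt0// exprn_gt0.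
have er : e * r ^+ 2 = d / 2 by rewrite /e; field; rewrite gt_eqF.
pose W w := f w - h w + e * nrm w ^+ 2.
have uW : usc (EFin \o W).
  move=> w c; rewrite /= lte_fin => wc.
  pose g := (c - W w) / 3; have g0 : 0 < g by rewrite divr_gt0// subr_gt0.
  have : ((f w)%:E < (f w + g)%:E)%E by rewrite lte_fin ltrDl.
  move/uf/near_nrmP => [e1 e10 H1]; apply/near_nrmP.
  pose K := e * (2 * nrm w + 1).
  have K0 : 0 <= K by apply: mulr_ge0; [exact: ltW|rewrite addr_ge0// mulr_ge0// nrm_ge0].
  exists (Num.min e1 (Num.min 1 (Num.min (g / (L + 1)) (g / (K + 1))))).
    by rewrite !lt_min e10 ltr01/=; apply/andP; split; apply: divr_gt0 => //; exact: ltr_wpDl.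
  move=> y; rewrite !lt_min => /and4P[y1 y2 y3 y4].
  have := H1 y y1; rewrite !lte_fin => fy.
  have n0 := nrm_ge0 (y - w).
  have hy : h w - h y <= g.
    have := le_trans (ler_norm _) (lh w y); rewrite -nrmN opprB => hh.
    move: y3; rewrite ltr_pdivlMr ?ltr_wpDl// mulrDr mulr1 (mulrC _ L); lra.
  have qy : e * nrm y ^+ 2 - e * nrm w ^+ 2 <= g.
    have t1 := nrm_distl y w; have nw := nrm_ge0 w; have ny := nrm_ge0 y.
    have : nrm y ^+ 2 - nrm w ^+ 2 <= nrm (y - w) * (2 * nrm w + 1) by rewrite !expr2; nra.
    move: y4; rewrite ltr_pdivlMr ?ltr_wpDl// mulrDr mulr1 /K => y4 q.
    rewrite -mulrBr; have : e * (nrm y ^+ 2 - nrm w ^+ 2) <= e * (nrm (y - w) * (2 * nrm w + 1)).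
      by rewrite ler_wpM2l// ltW.
    lra.
  by rewrite /W; move: g0 wc; rewrite /g /W in fy hy qy *; lra.
have [|z1 z1r z1m] := usc_max uW (@disc_compact R 0 r).
  by exists z0; rewrite /= subr0.
rewrite /= subr0 in z1r.
have Wz : eta + d <= W z1.
  have := z1m z0; rewrite /= subr0 lee_fin => /(_ z0r) h1; apply: le_trans h1.
  rewrite /W /d; have : 0 <= e * nrm z0 ^+ 2 by apply: mulr_ge0; [exact: ltW|apply: exprn_ge0; exact: nrm_ge0].
  lra.
have [z1lt|z1ge] := ltP (nrm z1) r; last first.
  have z1E : nrm z1 = r by apply/eqP; rewrite eq_le z1r.
  have := hbd _ z1E; move: Wz; rewrite /W z1E er; lra.
have [rho rho0 hrho] := hin _ z1lt.
pose s := Num.min (rho / 2) (r - nrm z1).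
have s0 : 0 < s by rewrite lt_min divr_gt0//= subr_gt0.
have srho : s < rho by rewrite gt_min; apply/orP; left; lra.
have [h1 h2] : f z1 <= cav f z1 s /\ cav h z1 s = h z1 by apply: hrho; rewrite s0 srho.
have bf := bmf_cpt z1 s mf lf; have bh := bmf_cpt z1 s mh lbh; have bn := bmf_nrm2 z1 s.
have : avg (fun x => W (cpt z1 s x)) <= avg (fun=> W z1).
  apply: le_avg; [by apply: bmfD; [exact: bmfB|exact: bmfZ]|exact: bmf_cst|].
  move=> x; rewrite -lee_fin; apply: z1m; rewrite /= subr0 (le_trans (nrm_cpt_le _ _ _))//.
  by rewrite gtr0_norm// -lerBrDl ge_min lexx orbT.
rewrite avg_cst /W avgD; [|exact: bmfB|exact: bmfZ].
rewrite avgB// avgZ// -/(cav f z1 s) -/(cav h z1 s) -/(cav (fun w => nrm w ^+ 2) z1 s) h2 cav_nrm2.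
have : 0 < e * s ^+ 2 by rewrite mulr_gt0// exprn_gt0.
rewrite mulrDr; lra.
Qed.

Lemma ln_leB1 (x : R) : 0 < x -> ln x <= x - 1.
Proof. by move=> x0; have := @le_ln1Dx R (x - 1); rewrite (addrC 1) subrK; apply; lra. Qed.

Lemma ln_ge1B (x : R) : 0 < x -> 1 - x^-1 <= ln x.
Proof.
move=> x0; have := ln_leB1 (_ : 0 < x^-1); rewrite invr_gt0 => /(_ x0).
by rewrite lnV ?posrE//; lra.
Qed.

Lemma ln_lip (e a b : R) : 0 < e -> e <= a -> e <= b -> `|ln a - ln b| <= e^-1 * `|a - b|.
Proof.
move=> e0.
have key (c d : R) : e <= c -> e <= d -> d <= c -> `|ln c - ln d| <= e^-1 * `|c - d|.
  move=> ec ed dc; have d0 := lt_le_trans e0 ed; have c0 := lt_le_trans e0 ec.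
  rewrite !ger0_norm ?subr_ge0 ?ler_ln ?posrE// -ln_div ?posrE//.
  apply: (le_trans (ln_leB1 _)); first exact: divr_gt0.
  rewrite (_ : c / d - 1 = d^-1 * (c - d)); last by field; rewrite gt_eqF.
  by rewrite ler_wpM2r ?subr_ge0// lef_pV2 ?posrE.
move=> ea eb; have [ab|/ltW ba] := leP b a; first exact: key.
by rewrite distrC (distrC a); exact: key.
Qed.

(* [ln |z|] clipped near its pole, to make it Lipschitz. *)
Definition lgc (e : R) z : R := ln (Num.max (nrm z) e).

Lemma lgc_lip (e : R) : 0 < e -> lipconst e^-1 (lgc e).
Proof.
move=> e0 w y; rewrite /lgc (le_trans (ln_lip e0 _ _)) ?le_max ?lexx ?orbT//.
apply: ler_wpM2l; first by rewrite invr_ge0 ltW.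
apply: le_trans (nrm_dist w y).
have := ler_norm (nrm w - nrm y); have := ler_norm (nrm y - nrm w); rewrite (distrC (nrm y)).
by rewrite ler_norml; case: (leP (nrm w) e); case: (leP (nrm y) e) => ? ? ? ?; apply/andP; split; lra.
Qed.

Lemma avg_log (e : R) z s : 0 < e -> (forall x, e <= nrm (cpt z s x)) ->
  avg (fun x => lgc e (cpt z s x)) = ln (Num.max (nrm z) `|s|).
Proof.
move=> e0 he.
have e1 : 0 <= e^-1 by rewrite invr_ge0 ltW.
have bL : bmf (fun x => lgc e (cpt z s x)).
  by apply: bmf_cpt; [exact: (lipschitz_measurable e1 (lgc_lip e0))|exact: (lipschitz_loc_bounded e1 (lgc_lip e0))].
have m0 : Num.max (nrm z) `|s| != 0.
  have := he 0; rewrite /cpt cos0 sin0 mulr1 mulr0 addr0 => h.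
  have := nrm_cpt_le z s 0; rewrite /cpt cos0 sin0 mulr1 mulr0 addr0 => h2.
  apply/eqP => M0; have : nrm z <= Num.max (nrm z) `|s| by rewrite le_max lexx.
  have : `|s| <= Num.max (nrm z) `|s| by rewrite le_max lexx orbT.
  rewrite M0; lra.
have := logpot_mean 1 z s 0; rewrite (negbTE m0) ln1 sub0r.
have -> : (fun x => logpot 1 (z.1 + s * cos (x + 0), z.2 + s * sin (x + 0))) =
          (fun x => (-1 * lgc e (cpt z s x))%:E).
  apply/funext => x; rewrite addr0 -/(cpt z s x) /logpot gt_eqF ?(lt_le_trans e0)//.
  by rewrite ln1 sub0r mulN1r /lgc (max_idPl _).
rewrite avgE; last exact: bmfZ.
by rewrite avgZ// => -[]; lra.
Qed.

Lemma cptBr z w s x : cpt z s x - w = cpt (z - w) s x.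
Proof. by rewrite /cpt; case: z w => [? ?] [? ?]; congr (_, _) => /=; rewrite addrAC. Qed.

Lemma subr_cpt z a x : z - cpt 0 a x = cpt z (- a) x.
Proof. by rewrite /cpt; case: z => [? ?]; congr (_, _) => /=; rewrite add0r mulNr. Qed.

Lemma nrm_unit (b : R) z w : nrm z = 1 -> nrm w = 1 ->
  nrm (z - (b * w.1, b * w.2)) ^+ 2 = (b - 1) ^+ 2 + b * nrm (z - w) ^+ 2.
Proof.
move=> z1 w1; have := nrm_sqr z; have := nrm_sqr w; rewrite z1 w1 !nrm_sqr/= expr1n => e1 e2.
transitivity ((z.1 ^+ 2 + z.2 ^+ 2) + b ^+ 2 * (w.1 ^+ 2 + w.2 ^+ 2) - 2 * b * (z.1 * w.1 + z.2 * w.2)); first by ring.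
transitivity ((b - 1) ^+ 2 + b * ((z.1 ^+ 2 + z.2 ^+ 2) + (w.1 ^+ 2 + w.2 ^+ 2) - 2 * (z.1 * w.1 + z.2 * w.2))); last by ring.
rewrite -e1 -e2; ring.
Qed.

(* Here [na], [nb] are the distances from [z] to [(1 + t) w] and [(1 + 2 t) w], for
   unit [z], [w] with [|z - w|^2 = D]: the kernel [ln nb - ln na - k] is nonnegative
   and concentrates at [D = 0]. *)
Lemma kern_est (t D na nb : R) : 0 < t -> 0 <= D -> 0 < na -> 0 < nb ->
  na ^+ 2 = t ^+ 2 + (1 + t) * D -> nb ^+ 2 = (2 * t) ^+ 2 + (1 + 2 * t) * D ->
  let k := ln ((1 + 2 * t) / (1 + t)) / 2 in
  0 <= ln nb - ln na - k /\ (ln nb - ln na - k) * D <= 3 * t * k.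
Proof.
move=> t0 D0 na0 nb0 naE nbE k.
have a0 : 0 < 1 + t by lra.
have b0 : 0 < 1 + 2 * t by lra.
(* Dividing the squared distances by [1 + 2 t] and [1 + t] absorbs [k]: the kernel is
   [(ln P - ln Q) / 2], and [P - Q] no longer depends on [D]. *)
pose P := (2 * t) ^+ 2 / (1 + 2 * t) + D; pose Q := t ^+ 2 / (1 + t) + D.
have t2 : 0 < t ^+ 2 by rewrite exprn_gt0.
have Q0 : 0 < Q by rewrite ltr_pwDl// divr_gt0.
have P0 : 0 < P by rewrite ltr_pwDl// divr_gt0// exprn_gt0// mulr_gt0.
have PE : P = nb ^+ 2 / (1 + 2 * t) by rewrite nbE /P; field; rewrite gt_eqF.
have QE : Q = na ^+ 2 / (1 + t) by rewrite naE /Q; field; rewrite gt_eqF.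
have kE : ln nb - ln na - k = (ln P - ln Q) / 2.
  have l1 : ln P = 2 * ln nb - ln (1 + 2 * t).
    by rewrite PE ln_div ?posrE ?exprn_gt0// lnXn// [2 * ln nb]mulr_natl.
  have l2 : ln Q = 2 * ln na - ln (1 + t).
    by rewrite QE ln_div ?posrE ?exprn_gt0// lnXn// [2 * ln na]mulr_natl.
  by rewrite l1 l2 /k ln_div ?posrE//; field.
have i1 : t ^+ 2 / (1 + 2 * t) <= t ^+ 2 / (1 + t).
  by apply: ler_wpM2l; [exact: ltW|rewrite lef_pV2 ?posrE//; lra].
have i0 : 0 < t ^+ 2 / (1 + 2 * t) by rewrite divr_gt0.
have PQ1 : P - Q <= 3 * (t ^+ 2 / (1 + 2 * t)).
  rewrite /P /Q; rewrite (_ : (2 * t) ^+ 2 / _ = 4 * (t ^+ 2 / (1 + 2 * t))); first by lra.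
  by field; rewrite gt_eqF.
have PQ0 : 0 <= P - Q.
  rewrite /P /Q (_ : (2 * t) ^+ 2 / (1 + 2 * t) + D - (t ^+ 2 / (1 + t) + D) = t ^+ 2 * (3 + 2 * t) / ((1 + 2 * t) * (1 + t))).
    by apply: divr_ge0; apply: mulr_ge0; lra.
  by field; rewrite !gt_eqF.
have lnPQ : ln P - ln Q <= (P - Q) / Q.
  rewrite -ln_div ?posrE// (le_trans (ln_leB1 _)) ?divr_gt0//.
  by rewrite mulrBl divff ?gt_eqF.
have lnPQ0 : 0 <= ln P - ln Q by rewrite subr_ge0 ler_ln ?posrE//; lra.
have kt : t / (1 + 2 * t) / 2 <= k.
  rewrite /k ler_pM2r ?invr_gt0//.
  apply: le_trans (ln_ge1B _); last exact: divr_gt0.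
  by rewrite invf_div le_eqVlt; apply/orP; left; apply/eqP; field; rewrite gt_eqF.
rewrite kE; split; first by rewrite divr_ge0.
have DQ : D <= Q by rewrite lerDr; apply: divr_ge0; exact: ltW.
have h1 : (ln P - ln Q) * D <= P - Q.
  apply: (@le_trans _ _ ((P - Q) / Q * Q)); last by rewrite divfK ?gt_eqF.
  by apply: ler_pM.
have h2 : 3 * (t ^+ 2 / (1 + 2 * t)) = 6 * t * (t / (1 + 2 * t) / 2) by field; rewrite gt_eqF.
have h3 : 6 * t * (t / (1 + 2 * t) / 2) <= 6 * t * k by rewrite ler_wpM2l// mulr_ge0// ltW.
lra.
Qed.

End submean.

Section global_submean.
Context {R : realType}.
Implicit Types (z w : R * R) (f h phi : R * R -> R).

Lemma avg_dist (c : R) (F G : R -> R) : bmf F -> bmf G ->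
  (forall x, `|F x - G x| <= c) -> `|avg F - avg G| <= c.
Proof.
move=> bF bG h; rewrite -avgB//; have bFG := bmfB bF bG.
rewrite ler_norml -{1}(avg_cst (- c)) -{2}(avg_cst c) !le_avg//; try exact: bmf_cst.
  by move=> x; have := h x; rewrite ler_norml => /andP[].
by move=> x; have := h x; rewrite ler_norml => /andP[].
Qed.

Lemma avg_fubini (G : R * R -> R) (M : R) : measurable_fun setT G ->
  (forall u, `|G u| <= M) ->
  avg (fun x => avg (fun y => G (x, y))) = avg (fun y => avg (fun x => G (x, y))).
Proof.
move=> mG GM.
have b1 x : bmf (fun y => G (x, y)).
  by split; [exact: (measurableT_comp mG (pair1_measurable x))|exists M => y; exact: GM].
have b2 y : bmf (fun x => G (x, y)).
  by split; [exact: (measurableT_comp mG (pair2_measurable y))|exists M => x; exact: GM].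
rewrite {1 3}/avg; congr fine.
under eq_integral do rewrite -avgE//.
under [RHS]eq_integral do rewrite -avgE//.
apply: (@Fubini _ _ _ _ R (circ_prob) (circ_prob) (EFin \o G)).
apply/integrable12ltyP; first by apply/measurable_EFinP.
apply: (@le_lt_trans _ _ (\int[circ_prob]_(x in [set: R]) M%:E)%E); last first.
  by rewrite integral_cst//= circ_prob_setT mule1 ltry.
apply: ge0_le_integral_nonmeasurable => x _; first exact: integral_ge0.
apply: (@le_trans _ _ (\int[circ_prob]_(y in [set: R]) M%:E)%E); last first.
  by rewrite integral_cst//= circ_prob_setT mule1.
by apply: ge0_le_integral_nonmeasurable => y _; rewrite /= lee_fin.
Qed.

(* Real-valued subharmonic functions; the bound holds for truncations from below. *)
Definition rsub f := [/\ usc (EFin \o f), loc_bounded f &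
  forall z, exists2 rho, 0 < rho & forall s, 0 < s < rho -> f z <= cav f z s].

Lemma measurable_pairB d (T : measurableType d) (F G : T -> R * R) :
  measurable_fun setT F -> measurable_fun setT G -> measurable_fun setT (fun x => F x - G x).
Proof.
by move=> mF mG; apply/measurable_fun_pairP; split => /=; apply: measurable_funB;
  do ?[exact: (measurableT_comp measurable_fst)|exact: (measurableT_comp measurable_snd)].
Qed.

Lemma nrm0 : nrm (0 : R * R) = 0.
Proof. by apply/eqP; rewrite nrm_eq0. Qed.

(* A superposition over the unit circle of the kernels of [kern_est] is harmonic
   in the disc and approximates a majorant on the circle, so it replaces the
   Poisson kernel in the maximum principle. *)
Lemma submean_unit f : rsub f -> f 0 <= cav f 0 1.
Proof.
move=> [uf lf sf]; apply/ler_addgt0Pr => d d0.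
have mf : measurable_fun setT f by apply/measurable_EFinP; exact: usc_measurable.
have [M hM] := lf 1; pose B := `|M|.
have fB w : nrm (w - 0) <= 1 -> ((EFin \o f) w <= B%:E)%E.
  by rewrite subr0 => /hM h; rewrite /= lee_fin (le_trans (ler_norm _))// (le_trans h)// ler_norm.
have bf := bmf_cpt 0 1 mf lf.
have [||L [phi [L0 lphi phiB fphi cphi]]] := @usc_majorant R (EFin \o f) 0 1 1 (B - (cav f 0 1 + d / 2)) B uf _ (normr_ge0 _) fB.
- by rewrite normr1.
- under eq_integral do rewrite /= -EFinB.
  rewrite avgE; last by apply: bmfB => //; exact: bmf_cst.
  rewrite avgB ?avg_cst//; last exact: bmf_cst.
  by rewrite lte_fin -/(cav f 0 1); lra.
have mphi := lipschitz_measurable L0 lphi.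
have lbphi := lipschitz_loc_bounded L0 lphi.
have bphi := bmf_cpt 0 1 mphi lbphi.
have {cphi}cphi : cav phi 0 1 < cav f 0 1 + d / 2.
  move: cphi; under eq_integral do rewrite /= -EFinB.
  rewrite avgE; last by apply: bmfB => //; exact: bmf_cst.
  rewrite avgB ?avg_cst//; last exact: bmf_cst.
  by rewrite lte_fin -/(cav phi 0 1); lra.
have L1 : 0 < L + 1 by rewrite ltr_wpDl.
(* Within [eta] the majorant [phi] varies by at most [d / 4]; [t] is then so small that the part of
   the kernel far from its peak costs at most another [d / 4]. *)
pose eta := d / (4 * (L + 1)); have eta0 : 0 < eta by rewrite divr_gt0// mulr_gt0.
pose t := eta * d / (12 * (L + 1)).
have t0 : 0 < t by rewrite divr_gt0// mulr_gt0.
have err1 : L * eta <= d / 4.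
  have -> : d / 4 = (L + 1) * eta by rewrite /eta; field; rewrite gt_eqF.
  by rewrite ler_wpM2r ?lerDl//; exact: ltW.
have err2 : L * (3 * t / eta) <= d / 4.
  have -> : d / 4 = (L + 1) * (3 * t / eta) by rewrite /t; field; rewrite !gt_eqF.
  apply: ler_wpM2r; last by rewrite lerDl.
  by apply: divr_ge0; [apply: mulr_ge0 => //; exact: ltW|exact: ltW].
pose k := ln ((1 + 2 * t) / (1 + t)) / 2.
have a0 : 0 < 1 + t by lra.
have b0 : 0 < 1 + 2 * t by lra.
have k0 : 0 < k.
  by rewrite /k divr_gt0// ln_gt0// ltr_pdivlMr// mul1r; lra.
pose e := t / 2; have e0 : 0 < e by rewrite divr_gt0.
have ei0 : 0 <= e^-1 by rewrite invr_ge0 ltW.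
have ml := lipschitz_measurable ei0 (lgc_lip e0).
have lbl := lipschitz_loc_bounded ei0 (lgc_lip e0).
(* Both poles lie outside the closed unit disc, so [K] is harmonic in [z] there. Its mean over [x]
   is 1 because [ln (1 + 2 t) - ln (1 + t) = 2 k], and at [z = 0] it is constantly 1. *)
pose K z x := (lgc e (z - cpt 0 (1 + 2 * t) x) - lgc e (z - cpt 0 (1 + t) x) - k) / k.
have bl z a : bmf (fun x => lgc e (z - cpt 0 a x)).
  rewrite (_ : (fun x => _) = (fun x => lgc e (cpt z (- a) x))); first exact: bmf_cpt.
  by apply/funext => x; rewrite subr_cpt.
have bK z : bmf (K z).
  rewrite /K; apply: bmfM; last exact: bmf_cst.
  by apply: bmfB; [exact: bmfB|exact: bmf_cst].
have far z a x : nrm z <= 1 -> 1 + t <= a -> t <= nrm (z - cpt 0 a x).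
  move=> z1 ta; have := nrm_distl (cpt 0 a x) z; rewrite -[nrm (_ - z)]nrmN opprB.
  rewrite -[cpt 0 a x]subr0 nrm_cptB subr0 gtr0_norm; lra.
have avgl z a : nrm z <= 1 -> 1 + t <= a -> avg (fun x => lgc e (z - cpt 0 a x)) = ln a.
  move=> z1 ta; rewrite (_ : (fun x => _) = (fun x => lgc e (cpt z (- a) x))); last first.
    by apply/funext => x; rewrite subr_cpt.
  rewrite avg_log//; last by move=> x; rewrite -subr_cpt (le_trans _ (far _ _ _ z1 ta))// /e; lra.
  by rewrite normrN gtr0_norm ?(max_idPr _)//; lra.
have avgK z : nrm z <= 1 -> avg (K z) = 1.
  move=> z1; rewrite /K; under eq_fun do rewrite mulrC.
  rewrite avgZ; last by apply: bmfB; [exact: bmfB|exact: bmf_cst].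
  rewrite avgB; [|exact: bmfB|exact: bmf_cst].
  rewrite avgB// avg_cst !avgl//; [|lra].
  have -> : ln (1 + 2 * t) = ln (1 + t) + 2 * k by rewrite /k ln_div ?posrE//; field.
  by field; rewrite gt_eqF.
pose h z := avg (fun x => phi (cpt 0 1 x) * K z x).
have bh z : bmf (fun x => phi (cpt 0 1 x) * K z x) by exact: bmfM.
have [_ [N hN]] := bphi.
have N0 : 0 <= N by exact: le_trans (normr_ge0 _) (hN 0).
pose Lh := N * (2 * e^-1 / k).
have Lh0 : 0 <= Lh by rewrite mulr_ge0// divr_ge0 ?(ltW k0)// mulr_ge0.
have lh : lipconst Lh h.
  move=> z w; apply: avg_dist => // x.
  rewrite -mulrBr normrM -mulrA ler_pM// /K -mulrBl normrM.
  rewrite normfV (gtr0_norm k0) mulrAC ler_wpM2r ?invr_ge0 ?(ltW k0)//.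
  have := lgc_lip e0 (z - cpt 0 (1 + 2 * t) x) (w - cpt 0 (1 + 2 * t) x).
  have := lgc_lip e0 (z - cpt 0 (1 + t) x) (w - cpt 0 (1 + t) x).
  have E c : z - c - (w - c) = z - w by rewrite opprB addrA subrK.
  rewrite !E => i1 i2.
  set l1 := lgc e (z - cpt 0 (1 + 2 * t) x) in i2 *.
  set l2 := lgc e (z - cpt 0 (1 + t) x) in i1 *.
  set l3 := lgc e (w - cpt 0 (1 + 2 * t) x) in i2 *.
  set l4 := lgc e (w - cpt 0 (1 + t) x) in i1 *.
  rewrite (_ : l1 - l2 - k - (l3 - l4 - k) = (l1 - l3) - (l2 - l4)); last by ring.
  rewrite (le_trans (ler_normB _ _))//; lra.
have mh z s : nrm z < 1 -> 0 < s < 1 - nrm z -> cav h z s = h z.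
  move=> z1 /andP[s0 s1]; rewrite /cav /h.
  pose G (u : R * R) := phi (cpt 0 1 u.2) * K (cpt z s u.1) u.2.
  have mG : measurable_fun setT G.
    apply: measurable_funM.
      by apply: (measurableT_comp mphi); apply: (measurableT_comp (measurable_cpt 0 1)).
    have mc a : measurable_fun setT (fun u : R * R => lgc e (cpt z s u.1 - cpt 0 a u.2)).
      apply: (measurableT_comp ml).
      have m1 : measurable_fun setT (fun u : R * R => cpt z s u.1) by apply: (measurableT_comp (measurable_cpt z s)).
      have m2 : measurable_fun setT (fun u : R * R => cpt 0 a u.2) by apply: (measurableT_comp (measurable_cpt 0 a)).
      exact: measurable_pairB.
    rewrite /K; apply: measurable_funM => //; apply: measurable_funB => //; exact: measurable_funB.
  have cz x : nrm (cpt z s x) <= 1.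
    by rewrite (le_trans (nrm_cpt_le _ _ _))// gtr0_norm//; lra.
  have [Ml hMl] := lbl (2 + 2 * t + 1).
  have lb w a x : nrm w <= 1 -> 0 < a -> a <= 1 + 2 * t -> `|lgc e (w - cpt 0 a x)| <= Ml.
    move=> w1 ap ale; apply: hMl; rewrite subr_cpt (le_trans (nrm_cpt_le _ _ _))// normrN gtr0_norm//; lra.
  rewrite (@avg_fubini G (N * ((Ml + Ml + k) / k)))//; last first.
    move=> [x y]; rewrite /G/= normrM ler_pM// /K normrM normfV (gtr0_norm k0) ler_wpM2r ?invr_ge0 ?(ltW k0)//.
    rewrite (le_trans (ler_normB _ _))// (gtr0_norm k0) lerD2r (le_trans (ler_normB _ _))// lerD ?lb//; lra.
  congr avg; apply/funext => y; rewrite /G/=.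
  have bc a : bmf (fun x => lgc e (cpt z s x - cpt 0 a y)).
    rewrite (_ : (fun x => _) = (fun x => lgc e (cpt (z - cpt 0 a y) s x))); first exact: bmf_cpt.
    by apply/funext => x; rewrite cptBr.
  rewrite avgZ; last first.
    by rewrite /K; apply: bmfM; [apply: bmfB; [exact: bmfB|exact: bmf_cst]|exact: bmf_cst].
  congr (_ * _); rewrite /K; under eq_fun do rewrite mulrC.
  rewrite avgZ; last by apply: bmfB; [exact: bmfB|exact: bmf_cst].
  rewrite avgB; [|exact: bmfB|exact: bmf_cst].
  rewrite avgB// avg_cst mulrC.
  have av a : t <= a - 1 -> avg (fun x => lgc e (cpt z s x - cpt 0 a y)) = lgc e (z - cpt 0 a y).
    move=> ta; have dz : a - nrm z <= nrm (z - cpt 0 a y).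
      have := nrm_distl (cpt 0 a y) z; rewrite -[nrm (_ - z)]nrmN opprB.
      rewrite -[cpt 0 a y]subr0 nrm_cptB subr0 gtr0_norm; lra.
    rewrite (_ : (fun x => _) = (fun x => lgc e (cpt (z - cpt 0 a y) s x))); last first.
      by apply/funext => x; rewrite cptBr.
    rewrite avg_log//; last first.
      by move=> x; rewrite -cptBr (le_trans _ (far _ _ _ (cz x) _))// /e; lra.
    rewrite gtr0_norm// /lgc; congr ln.
    by rewrite !(max_idPl _)// /e; lra.
  by rewrite !av//; lra.
have hb z : nrm z = 1 -> f z <= h z + d / 2.
  move=> z1.
  apply: (@le_trans _ _ (phi z)); first by rewrite -lee_fin; apply: fphi; rewrite subr0 z1.
  have : avg (fun x => (phi z - L * eta) * K z x - L * (3 * t / eta)) <= h z.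
    apply: le_avg => //; first by apply: bmfB; [exact: bmfZ|exact: bmf_cst].
    move=> x; set w := cpt 0 1 x.
    have w1 : nrm w = 1 by rewrite -[w]subr0 nrm_cptB normr1.
    have wE a : cpt 0 a x = (a * w.1, a * w.2) by rewrite /w /cpt/= !add0r !mul1r.
    pose D := nrm (z - w) ^+ 2.
    have na : nrm (z - cpt 0 (1 + t) x) ^+ 2 = t ^+ 2 + (1 + t) * D.
      by rewrite wE nrm_unit// addrAC subrr add0r.
    have nb : nrm (z - cpt 0 (1 + 2 * t) x) ^+ 2 = (2 * t) ^+ 2 + (1 + 2 * t) * D.
      by rewrite wE nrm_unit// addrAC subrr add0r.
    have z1' : nrm z <= 1 by rewrite z1.
    have fa : t <= nrm (z - cpt 0 (1 + t) x) by apply: far.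
    have fb : t <= nrm (z - cpt 0 (1 + 2 * t) x) by apply: far => //; lra.
    have [K1 K2] := kern_est t0 (sqr_ge0 _) (lt_le_trans t0 fa) (lt_le_trans t0 fb) na nb.
    have KE : K z x = (ln (nrm (z - cpt 0 (1 + 2 * t) x)) - ln (nrm (z - cpt 0 (1 + t) x)) - k) / k.
      by rewrite /K /lgc !(max_idPl _)// /e; lra.
    have Kp : 0 <= K z x by rewrite KE divr_ge0// ltW.
    have KD : K z x * D <= 3 * t.
      by rewrite KE mulrAC ler_pdivrMr.
    have phil : phi z - phi w <= L * nrm (z - w) by exact: le_trans (ler_norm _) (lphi z w).
    (* This trades the distance for its square [D], whose product with the kernel is at most
       [3 t]. *)
    have nD : nrm (z - w) <= eta + D / eta.
      have : 0 <= (nrm (z - w) - eta) ^+ 2 / eta by rewrite divr_ge0 ?sqr_ge0// ltW.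
      rewrite (_ : _ / eta = D / eta + eta - 2 * nrm (z - w)); last by rewrite /D; field; rewrite gt_eqF.
      have := nrm_ge0 (z - w); lra.
    have s1 : (phi z - phi w) * K z x <= L * (eta + D / eta) * K z x.
      by rewrite ler_wpM2r// (le_trans phil)// ler_wpM2l.
    have s2 : L * (eta + D / eta) * K z x <= L * eta * K z x + L * (3 * t / eta).
      rewrite mulrDr mulrDl lerD2l -mulrA ler_wpM2l// mulrAC ler_wpM2r ?invr_ge0 ?(ltW eta0)// mulrC//.
    rewrite mulrBl; rewrite mulrBl in s1; lra.
  rewrite avgB; [|exact: bmfZ|exact: bmf_cst].
  rewrite avgZ// avgK ?z1// avg_cst mulr1; lra.
have h0 : h 0 = cav phi 0 1.
  rewrite /h /cav; congr avg; apply/funext => x.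
  have l a : 1 + t <= a -> lgc e (0 - cpt 0 a x) = ln a.
    move=> ta; rewrite /lgc sub0r nrmN -[cpt 0 a x]subr0 nrm_cptB gtr0_norm ?(max_idPl _)// /e; lra.
  rewrite /K !l//; last lra.
  rewrite (_ : _ / k = 1) ?mulr1// /k ln_div ?posrE//.
  have : ln ((1 + 2 * t) / (1 + t)) != 0 :> R by move: k0; rewrite /k pmulr_lgt0 ?invr_gt0// => /gt_eqF ->.
  rewrite ln_div ?posrE// => l0; field.
  by rewrite l0.
have := @max_principle R f h Lh 1 (d / 2) ltr01 uf lf Lh0 lh _ hb 0.
rewrite nrm0 ler01 h0 => mp.
suff : f 0 <= cav phi 0 1 + d / 2 by lra.
apply: mp => // z z1; have [rho rho0 hrho] := sf z.
exists (Num.min rho (1 - nrm z)); first by rewrite lt_min rho0 subr_gt0.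
by move=> s /andP[s0]; rewrite lt_min => /andP[s1 s2]; split; [apply: hrho|apply: mh => //]; rewrite s0.
Qed.

Lemma rsub_affine f z s : 0 < s -> rsub f -> rsub (fun w => f (z.1 + s * w.1, z.2 + s * w.2)).
Proof.
move=> s0 [uf lf sf].
pose a w : R * R := (z.1 + s * w.1, z.2 + s * w.2).
have aB w y : nrm (a w - a y) = s * nrm (w - y).
  apply/eqP; rewrite -(@eqrXn2 _ 2)// ?nrm_ge0 ?mulr_ge0 ?(ltW s0) ?nrm_ge0//.
  rewrite exprMn !nrm_sqr/=; apply/eqP; ring.
have ac w t x : a (cpt w t x) = cpt (a w) (s * t) x.
  by rewrite /a /cpt/=; congr (_, _); ring.
split.
- move=> w c /= /uf/near_nrmP [e e0 H]; apply/near_nrmP; exists (e / s); first exact: divr_gt0.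
  by move=> y; rewrite ltr_pdivlMr// mulrC -aB => /H.
- move=> X; have [M hM] := lf (nrm (a 0) + s * X); exists M => w wX; apply: hM.
  have := nrm_triangle (a w - a 0) (a 0); rewrite subrK => /le_trans; apply.
  by rewrite addrC lerD2l aB subr0 ler_pM2l.
- move=> w; have [rho rho0 H] := sf (a w); exists (rho / s); first exact: divr_gt0.
  move=> t /andP[t0 tr]; rewrite (le_trans (H (s * t) _))//.
    by rewrite mulr_gt0//= mulrC -ltr_pdivlMr.
  rewrite /cav le_eqVlt; apply/orP; left; apply/eqP; congr avg; apply/funext => x.
  by rewrite -ac.
Qed.

(** An affine change of variable reduces every circle to the unit circle, so the local inequality
    holds at all radii. *)
Lemma rsub_submean f z s : rsub f -> 0 < s -> f z <= cav f z s.
Proof.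
move=> sf s0; have := submean_unit (rsub_affine z s0 sf).
rewrite /cav /cpt/= !mulr0 !addr0 -surjective_pairing.
by under eq_fun do rewrite !add0r !mul1r.
Qed.

End global_submean.

(** * Mean operators on the plane *)

Section mean_operators.
Local Open Scope ereal_scope.
Context {R : realType}.
Local Notation mR := (measurableTypeR R).
Implicit Types (z w y : R * R) (F G : R * R -> \bar R).

Definition nnm F := measurable_fun setT F /\ forall z, 0 <= F z.

Definition eav F (s : R) z : \bar R := \int[circ_prob]_x F (cpt z s x).

Lemma eav_ge0 F s z : (forall y, 0 <= F y) -> 0 <= eav F s z.
Proof. by move=> F0; apply: integral_ge0 => x _. Qed.

Lemma measurable_cpt2 (s : R) : measurable_fun setT (fun u : (mR * mR) * mR => cpt u.1 s u.2).
Proof.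
have m1 : measurable_fun setT (fun u : (mR * mR) * mR => u.1.1).
  exact: (measurableT_comp measurable_fst).
have m2 : measurable_fun setT (fun u : (mR * mR) * mR => u.1.2).
  exact: (measurableT_comp measurable_snd).
apply: measurable_fun_pair; apply: measurable_funD => //; apply: measurable_funM => //.
  by apply: (measurableT_comp measurable_cos).
by apply: (measurableT_comp measurable_sin).
Qed.

Lemma measurable_circle F s z : measurable_fun setT F -> measurable_fun setT (fun x => F (cpt z s x)).
Proof. by move=> mF; exact: (measurableT_comp mF (measurable_cpt z s)). Qed.

Lemma nnm_eav F s : nnm F -> nnm (eav F s).
Proof.
move=> [mF F0]; split; last by move=> z; exact: eav_ge0.
apply: (@measurable_fun_fubini_tonelli_F _ _ (mR * mR)%type mR R circ_prob (fun u => F (cpt u.1 s u.2))) => //.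
exact: (measurableT_comp mF (measurable_cpt2 s)).
Qed.

Lemma nnmM F G : nnm F -> nnm G -> nnm (fun z => F z * G z).
Proof. by move=> [mF F0] [mG G0]; split; [exact: emeasurable_funM|move=> z; exact: mule_ge0]. Qed.

Lemma nnmB F z : nnm F -> nnm (fun y => F (y - z)%R).
Proof.
move=> [mF F0]; split => // ; apply: (measurableT_comp mF).
by apply: measurable_pairB.
Qed.

Lemma eavD F G s z : nnm F -> nnm G -> eav (fun y => F y + G y) s z = eav F s z + eav G s z.
Proof. by move=> [mF F0] [mG G0]; rewrite /eav ge0_integralD//; exact: measurable_circle. Qed.

Lemma eavZ (c : R) F s z : (0 <= c)%R -> nnm F -> eav (fun y => c%:E * F y) s z = c%:E * eav F s z.
Proof. by move=> c0 [mF F0]; rewrite /eav ge0_integralZl//; exact: measurable_circle. Qed.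

Lemma eav_cst (c : \bar R) s z : 0 <= c -> eav (fun=> c) s z = c.
Proof. by move=> c0; rewrite /eav integral_cst//= circ_prob_setT mule1. Qed.

Lemma le_eav F G s z : (forall y, 0 <= F y) -> (forall x, F (cpt z s x) <= G (cpt z s x)) ->
  eav F s z <= eav G s z.
Proof. by move=> F0 FG; apply: ge0_le_integral_nonmeasurable. Qed.

Lemma eq_eav F G s z : (forall x, F (cpt z s x) = G (cpt z s x)) ->
  eav F s z = eav G s z.
Proof. by move=> FG; apply: eq_integral. Qed.

Lemma eav_shift F w s z : eav (fun y => F (y - w)%R) s z = eav F s (z - w)%R.
Proof. by apply: eq_integral => x _; rewrite cptBr. Qed.

Lemma eav_neg F s z : nnm F -> eav F (- s) z = eav F s z.
Proof.
move=> [mF F0]; rewrite /eav -[RHS](@circ_shift R pi (fun x => F (cpt z s x)))//.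
- by apply: eq_integral => x _; rewrite /cpt cosDpi sinDpi !mulrN !mulNr.
- by move=> x; rewrite per_cpt.
- exact: measurable_circle.
Qed.

(** For a fixed angle, a translation of the plane moves the circle point from [G] to [F] with radius
    [- s]; the sign is immaterial after averaging. *)
Lemma eav_adjoint F G s : nnm F -> nnm G ->
  \int[plane]_z (F z * eav G s z) = \int[plane]_z (eav F s z * G z).
Proof.
move=> nF nG; have [mF F0] := nF; have [mG G0] := nG.
have m1 (H : R * R -> \bar R) : measurable_fun setT H -> measurable_fun setT (fun u : (mR * mR) * mR => H u.1).
  by move=> mH; exact: (measurableT_comp mH measurable_fst).
transitivity (\int[plane]_z \int[circ_prob]_x (F z * G (cpt z s x))).
  by apply: eq_integral => z _; rewrite /eav ge0_integralZl//; exact: measurable_circle.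
rewrite (@fubini_tonelli _ _ (mR * mR)%type mR R plane circ_prob (fun u => F u.1 * G (cpt u.1 s u.2)))//=; first last.
- by move=> u; exact: mule_ge0.
- apply: emeasurable_funM; first exact: m1.
  exact: (measurableT_comp mG (measurable_cpt2 s)).
transitivity (\int[circ_prob]_x \int[plane]_z (F (cpt z (- s) x) * G z)).
  apply: eq_integral => x _.
  rewrite -(@plane_translation R (cpt 0%R s x) (fun z => F (cpt z (- s) x) * G z)).
  - apply: eq_integral => -[z1 z2] _; rewrite /cpt/= !add0r; congr (F (_, _) * _); ring.
  - apply: emeasurable_funM => //; apply: (measurableT_comp mF).
    exact: (measurableT_comp (measurable_cpt2 (- s)) (pair2_measurable x)).
  - by move=> z; exact: mule_ge0.
rewrite -(@fubini_tonelli _ _ (mR * mR)%type mR R plane circ_prob (fun u => F (cpt u.1 (- s) u.2) * G u.1))//=; first last.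
- by move=> u; exact: mule_ge0.
- apply: emeasurable_funM; last exact: m1.
  exact: (measurableT_comp mF (measurable_cpt2 _)).
apply: eq_integral => z _; rewrite -eav_neg//.
by rewrite ge0_integralZr//; exact: measurable_circle.
Qed.

Lemma eav_comm F a b z : nnm F -> eav (eav F a) b z = eav (eav F b) a z.
Proof.
move=> [mF F0]; rewrite /eav.
pose G (u : mR * mR) := F (cpt (cpt z b u.1) a u.2).
transitivity (\int[circ_prob]_y \int[circ_prob]_x G (x, y)); last first.
  apply: eq_integral => x _; apply: eq_integral => y _; congr F.
  by rewrite /cpt/= addrAC [in X in (_, X)]addrAC.
apply: (@fubini_tonelli _ _ mR mR R circ_prob circ_prob G) => //; last by move=> u; exact: F0.
apply: (measurableT_comp mF).
have m : measurable_fun setT (fun u : mR * mR => (cpt z b u.1, u.2)).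
  by apply: measurable_fun_pair => //; exact: (measurableT_comp (measurable_cpt z b)).
exact: (measurableT_comp (measurable_cpt2 a) m).
Qed.

Lemma plane_shift F z : nnm F -> \int[plane]_y F (y - z)%R = \int[plane]_y F y.
Proof. by move=> [mF F0]; rewrite -[RHS](@plane_translation R (- z)%R). Qed.

Lemma measurable_rotp2 : measurable_fun setT (fun u : (mR * mR) * mR => rotp u.2 u.1).
Proof.
have m1 : measurable_fun setT (fun u : (mR * mR) * mR => u.1.1).
  exact: (measurableT_comp measurable_fst).
have m2 : measurable_fun setT (fun u : (mR * mR) * mR => u.1.2).
  exact: (measurableT_comp measurable_snd).
have m3 : measurable_fun setT (fun u : (mR * mR) * mR => cos u.2).
  by apply: (measurableT_comp measurable_cos).
have m4 : measurable_fun setT (fun u : (mR * mR) * mR => sin u.2).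
  by apply: (measurableT_comp measurable_sin).
apply: measurable_fun_pair => /=.
  by apply: measurable_funB; exact: measurable_funM.
by apply: measurable_funD; exact: measurable_funM.
Qed.

(** Since [G] is invariant under rotations, the integral equals its mean over all of them, and
    Tonelli leaves the circle mean of [F]. This replaces polar coordinates. *)
Lemma radial_average F G z : nnm F -> nnm G -> (forall t y, G (rotp t y) = G y) ->
  \int[plane]_w (F (z + w)%R * G w) = \int[plane]_w (eav F (nrm w) z * G w).
Proof.
move=> [mF F0] [mG G0] rG.
have mFz : measurable_fun setT (fun w => F (z + w)%R).
  apply: (measurableT_comp mF); apply: measurable_fun_pair => /=; exact: measurable_funD.
have h0 u : 0 <= F (z + rotp u.2 u.1)%R * G u.1 by exact: mule_ge0.
transitivity (\int[circ_prob]_x \int[plane]_w (F (z + rotp x w)%R * G w)).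
  transitivity (\int[@circ_prob R]_x \int[plane]_w (F (z + w)%R * G w)).
    by rewrite integral_cst//= circ_prob_setT mule1.
  apply: eq_integral => x _.
  rewrite -(@plane_rot R x (fun w => F (z + w)%R * G w)).
  - by apply: eq_integral => w _; rewrite rG.
  - exact: emeasurable_funM.
  - by move=> w; exact: mule_ge0.
rewrite -(@fubini_tonelli _ _ (mR * mR)%type mR R plane circ_prob (fun u => F (z + rotp u.2 u.1)%R * G u.1))//=; last first.
  apply: emeasurable_funM; last exact: (measurableT_comp mG).
  exact: (measurableT_comp mFz measurable_rotp2).
apply: eq_integral => w _; have [a wa] := polar w.
rewrite ge0_integralZr//; last first.
  apply: (measurableT_comp mFz).
  exact: (measurableT_comp measurable_rotp2 (pair1_measurable w)).
congr (_ * _); rewrite /eav -(@circ_shift R a (fun x => F (cpt z (nrm w) x)))//.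
- apply: eq_integral => x _; congr F; rewrite /cpt cosD sinD {1}wa /rotp/=; congr (_, _) => /=; ring.
- by move=> x; rewrite per_cpt.
- exact: measurable_circle.
Qed.

End mean_operators.

(** * The truncated logarithmic kernel *)

Section log_kernel.
Local Open Scope ereal_scope.
Context {R : realType}.
Local Notation mR := (measurableTypeR R).
Implicit Types (z w y : R * R) (F G : R * R -> \bar R).

Definition ell (X : R) z : \bar R := maxe (logpot X z) 0.

Lemma nnm_ell X : nnm (ell X).
Proof.
split; last by move=> z; rewrite /ell le_max lexx orbT.
by apply: measurable_maxe => //; exact: measurable_logpot.
Qed.

Lemma ell_in (X : R) z : (nrm z <= X)%R -> ell X z = logpot X z.
Proof. by move=> zX; apply/max_idPl; exact: logpot_ge0. Qed.

Lemma ell_out (X : R) z : (0 < X)%R -> (X <= nrm z)%R -> ell X z = 0.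
Proof.
move=> X0 Xz; have z0 := lt_le_trans X0 Xz.
by apply/max_idPr; rewrite /logpot gt_eqF// lee_fin subr_le0 ler_ln.
Qed.

Lemma logpotE (X : R) z : (0 < nrm z)%R -> logpot X z = (ln X - ln (nrm z))%:E.
Proof. by move=> z0; rewrite /logpot gt_eqF. Qed.

Lemma ell_rot X t z : ell X (rotp t z) = ell X z.
Proof. by rewrite /ell /logpot nrm_rot. Qed.

Lemma eav_logpot X s z : (0 < s)%R -> eav (logpot X) s z = (ln X - ln (Num.max (nrm z) s))%:E.
Proof.
move=> s0; have := logpot_mean X z s 0; under eq_integral do rewrite addr0.
by rewrite -/(eav _ s z) => ->; rewrite gtr0_norm// gt_eqF// lt_max s0 orbT.
Qed.

Lemma eav_ell (X s : R) z : (0 < s)%R -> (nrm z + s <= X)%R ->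
  eav (ell X) s z = (ln X - ln (Num.max (nrm z) s))%:E.
Proof.
move=> s0 zX; rewrite -eav_logpot//; apply: eq_eav => x; apply: ell_in.
by rewrite (le_trans (nrm_cpt_le _ _ _))// gtr0_norm.
Qed.

(** Averaging caps the pole at radius [s], and [ell s] is what the cap removes. The bound on
    [|z| + s] keeps the circle where [ell X] is the untruncated logarithm. *)
Lemma ell_eav_ell (X s : R) z : (0 < s)%R -> (nrm z + s <= X)%R ->
  ell s z + eav (ell X) s z = ell X z.
Proof.
move=> s0 zX; rewrite eav_ell//; have n0 := nrm_ge0 z.
rewrite [RHS]ell_in; last lra.
have [zs|sz] := leP (nrm z) s.
  rewrite ell_in//; have [z0|z0] := eqVneq (nrm z) 0%R; first by rewrite /logpot z0 eqxx.
  have zp : (0 < nrm z)%R by rewrite lt0r z0.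
  by rewrite !logpotE// -EFinD; congr EFin; ring.
rewrite ell_out//; last exact: ltW.
by rewrite add0e logpotE//; exact: lt_trans sz.
Qed.

(** Formally [ell a] is [I - M_a] applied to a logarithmic pole, so this says that [I - M_a] and
    [I - M_b] commute on it. The pole is realized by [ell X] with [X] too large for its truncation
    to be felt, and the common term [M_b M_a (ell X)] is finite and cancels. *)
Lemma ell_eav_comm (a b : R) z : (0 < a)%R -> (0 < b)%R ->
  eav (ell a) b z + ell b z = eav (ell b) a z + ell a z.
Proof.
move=> a0 b0; have n0 := nrm_ge0 z; pose X := (nrm z + a + b)%R.
pose I := eav (eav (ell X) a) b z.
have key c d : (0 < c)%R -> (0 < d)%R -> (c + d = a + b)%R ->
    eav (ell c) d z + ell d z + eav (eav (ell X) c) d z = ell X z.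
  move=> c0 d0 cd; rewrite addeAC -eavD; [|exact: nnm_ell|exact: nnm_eav (nnm_ell _)].
  rewrite addeC -[RHS](@ell_eav_ell X d z)//; last by rewrite /X; lra.
  congr (_ + _); apply: eq_eav => x; apply: ell_eav_ell => //.
  by have := nrm_cpt_le z d x; rewrite gtr0_norm// /X; lra.
have Ifin : I \is a fin_num.
  rewrite ge0_fin_numE; last by apply: eav_ge0 => y; apply: eav_ge0 => ?; exact: (nnm_ell _).2.
  apply: (@le_lt_trans _ _ (ln X - ln a)%:E); last exact: ltry.
  rewrite -[leRHS](@eav_cst R _ b z).
    apply: le_eav => [y|x]; first by apply: eav_ge0 => ?; exact: (nnm_ell _).2.
    have := nrm_cpt_le z b x; rewrite gtr0_norm// => h.
    rewrite eav_ell//; last by rewrite /X; lra.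
    by rewrite lee_fin lerD2l lerN2 ler_ln ?posrE ?lt_max ?a0 ?orbT// le_max lexx orbT.
  by rewrite lee_fin subr_ge0 ler_ln ?posrE// /X; lra.
have := key a b a0 b0 erefl; have := key b a b0 a0 (addrC _ _).
rewrite (@eav_comm R (ell X) b a z (nnm_ell X)) -/I => <- h.
by rewrite -[LHS](addeK _ Ifin) h addeK.
Qed.

Lemma ell_ge0 X z : 0 <= ell X z. Proof. exact: (nnm_ell X).2. Qed.

Lemma le_logpot (X Y : R) z : (0 < X)%R -> (X <= Y)%R -> logpot X z <= logpot Y z.
Proof.
move=> X0 XY; rewrite /logpot; case: ifP => // _.
by rewrite lee_fin lerD2r ler_ln ?posrE//; exact: lt_le_trans XY.
Qed.

Lemma le_ell (X Y : R) z : (0 < X)%R -> (X <= Y)%R -> ell X z <= ell Y z.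
Proof.
by move=> X0 XY; rewrite /ell ge_max !le_max lexx orbT (le_logpot _ X0 XY).
Qed.

Lemma measurable_disc z (r : R) : measurable [set y | nrm (y - z)%R <= r]%R.
Proof.
rewrite -[X in measurable X]setTI; apply: measurable_fun_le => //.
by apply: (measurableT_comp measurable_nrm); exact: measurable_pairB.
Qed.

Lemma plane_disc_fin (r : R) : plane [set y : R * R | nrm y <= r]%R < +oo.
Proof.
apply: (@le_lt_trans _ _ (plane (`[(- r)%R, r] `*` `[(- r)%R, r]))).
  apply: le_measure; rewrite ?inE.
  - have := measurable_disc (0%R : R * R) r; rewrite (_ : [set y : R * R | nrm (y - 0) <= r]%R = [set y : R * R | nrm y <= r]%R)//.
    by apply/seteqP; split => y /=; rewrite subr0.
  - exact: measurableX.
  - move=> y /= yr.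
    have h1 : (`|y.1| <= nrm y)%R.
      by rewrite -(ger0_norm (nrm_ge0 _)) -ler_sqr ?nnegrE// !real_normK ?num_real// nrm_sqr lerDl sqr_ge0.
    have h2 : (`|y.2| <= nrm y)%R.
      by rewrite -(ger0_norm (nrm_ge0 _)) -ler_sqr ?nnegrE// !real_normK ?num_real// nrm_sqr lerDr sqr_ge0.
    by split => /=; rewrite in_itv/= -ler_norml; [exact: le_trans yr|exact: le_trans yr].
by rewrite plane_box//= lebesgue_measure_itv/=; case: ifP => _; rewrite ?mul0e// -EFinD -EFinM ltry.
Qed.

Lemma plane_eav F s : nnm F -> \int[plane]_z eav F s z = \int[plane]_z F z.
Proof.
move=> nF; have := @eav_adjoint R F (cst 1) s nF; rewrite /cst.
have n1 : nnm (fun=> 1 : \bar R) by split => // z; exact: lee01.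
move=> /(_ n1); under eq_integral do rewrite eav_cst ?lee01// mule1.
by under [X in _ = X -> _]eq_integral do rewrite mule1.
Qed.

(** Averaging preserves the plane integral, and the mean of [ell X] over circles of radius [X] is at
    most [ln 3] and vanishes beyond [2 X]. *)
Lemma ell_integral_fin (X : R) : (0 < X)%R -> \int[plane]_z ell X z < +oo.
Proof.
move=> X0; rewrite -(plane_eav X (nnm_ell X)).
pose D := [set y : R * R | nrm y <= 2 * X]%R.
have mD : measurable D.
  have := measurable_disc (0%R : R * R) (2 * X)%R; rewrite (_ : [set y : R * R | nrm (y - 0) <= 2 * X]%R = D)//.
  by apply/seteqP; split => y /=; rewrite subr0.
have l3 : (0 <= ln 3 :> R)%R by rewrite ln_ge0// ler1n.
apply: (@le_lt_trans _ _ (\int[plane]_z ((ln 3)%:E * (\1_D z)%:E))).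
  apply: ge0_le_integral_nonmeasurable => z _; first by apply: eav_ge0 => y; exact: ell_ge0.
  have [zD|zD] := leP (nrm z) (2 * X)%R.
    rewrite indicE mem_set// mule1.
    apply: (@le_trans _ _ (eav (ell (3 * X)) X z)).
      by apply: le_eav => [y|x]; [exact: ell_ge0|apply: le_ell => //; lra].
    rewrite eav_ell//; last lra.
    by rewrite lee_fin lnM ?posrE// lerBlDr lerD2l ler_ln ?posrE ?lt_max ?X0 ?orbT// le_max lexx orbT.
  rewrite [leLHS](_ : _ = 0); first by rewrite mule_ge0 ?lee_fin.
  rewrite -(@eav_cst R 0 X z)//; apply: eq_eav => x; apply: ell_out => //.
  have := nrm_distl z (z - cpt z X x)%R; rewrite subKr.
  by rewrite -[nrm (z - _)%R]nrmN opprB nrm_cptB gtr0_norm//; lra.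
rewrite ge0_integralZl//; last by apply/measurable_EFinP; exact: measurable_indic.
by rewrite integral_indic// setIT lte_mul_pinfty// plane_disc_fin.
Qed.

Lemma ell_integral_gt0 (X : R) : (0 < X)%R -> 0 < \int[plane]_z ell X z.
Proof.
move=> X0; pose a := (X / 4)%R; have a0 : (0 < a)%R by rewrite divr_gt0.
pose S := (`[(- a)%R, a] `*` `[(- a)%R, a])%classic : set (mR * mR).
have mS : measurable S by exact: measurableX.
have l2 : (0 < ln 2 :> R)%R by rewrite ln_gt0// ltr1n.
apply: (@lt_le_trans _ _ (\int[plane]_z ((ln 2)%:E * (\1_S z)%:E))).
  rewrite ge0_integralZl//; last first.
  - by rewrite lee_fin ltW.
  - by apply/measurable_EFinP; exact: measurable_indic.
  rewrite integral_indic// setIT mule_gt0//= plane_box//= lebesgue_measure_itv/= lte_fin.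
  rewrite ifT; last lra.
  by rewrite -EFinD -EFinM lte_fin mulr_gt0//; lra.
apply: ge0_le_integral_nonmeasurable => z _.
  by rewrite mule_ge0 ?lee_fin// ltW.
have [[]|zS] := pselect (S z); last first.
  by rewrite indicE memNset// mule0 ell_ge0.
rewrite /= !in_itv/= => /andP[h1 h2] /andP[h3 h4].
rewrite indicE mem_set; last by split => /=; rewrite in_itv/=; apply/andP.
have nz : (nrm z <= X / 2)%R.
  rewrite -ler_sqr ?nnegrE ?nrm_ge0 ?divr_ge0 ?(ltW X0)// nrm_sqr.
  have : (z.1 ^+ 2 <= a ^+ 2)%R by rewrite -real_normK ?num_real// lerXn2r ?nnegrE ?(ltW a0)// ler_norml h1 h2.
  have : (z.2 ^+ 2 <= a ^+ 2)%R by rewrite -real_normK ?num_real// lerXn2r ?nnegrE ?(ltW a0)// ler_norml h3 h4.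
  rewrite (_ : (X / 2) ^+ 2 = 4 * a ^+ 2)%R; last by rewrite /a; field.
  by have := sqr_ge0 a; lra.
rewrite mule1 ell_in; last lra.
rewrite /logpot; case: ifPn => [|z0]; first by rewrite leey.
have zp : (0 < nrm z)%R by rewrite lt0r z0 nrm_ge0.
rewrite lee_fin lerBrDr -lnM ?posrE// ler_ln ?posrE ?mulr_gt0//; lra.
Qed.

End log_kernel.

(** * The Green function of a disc *)

Section green.
Context {R : realType}.
Local Notation mR := (measurableTypeR R).
Implicit Types (z w y : R * R).

(* For complex numbers, [hvec b z y] is the vector [b^2 - conj(z) y]. *)
Definition hvec (b : R) z y : R * R :=
  (b ^+ 2 - (z.1 * y.1 + z.2 * y.2), z.2 * y.1 - z.1 * y.2).

Lemma nrm_hvec_sqr b z y : nrm (hvec b z y) ^+ 2 =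
  b ^+ 2 * nrm (y - z) ^+ 2 + (b ^+ 2 - nrm z ^+ 2) * (b ^+ 2 - nrm y ^+ 2).
Proof. by rewrite !nrm_sqr/=; ring. Qed.

Lemma nrm_hvec_ge b z y : nrm z * nrm y <= b ^+ 2 -> b ^+ 2 - nrm z * nrm y <= nrm (hvec b z y).
Proof.
move=> zy; rewrite -ler_sqr ?nnegrE ?nrm_ge0 ?subr_ge0//.
rewrite nrm_hvec_sqr -subr_ge0.
have h : (nrm y - nrm z) ^+ 2 <= nrm (y - z) ^+ 2.
  rewrite -real_normK ?num_real// ler_sqr ?nnegrE ?nrm_ge0//; exact: nrm_dist.
rewrite (_ : _ - _ = b ^+ 2 * (nrm (y - z) ^+ 2 - (nrm y - nrm z) ^+ 2)); last by ring.
by rewrite mulr_ge0 ?sqr_ge0// subr_ge0.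
Qed.

Lemma nrm_hvec_le b z y : nrm (hvec b z y) <= b ^+ 2 + nrm z * nrm y.
Proof.
have zy0 : 0 <= nrm z * nrm y by rewrite mulr_ge0// nrm_ge0.
rewrite -ler_sqr ?nnegrE ?nrm_ge0 ?addr_ge0 ?sqr_ge0//.
rewrite nrm_hvec_sqr -subr_ge0.
have h : nrm (y - z) ^+ 2 <= (nrm y + nrm z) ^+ 2.
  rewrite ler_sqr ?nnegrE ?nrm_ge0 ?addr_ge0 ?nrm_ge0//.
  by have := nrm_triangle y (- z); rewrite nrmN.
rewrite (_ : _ - _ = b ^+ 2 * ((nrm y + nrm z) ^+ 2 - nrm (y - z) ^+ 2)); last by ring.
by rewrite mulr_ge0 ?sqr_ge0// subr_ge0.
Qed.

(** Squares appear because the formula for the modulus of [hvec] is quadratic. *)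
Lemma ln_ratio_le (x y : R) : 0 < x -> 0 < y -> 2 * (ln x - ln y) <= x ^+ 2 / y ^+ 2 - 1.
Proof.
move=> x0 y0; have := ln_leB1 (_ : 0 < x ^+ 2 / y ^+ 2); rewrite divr_gt0 ?exprn_gt0// => /(_ isT).
rewrite ln_div ?posrE ?exprn_gt0// !lnXn// mulrBr.
by rewrite [2 * ln x]mulr_natl [2 * ln y]mulr_natl.
Qed.

(** The Green function and [ln (b / s)] both vanish at [s = b], so it is enough to extract the
    factor [b - s] from [h^2 - (b D)^2] and compare slopes. Here [t], [s], [D], [h] stand for [|z|],
    [|y|], [|y - z|], [|hvec b z y|]. *)
Lemma green_real_in (b r t s D h : R) : 0 <= t -> t <= r -> r < b ->
  b - (b - r) / 4 <= s -> s < b -> s - t <= D -> 0 < h ->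
  h ^+ 2 = b ^+ 2 * D ^+ 2 + (b ^+ 2 - t ^+ 2) * (b ^+ 2 - s ^+ 2) ->
  ln h - ln b - ln D <= 4 * (b / (b - r)) * (ln b - ln s).
Proof.
move=> t0 tr rb s1 s2 D1 h0 hE.
have b0 : 0 < b by lra.
have s0 : 0 < s by lra.
have w0 : 0 < b - r by lra.
have D2 : 3 / 4 * (b - t) <= D by lra.
have D0 : 0 < D by lra.
have l1 : (b - s) / b <= ln b - ln s.
  rewrite -ln_div ?posrE// (le_trans _ (ln_ge1B _)) ?divr_gt0//.
  by rewrite invf_div mulrBl divff ?gt_eqF.
have l2 := ln_ratio_le h0 (mulr_gt0 b0 D0).
rewrite lnM ?posrE// in l2.
have key : (b ^+ 2 - t ^+ 2) * (b + s) * (b - r) <= 8 * (b ^+ 2 * D ^+ 2).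
  have e1 : (b + t) * (b + s) <= (2 * b) * (2 * b) by apply: ler_pM; lra.
  have e2 : (b - t) * (b - r) <= (b - t) * (b - t) by apply: ler_wpM2l; lra.
  have e3 : (3 / 4 * (b - t)) ^+ 2 <= D ^+ 2 by rewrite ler_sqr ?nnegrE; lra.
  apply: (@le_trans _ _ (((2 * b) * (2 * b)) * ((b - t) * (b - t)))).
    rewrite (_ : _ * _ * _ = ((b + t) * (b + s)) * ((b - t) * (b - r))); last by ring.
    by apply: ler_pM => //; apply: mulr_ge0; lra.
  apply: (@le_trans _ _ (8 * (b ^+ 2 * (3 / 4 * (b - t)) ^+ 2))); last first.
    by rewrite ler_pM2l// ler_pM2l// exprn_gt0.
  rewrite -subr_ge0 (_ : _ - _ = 1 / 2 * (b ^+ 2 * (b - t) ^+ 2)); last by field.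
  by apply: mulr_ge0 => //; rewrite mulr_ge0 ?sqr_ge0.
have l3 : h ^+ 2 / (b * D) ^+ 2 - 1 <= 8 * (b / (b - r)) * ((b - s) / b).
  rewrite (_ : h ^+ 2 / (b * D) ^+ 2 - 1 = ((b ^+ 2 - t ^+ 2) * (b + s) * (b - r)) / (8 * (b ^+ 2 * D ^+ 2)) * (8 * ((b - s) / (b - r)))); last first.
    by rewrite hE; field; rewrite !gt_eqF.
  rewrite (_ : 8 * (b / (b - r)) * ((b - s) / b) = 1 * (8 * ((b - s) / (b - r)))); last by field; rewrite !gt_eqF.
  apply: ler_wpM2r; first by rewrite mulr_ge0// divr_ge0//; lra.
  by rewrite ler_pdivrMr ?mul1r// !mulr_gt0// exprn_gt0.
have l4 : 4 * (b / (b - r)) * ((b - s) / b) <= 4 * (b / (b - r)) * (ln b - ln s).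
  by apply: ler_wpM2l => //; rewrite mulr_ge0// divr_ge0// ltW.
lra.
Qed.

(** The same comparison for the harmonic continuation of the Green function beyond the circle, where
    it is nonpositive; it serves smoothing circles that cross the boundary. *)
Lemma green_real_out (b r t s D h : R) : 0 <= t -> t <= r -> r < b ->
  b <= s -> s <= b + (b - r) / 8 -> 0 < D -> b ^+ 2 - t * s <= h ->
  h ^+ 2 = b ^+ 2 * D ^+ 2 + (b ^+ 2 - t ^+ 2) * (b ^+ 2 - s ^+ 2) ->
  ln b + ln D - ln h <= 4 * (b / (b - r)) * (ln s - ln b).
Proof.
move=> t0 tr rb s1 s2 D0 h1 hE.
have b0 : 0 < b by lra.
have s0 : 0 < s by lra.
have w0 : 0 < b - r by lra.
have h2 : 7 / 8 * (b * (b - t)) <= h.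
  have : t * s <= t * (b + (b - t) / 8) by apply: ler_wpM2l; lra.
  have : t * ((b - t) / 8) <= b * ((b - t) / 8) by apply: ler_wpM2r; lra.
  rewrite expr2 in h1; lra.
have bt0 : 0 < b * (b - t) by apply: mulr_gt0; lra.
have h0 : 0 < h by lra.
have l1 : (s - b) / s <= ln s - ln b.
  rewrite -ln_div ?posrE// (le_trans _ (ln_ge1B _)) ?divr_gt0//.
  by rewrite invf_div mulrBl divff ?gt_eqF.
have l2 := ln_ratio_le (mulr_gt0 b0 D0) h0.
rewrite lnM ?posrE// in l2.
have key : (b ^+ 2 - t ^+ 2) * (s + b) * s * (b - r) <= 8 * b * h ^+ 2.
  have e1 : (b + t) * (s + b) <= (2 * b) * (17 / 8 * b) by apply: ler_pM; lra.
  have e2 : (b - t) * (b - r) <= (b - t) * (b - t) by apply: ler_wpM2l; lra.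
  have e3 : (7 / 8 * (b * (b - t))) ^+ 2 <= h ^+ 2 by rewrite ler_sqr ?nnegrE; lra.
  apply: (@le_trans _ _ (((2 * b) * (17 / 8 * b)) * ((9 / 8 * b) * ((b - t) * (b - t))))).
    rewrite (_ : _ * _ * _ * _ = ((b + t) * (s + b)) * (s * ((b - t) * (b - r)))); last by ring.
    apply: ler_pM => //; [by apply: mulr_ge0; lra|by apply: mulr_ge0; [lra|apply: mulr_ge0; lra]|].
    by apply: ler_pM => //; [lra|apply: mulr_ge0; lra|lra].
  apply: (@le_trans _ _ (8 * b * (7 / 8 * (b * (b - t))) ^+ 2)); last first.
    by apply: ler_wpM2l => //; lra.
  rewrite -subr_ge0 (_ : _ - _ = 43 / 32 * (b * (b * (b - t)) ^+ 2)); last by field.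
  by apply: mulr_ge0 => //; rewrite mulr_ge0 ?sqr_ge0// ltW.
have l3 : (b * D) ^+ 2 / h ^+ 2 - 1 <= 8 * (b / (b - r)) * ((s - b) / s).
  have bDE : (b * D) ^+ 2 = h ^+ 2 + (b ^+ 2 - t ^+ 2) * (s ^+ 2 - b ^+ 2) by rewrite hE; ring.
  rewrite (_ : (b * D) ^+ 2 / h ^+ 2 - 1 = ((b ^+ 2 - t ^+ 2) * (s + b) * s * (b - r)) / (8 * b * h ^+ 2) * (8 * (b / (b - r)) * ((s - b) / s))); last first.
    by rewrite bDE; field; rewrite !gt_eqF.
  rewrite -[leRHS]mul1r.
  apply: ler_wpM2r; first by apply: mulr_ge0; [rewrite mulr_ge0// divr_ge0//; lra|rewrite divr_ge0//; lra].
  by rewrite ler_pdivrMr ?mul1r// !mulr_gt0// exprn_gt0.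
have l4 : 4 * (b / (b - r)) * ((s - b) / s) <= 4 * (b / (b - r)) * (ln s - ln b).
  by apply: ler_wpM2l => //; rewrite mulr_ge0// divr_ge0// ltW.
lra.
Qed.

Local Open Scope ereal_scope.

(** The map [y -> b^2 - conj(z) y] sends a circle of radius [d] to one of radius [|z| d], so this is
    the logarithmic mean again; the last hypothesis decides which modulus is the larger. *)
Lemma eav_logpot_hvec (b X d : R) z y : (0 <= d)%R -> (0 < nrm (hvec b z y))%R ->
  (nrm z * d <= nrm (hvec b z y))%R ->
  eav (fun w => logpot X (hvec b z w)) d y = (ln X - ln (nrm (hvec b z y)))%:E.
Proof.
move=> d0 h0 hd; have [th zth] := polar z.
have := logpot_mean X (hvec b z y) (- (nrm z * d)) (- th).
have zd : (0 <= nrm z * d)%R by rewrite mulr_ge0 ?nrm_ge0.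
rewrite normrN (ger0_norm zd) (max_idPl hd) (gt_eqF h0) => <-.
apply: eq_integral => x _; congr logpot; rewrite /hvec /cpt cosB sinB/=.
have -> : z.1 = (nrm z * cos th)%R by rewrite {1}zth.
have -> : z.2 = (nrm z * sin th)%R by rewrite {1}zth.
by congr (_, _) => /=; ring.
Qed.

(** The classical [ln |(b^2 - conj(z) y) / (b (y - z))|], extended by zero, and written through
    [logpot] so that the pole has the value +oo. *)
Definition green (b : R) z y : \bar R :=
  if (nrm y < b)%R then logpot (nrm (hvec b z y) / b) (y - z)%R else 0.

Lemma nnm_green (b : R) z : (nrm z < b)%R -> nnm (green b z).
Proof.
move=> zb; have b0 : (0 < b)%R by exact: le_lt_trans (nrm_ge0 z) zb.
have mD : measurable_fun setT (fun y => nrm (y - z)%R).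
  by apply: (measurableT_comp measurable_nrm); exact: measurable_pairB.
have mh : measurable_fun setT (fun y => nrm (hvec b z y)).
  apply: (measurableT_comp measurable_nrm); apply: measurable_fun_pair => /=.
    by apply: measurable_funB => //; apply: measurable_funD; exact: measurable_funM.
  by apply: measurable_funB; exact: measurable_funM.
split.
  apply: measurable_fun_if => //=.
    by apply: measurable_fun_ltr => //; exact: measurable_nrm.
  apply: measurable_funTS; rewrite /logpot; apply: measurable_fun_if => //=.
    by apply: measurable_fun_eqr.
  apply: measurable_funTS; apply/measurable_EFinP; apply: measurable_funB.
    by apply: (measurableT_comp (@measurable_ln R)); apply: measurable_funM.
  exact: (measurableT_comp (@measurable_ln R)).
move=> y; rewrite /green; case: ifPn => // yb; apply: logpot_ge0.
rewrite ler_pdivlMr// -ler_sqr ?nnegrE ?mulr_ge0 ?nrm_ge0 ?(ltW b0)//.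
rewrite nrm_hvec_sqr exprMn mulrC lerDl; have n0 := nrm_ge0 y; have n1 := nrm_ge0 z.
by rewrite mulr_ge0// subr_ge0 ler_sqr ?nnegrE ?(ltW b0)// ltW.
Qed.

Local Notation C b r := (4 * (b / (b - r)))%R.

Let hpos (b r d : R) z y (zr : (nrm z <= r)%R) (rb : (r < b)%R) (d0 : (0 < d)%R) (db : (d <= (b - r) / 8)%R) : (nrm y <= b + d)%R -> (0 < nrm (hvec b z y))%R /\ (nrm z * d <= nrm (hvec b z y))%R.
Proof.
have t0 := nrm_ge0 z; have b0 : (0 < b)%R by lra.
have zb : (nrm z < b)%R by lra.
have C0 : (0 <= C b r)%R by rewrite mulr_ge0// divr_ge0//; lra.
move=> yb; have n0 := nrm_ge0 y.
have h1 : (nrm z * nrm y <= nrm z * (b + d))%R by apply: ler_wpM2l.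
have h2 : (nrm z * d <= b * d)%R by apply: ler_wpM2r; lra.
have h3 : (8 * (b * d) <= b * (b - nrm z))%R by rewrite mulrCA; apply: ler_wpM2l; lra.
have h4 : (0 < b * d)%R by apply: mulr_gt0.
have h5 : (nrm z * (b + d) = nrm z * b + nrm z * d)%R by rewrite mulrDr.
have h6 : (b * (b - nrm z) = b ^+ 2 - nrm z * b)%R by rewrite expr2; ring.
have h : (nrm z * nrm y <= b ^+ 2)%R by lra.
by have := nrm_hvec_ge h; split; lra.
Qed.

(** The constants [2 b^2] and [2 b] keep both logarithms nonnegative over the disc, so that their
    means can be added freely in the extended reals; their quotient supplies the factor [b]. *)
Let green_split (b r d : R) z y (zr : (nrm z <= r)%R) (rb : (r < b)%R) (d0 : (0 < d)%R) (db : (d <= (b - r) / 8)%R) : (nrm y < b)%R ->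
  green b z y + logpot (2 * b ^+ 2) (hvec b z y) = logpot (2 * b) (y - z)%R.
Proof.
have t0 := nrm_ge0 z; have b0 : (0 < b)%R by lra.
have zb : (nrm z < b)%R by lra.
have C0 : (0 <= C b r)%R by rewrite mulr_ge0// divr_ge0//; lra.
move=> yb; have [h0 _] : (0 < nrm (hvec b z y))%R /\ (nrm z * d <= nrm (hvec b z y))%R.
  by apply: (hpos zr rb d0 db); lra.
rewrite /green yb [X in _ + X]logpotE// /logpot; case: ifPn => // yz.
rewrite -EFinD; congr EFin; rewrite ln_div ?posrE// !lnM ?posrE ?exprn_gt0//; ring.
Qed.

(** The smoothing circle stays inside the disc: its mean leaves the harmonic part unchanged, and the
    pole loses [ell d]. *)
Let star_near (b r d : R) z y (zr : (nrm z <= r)%R) (rb : (r < b)%R) (d0 : (0 < d)%R) (db : (d <= (b - r) / 8)%R) : (nrm y + d < b)%R ->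
  eav (green b z) d y + ell d (y - z)%R <= green b z y.
Proof.
have t0 := nrm_ge0 z; have b0 : (0 < b)%R by lra.
have zb : (nrm z < b)%R by lra.
have C0 : (0 <= C b r)%R by rewrite mulr_ge0// divr_ge0//; lra.
move=> yd; have n0 := nrm_ge0 y.
have [h0 h1] : (0 < nrm (hvec b z y))%R /\ (nrm z * d <= nrm (hvec b z y))%R.
  by apply: (hpos zr rb d0 db); lra.
have B2 : (0 < 2 * b ^+ 2)%R by rewrite mulr_gt0// exprn_gt0.
have Lfin : ((ln (2 * b ^+ 2) - ln (nrm (hvec b z y)))%:E) \is a fin_num by [].
rewrite -(leeD2rE _ _ Lfin) -{2}logpotE// (green_split zr rb d0 db); last lra.
rewrite addeAC -(eav_logpot_hvec _ (ltW d0))//.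
have mh : measurable_fun setT (fun w => logpot (2 * b ^+ 2) (hvec b z w)).
  apply: (measurableT_comp (measurable_logpot _)); apply: measurable_fun_pair => /=.
    by apply: measurable_funB => //; apply: measurable_funD; exact: measurable_funM.
  by apply: measurable_funB; exact: measurable_funM.
have cin x : (nrm (cpt y d x) < b)%R.
  by rewrite (le_lt_trans (nrm_cpt_le _ _ _))// gtr0_norm.
have -> : eav (green b z) d y + eav (fun w => logpot (2 * b ^+ 2) (hvec b z w)) d y = eav (fun w => logpot (2 * b) (w - z)%R) d y.
  rewrite /eav -ge0_integralD//.
  - by apply: eq_integral => x _; exact: (green_split zr rb d0 db).
  - by move=> x _; exact: (nnm_green zb).2.
  - exact: measurable_circle (nnm_green zb).1.
  - move=> x _; apply: logpot_ge0; rewrite (le_trans (nrm_hvec_le _ _ _))//.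
    have : (nrm z * nrm (cpt y d x) <= b * b)%R by apply: ler_pM => //; [exact: nrm_ge0|exact: ltW|exact: ltW].
    rewrite expr2; lra.
  - exact: (measurable_circle _ _ mh).
rewrite eav_shift eav_logpot// addeC.
have [zs|sz] := leP (nrm (y - z)%R) d.
  rewrite ell_in//; have [e0|e0] := eqVneq (nrm (y - z)%R) 0%R; first by rewrite [leRHS]/logpot e0 eqxx leey.
  have zp : (0 < nrm (y - z)%R)%R by rewrite lt0r e0 nrm_ge0.
  by rewrite !logpotE// -EFinD lee_fin; lra.
rewrite ell_out//; last exact: ltW.
by rewrite add0e logpotE//; exact: lt_trans sz.
Qed.

Let green_le_ell (b r d : R) z y (zr : (nrm z <= r)%R) (rb : (r < b)%R) (d0 : (0 < d)%R) (db : (d <= (b - r) / 8)%R) : (b - d <= nrm y)%R -> green b z y <= (C b r)%:E * ell b y.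
Proof.
have t0 := nrm_ge0 z; have b0 : (0 < b)%R by lra.
have zb : (nrm z < b)%R by lra.
have C0 : (0 <= C b r)%R by rewrite mulr_ge0// divr_ge0//; lra.
move=> yd; rewrite /green; case: ifPn => yb; last by rewrite mule_ge0// ell_ge0.
have [h0 _] : (0 < nrm (hvec b z y))%R /\ (nrm z * d <= nrm (hvec b z y))%R.
  by apply: (hpos zr rb d0 db); lra.
have y0 : (0 < nrm y)%R by lra.
have D0 : (0 < nrm (y - z)%R)%R by have := nrm_distl y z; lra.
rewrite ell_in; last exact: ltW.
rewrite !logpotE// -EFinM lee_fin ln_div ?posrE//.
apply: (@green_real_in b r (nrm z)) => //; [lra|exact: nrm_distl|exact: nrm_hvec_sqr].
Qed.

(** The smoothing circle meets the disc only in the boundary layer, where [green] is at most a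
    multiple of [ell b]; [ell_eav_comm] then turns [M_d (ell b)] into [M_b (ell d)]. *)
Let star_far (b r d : R) z y (zr : (nrm z <= r)%R) (rb : (r < b)%R) (d0 : (0 < d)%R) (db : (d <= (b - r) / 8)%R) : (b <= nrm y)%R ->
  eav (green b z) d y + ell d (y - z)%R <= (C b r)%:E * eav (ell d) b y.
Proof.
have t0 := nrm_ge0 z; have b0 : (0 < b)%R by lra.
have zb : (nrm z < b)%R by lra.
have C0 : (0 <= C b r)%R by rewrite mulr_ge0// divr_ge0//; lra.
move=> yb.
rewrite [X in _ + X]ell_out//; last by have := nrm_distl y z; lra.
rewrite adde0; apply: (@le_trans _ _ ((C b r)%:E * eav (ell b) d y)); last first.
  apply: lee_wpmul2l; first by rewrite lee_fin.
  have key (p q u v : \bar R) : 0 <= q -> v = 0 -> p + q = u + v -> p <= u.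
    by move=> q0 ->; rewrite adde0 => <-; rewrite leeDl.
  exact: (key _ _ _ _ (ell_ge0 d y) (ell_out b0 yb) (ell_eav_comm y b0 d0)).
rewrite -eavZ//; last exact: nnm_ell.
apply: le_eav => [w|x]; first exact: (nnm_green zb).2.
apply: (green_le_ell zr rb d0 db); have := nrm_distl y (y - cpt y d x)%R; rewrite subKr.
by rewrite -[nrm (y - _)%R]nrmN opprB nrm_cptB gtr0_norm//; lra.
Qed.

(** The circle crosses the boundary. There [green - C ell b] is compared with its harmonic
    continuation from inside: they agree in the disc, and outside the continuation is larger by
    [green_real_out]. The continuation has the mean value property, and [M_d (ell b) - ell b] equals
    [M_b (ell d)] at [y]. *)
Let star_mid (b r d : R) z y (zr : (nrm z <= r)%R) (rb : (r < b)%R) (d0 : (0 < d)%R) (db : (d <= (b - r) / 8)%R) : (b - d <= nrm y)%R -> (nrm y < b)%R ->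
  eav (green b z) d y + ell d (y - z)%R <= green b z y + (C b r)%:E * eav (ell d) b y.
Proof.
have t0 := nrm_ge0 z; have b0 : (0 < b)%R by lra.
have zb : (nrm z < b)%R by lra.
have C0 : (0 <= C b r)%R by rewrite mulr_ge0// divr_ge0//; lra.
move=> y1 y2.
have [h0 h1] : (0 < nrm (hvec b z y))%R /\ (nrm z * d <= nrm (hvec b z y))%R.
  by apply: (hpos zr rb d0 db); lra.
have y0 : (0 < nrm y)%R by lra.
have Dd : (d <= nrm (y - z)%R)%R by have := nrm_distl y z; lra.
have D0 : (0 < nrm (y - z)%R)%R by lra.
rewrite [X in _ + X]ell_out// adde0.
have eE : eav (ell d) b y + logpot b y = eav (ell b) d y.
  have key (p q u v w : \bar R) : q = 0 -> v = w -> p + q = u + v -> u + w = p.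
    by move=> -> ->; rewrite adde0.
  apply: (key _ _ _ _ _ _ (ell_in (ltW y2)) (ell_eav_comm y b0 d0)).
  by apply: ell_out => //; lra.
pose X := (3 * b)%R; pose Z := (3 * b ^+ 2)%R.
have X0 : (0 < X)%R by rewrite mulr_gt0.
have Z0 : (0 < Z)%R by rewrite mulr_gt0// exprn_gt0.
have cb x : (nrm (cpt y d x) <= b + d)%R.
  by rewrite (le_trans (nrm_cpt_le _ _ _))// gtr0_norm//; lra.
have ca x : (b - 2 * d <= nrm (cpt y d x))%R.
  have := nrm_distl y (y - cpt y d x)%R; rewrite subKr.
  by rewrite -[nrm (y - _)%R]nrmN opprB nrm_cptB gtr0_norm//; lra.
have mh : measurable_fun setT (fun w => logpot Z (hvec b z w)).
  apply: (measurableT_comp (measurable_logpot _)); apply: measurable_fun_pair => /=.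
    by apply: measurable_funB => //; apply: measurable_funD; exact: measurable_funM.
  by apply: measurable_funB; exact: measurable_funM.
have mz : measurable_fun setT (fun w => logpot X (w - z)%R).
  by apply: (measurableT_comp (measurable_logpot _)); exact: measurable_pairB.
have p1 x : 0 <= logpot Z (hvec b z (cpt y d x)).
  apply: logpot_ge0; rewrite (le_trans (nrm_hvec_le _ _ _))//.
  have : (nrm z * nrm (cpt y d x) <= b * (2 * b))%R by apply: ler_pM => //; rewrite ?nrm_ge0//; have := cb x; lra.
  by rewrite /Z expr2; lra.
have p2 x : 0 <= logpot X (cpt y d x) by apply: logpot_ge0; have := cb x; rewrite /X; lra.
have p3 x : 0 <= logpot X (cpt y d x - z)%R.
  by apply: logpot_ge0; have := nrm_triangle (cpt y d x) (- z)%R; rewrite nrmN; have := cb x; rewrite /X; lra.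
have p4 x : 0 <= green b z (cpt y d x) by exact: (nnm_green zb).2.
have lbX : (0 <= ln X - ln b)%R by rewrite subr_ge0 ler_ln ?posrE// /X; lra.
(* The comparison with the continuation, rearranged with the constants [X] and [Z = b X] so that all
   terms are nonnegative. *)
have pw x : green b z (cpt y d x) + logpot Z (hvec b z (cpt y d x)) + (C b r)%:E * logpot X (cpt y d x)
  <= logpot X (cpt y d x - z)%R + (C b r)%:E * ell b (cpt y d x) + (C b r * (ln X - ln b))%:E.
  have w1 := cb x; have w2 := ca x; move: (cpt y d x) w1 w2 => w w1 w2.
  have [hw0 hw1] := hpos zr rb d0 db w1.
  have w0 : (0 < nrm w)%R by lra.
  have Dw := nrm_distl w z.
  have Dw0 : (0 < nrm (w - z)%R)%R by lra.
  rewrite /green [logpot Z _]logpotE// [logpot X w]logpotE// [logpot X (w - z)%R]logpotE//.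
  have XZ : (ln X = ln Z - ln b)%R.
    by rewrite /X /Z !lnM ?posrE ?exprn_gt0//; ring.
  case: ifPn => wb.
    rewrite ell_in; last exact: ltW.
    rewrite !logpotE// -!EFinM -!EFinD lee_fin ln_div ?posrE// XZ.
    by rewrite le_eqVlt; apply/orP; left; apply/eqP; ring.
  rewrite -leNgt in wb; rewrite ell_out// mule0 add0e adde0 -!EFinM -!EFinD lee_fin.
  have : (ln b + ln (nrm (w - z)) - ln (nrm (hvec b z w)) <= C b r * (ln (nrm w) - ln b))%R.
    apply: (@green_real_out b r (nrm z)) => //; [lra| |exact: nrm_hvec_sqr].
    apply: nrm_hvec_ge.
    have : (nrm z * nrm w <= nrm z * (b + d))%R by apply: ler_wpM2l.
    have : (nrm z * d <= b * d)%R by apply: ler_wpM2r; lra.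
    have : (8 * (b * d) <= b * (b - nrm z))%R by rewrite mulrCA; apply: ler_wpM2l; lra.
    have : (0 <= b * d)%R by apply: mulr_ge0; lra.
    rewrite expr2 !mulrDr; lra.
  rewrite !mulrBr XZ; lra.
have step : eav (green b z) d y + (ln Z - ln (nrm (hvec b z y)))%:E + (C b r)%:E * (ln X - ln (nrm y))%:E
  <= (ln X - ln (nrm (y - z)%R))%:E + (C b r)%:E * eav (ell b) d y + (C b r * (ln X - ln b))%:E.
  rewrite -(eav_logpot_hvec _ (ltW d0))//.
  have mg := measurable_circle d y (nnm_green zb).1.
  have m1 := measurable_circle d y mh.
  have m2 := measurable_circle d y (measurable_logpot X).
  have m3 := measurable_circle d y mz.
  have m4 := measurable_circle d y (nnm_ell b).1.
  have -> : (ln X - ln (nrm y))%:E = eav (logpot X) d y.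
    by rewrite eav_logpot// (max_idPl _)//; lra.
  have -> : (ln X - ln (nrm (y - z)%R))%:E = eav (fun w => logpot X (w - z)%R) d y.
    by rewrite eav_shift eav_logpot// (max_idPl _)//; lra.
  have -> : (C b r * (ln X - ln b))%:E = eav (fun=> (C b r * (ln X - ln b))%:E) d y.
    by rewrite eav_cst// lee_fin mulr_ge0.
  rewrite /eav -!ge0_integralZl//; last by move=> x _; exact: ell_ge0.
  have c0 x : 0 <= (C b r)%:E * ell b (cpt y d x) by rewrite mule_ge0// ell_ge0.
  have c1 x : 0 <= (C b r)%:E * logpot X (cpt y d x) by rewrite mule_ge0.
  have mc1 : measurable_fun setT (fun x => (C b r)%:E * logpot X (cpt y d x)) by exact: measurable_funeM.
  have mc0 : measurable_fun setT (fun x => (C b r)%:E * ell b (cpt y d x)) by exact: measurable_funeM.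
  have cc : (0 <= C b r * (ln X - ln b))%R by exact: mulr_ge0.
  rewrite -!ge0_integralD//; try by [move=> x _; exact: adde_ge0|exact: emeasurable_funD].
  apply: ge0_le_integral_nonmeasurable => x _ //.
  by rewrite !adde_ge0.
have gE : green b z y = (ln (nrm (hvec b z y)) - ln b - ln (nrm (y - z)))%:E.
  by rewrite /green y2 logpotE// ln_div ?posrE.
move: step; rewrite gE -eE logpotE//.
have e0 : 0 <= eav (ell d) b y by apply: eav_ge0 => w; exact: ell_ge0.
have e1 : 0 <= eav (green b z) d y by apply: eav_ge0 => w; exact: (nnm_green zb).2.
have XZ : (ln X = ln Z - ln b)%R.
  by rewrite /X /Z !lnM ?posrE ?exprn_gt0//; ring.
have efin : eav (ell d) b y \is a fin_num.
  rewrite ge0_fin_numE//; apply: (@le_lt_trans _ _ (eav (ell b) d y)).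
    by rewrite -eE leeDl// logpot_ge0// ltW.
  rewrite -(@ell_in R b) ?(ltW y2)// in eE.
  have := @eav_ell R X d y d0; rewrite (_ : (nrm y + d <= X)%R); last by rewrite /X; lra.
  move=> /(_ isT) eX; apply: (@le_lt_trans _ _ (eav (ell X) d y)).
    by apply: le_eav => [w|x]; [exact: ell_ge0|apply: le_ell => //; rewrite /X; lra].
  by rewrite eX ltry.
case: (eav (ell d) b y) efin e0 => [u||]//= _ _.
rewrite -?EFinD -?EFinM -?EFinD.
case: (eav (green b z) d y) e1 => [v||]//= _; rewrite -?EFinD !lee_fin => h.
by rewrite XZ in h; lra.
Qed.

(* Smoothing at scale [d] costs [ell d] at the pole and a boundary term,
   because [green] vanishes on the circle at a rate comparable to [ell b]. *)
Lemma green_smoothing (b r d : R) z y (zr : (nrm z <= r)%R) (rb : (r < b)%R) (d0 : (0 < d)%R) (db : (d <= (b - r) / 8)%R) :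
  eav (green b z) d y + ell d (y - z)%R <= green b z y + (C b r)%:E * eav (ell d) b y.
Proof.
have t0 := nrm_ge0 z; have b0 : (0 < b)%R by lra.
have zb : (nrm z < b)%R by lra.
have C0 : (0 <= C b r)%R by rewrite mulr_ge0// divr_ge0//; lra.
have g0 := (nnm_green zb).2 y.
have e0 : 0 <= (C b r)%:E * eav (ell d) b y by rewrite mule_ge0// eav_ge0// => w; exact: ell_ge0.
have [yb|yb] := ltP (nrm y) b; last by rewrite (le_trans (star_far zr rb d0 db yb))// leeDr.
have [yd|yd] := ltP (nrm y + d)%R b; first by rewrite (le_trans (star_near zr rb d0 db yd))// leeDl.
by apply: (star_mid zr rb d0 db) => //; lra.
Qed.

(** For given moduli the Green function is largest when both points lie on one ray, and this is its
    value there. The test [t == s] is needed because [ln 0 = 0]. *)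
Definition gkernel (b t s : R) : \bar R :=
  if (s < b)%R then
    (if t == s then +oo else maxe (ln (b ^+ 2 - t * s) - ln b - ln `|t - s|)%:E 0)
  else 0.

Lemma gkernel_ge0 (b t s : R) : 0 <= gkernel b t s.
Proof. by rewrite /gkernel; do 2 case: ifP => // _; rewrite le_max lexx orbT. Qed.

Lemma green_le_gkernel (b : R) z y : (nrm z < b)%R -> green b z y <= gkernel b (nrm z) (nrm y).
Proof.
move=> zb; rewrite /green /gkernel; case: ifPn => // yb; case: ifPn => [|ts]; first by rewrite leey.
have z0 := nrm_ge0 z; have y0 := nrm_ge0 y; have b0 : (0 < b)%R by lra.
have n0 : (0 < `|nrm z - nrm y|)%R by rewrite normr_gt0 subr_eq0.
have nD : (`|nrm z - nrm y| <= nrm (y - z)%R)%R by rewrite distrC nrm_dist.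
have D0 : (0 < nrm (y - z)%R)%R by lra.
have h : (0 < b ^+ 2 - nrm z * nrm y)%R.
  by rewrite subr_gt0 expr2; apply: (@le_lt_trans _ _ (nrm z * b)%R); [apply: ler_wpM2l; lra|rewrite ltr_pM2r].
have h1 : (0 < nrm (hvec b z y))%R by apply: (lt_le_trans h); apply: nrm_hvec_ge; lra.
rewrite le_max; apply/orP; left; rewrite logpotE// lee_fin ln_div ?posrE//.
suff : (ln (nrm (hvec b z y)) + ln `|nrm z - nrm y| <= ln (b ^+ 2 - nrm z * nrm y) + ln (nrm (y - z)))%R by lra.
rewrite -!lnM ?posrE// ler_ln ?posrE ?mulr_gt0//.
rewrite -ler_sqr ?nnegrE ?mulr_ge0 ?(ltW n0) ?(ltW h) ?(ltW h1) ?(ltW D0)// !exprMn nrm_hvec_sqr real_normK ?num_real// -subr_ge0.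
rewrite (_ : _ - _ = ((b ^+ 2 - nrm z ^+ 2) * (b ^+ 2 - nrm y ^+ 2)) * (nrm (y - z) ^+ 2 - (nrm z - nrm y) ^+ 2))%R; last by ring.
apply: mulr_ge0; first by apply: mulr_ge0; rewrite subr_ge0 ler_sqr ?nnegrE//; lra.
by rewrite subr_ge0 -real_normK ?num_real// ler_sqr ?nnegrE ?nrm_ge0.
Qed.

Lemma green_le_ell2 (b : R) z y : (nrm z < b)%R -> green b z y <= ell (2 * b) (y - z)%R.
Proof.
move=> zb; rewrite /green; case: ifPn => yb; last exact: ell_ge0.
have z0 := nrm_ge0 z; have y0 := nrm_ge0 y; have b0 : (0 < b)%R by lra.
rewrite /ell le_max; apply/orP; left; rewrite /logpot; case: ifPn => // e0.
have zy : (nrm z * nrm y < b ^+ 2)%R.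
  by rewrite expr2; apply: (@le_lt_trans _ _ (nrm z * b)%R); [apply: ler_wpM2l; lra|rewrite ltr_pM2r].
have h1 : (0 < nrm (hvec b z y))%R by apply: (lt_le_trans _ (nrm_hvec_ge (ltW zy))); rewrite subr_gt0.
rewrite lee_fin lerD2r ler_ln ?posrE ?divr_gt0 ?mulr_gt0// ler_pdivrMr//.
have := nrm_hvec_le b z y; rewrite -mulrA -expr2; lra.
Qed.

Lemma green_integral_fin (b : R) z : (nrm z < b)%R -> \int[plane]_y green b z y < +oo.
Proof.
move=> zb; have b0 : (0 < b)%R by have := nrm_ge0 z; lra.
apply: (@le_lt_trans _ _ (\int[plane]_y ell (2 * b) (y - z)%R)).
  apply: ge0_le_integral_nonmeasurable => y _; [exact: (nnm_green zb).2|exact: green_le_ell2].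
rewrite plane_shift; last exact: nnm_ell.
by apply: ell_integral_fin; lra.
Qed.

End green.

(** * The smoothed gap *)

Section core.
Local Open Scope ereal_scope.
Context {R : realType}.
Local Notation mR := (measurableTypeR R).
Implicit Types (z w y : R * R).

Lemma measurable_gkernel (b : R) : measurable_fun setT (fun u : mR * mR => gkernel b u.1 u.2).
Proof.
apply: measurable_fun_if => //=; first exact: measurable_fun_ltr.
apply: measurable_funTS; apply: measurable_fun_if => //=; first exact: measurable_fun_eqr.
apply: measurable_funTS; apply: measurable_maxe => //; apply/measurable_EFinP.
apply: measurable_funB; last first.
  apply: (measurableT_comp (@measurable_ln R)); apply: measurableT_comp => //.
  exact: measurable_funB.
apply: measurable_funB => //; apply: (measurableT_comp (@measurable_ln R)).
by apply: measurable_funB => //; exact: measurable_funM.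
Qed.

Lemma plane_integralD (F G : R * R -> \bar R) : nnm F -> nnm G ->
  \int[plane]_y (F y + G y) = \int[plane]_y F y + \int[plane]_y G y.
Proof. by move=> [mF F0] [mG G0]; rewrite ge0_integralD. Qed.

Section data.
Variables (b r r0 d B : R) (f g : R * R -> R).

(** The bounded form of the problem: [f] and [g] stand for truncations of [v] and [V], and the
    submean inequality is asked for at the single scale [d]. *)
Definition smoothing_data : Prop :=
  [/\ [/\ 0 <= r, r < b, 0 < r0, r0 < b & 0 < d <= (b - r) / 8]%R,
      measurable_fun setT f /\ measurable_fun setT g,
      forall z, [/\ 0 <= f z, f z <= g z & g z <= B]%R &
      forall z, (nrm z < b)%R -> (f z)%:E <= eav (EFin \o f) d z /\ (g z)%:E <= eav (EFin \o g) d z].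

Local Notation F := (fun z => (f z)%:E).
Local Notation G := (fun z => (g z)%:E).
Local Notation E := (fun z => (g z - f z)%:E).
(** The substitute at scale [d] for the Riesz measure of [f], cut off to the disc in which the
    submean inequality makes it nonnegative. *)
Definition defect z : \bar R := if (nrm z < b)%R then eav F d z - F z else 0.

Hypothesis H : smoothing_data.

Lemma data_B0 : (0 <= B)%R.
Proof. by case: H => _ _ /(_ (0, 0)%R)[h1 h2 h3] _; exact: (le_trans h1 (le_trans h2 h3)). Qed.

Lemma nnm_F : nnm F.
Proof.
case: H => _ [mf _] h _; split; first exact/measurable_EFinP.
by move=> z; have [] := h z.
Qed.

Lemma nnm_G : nnm G.
Proof.
case: H => _ [_ mg] h _; split; first exact/measurable_EFinP.
by move=> z; have [h1 h2 _] := h z; rewrite lee_fin; exact: le_trans h2.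
Qed.

Lemma nnm_E : nnm E.
Proof.
case: H => _ [mf mg] h _; split; first by apply/measurable_EFinP; exact: measurable_funB.
by move=> z; have [h1 h2 _] := h z; rewrite lee_fin subr_ge0.
Qed.

Lemma F_B y : (0 <= f y <= B)%R.
Proof. by case: H => _ _ /(_ y)[h1 h2 h3] _; rewrite h1/= (le_trans h2). Qed.

Lemma E_B y : (0 <= g y - f y <= B)%R.
Proof. case: H => _ _ /(_ y)[h1 h2 h3] _; rewrite subr_ge0 h2/=; lra. Qed.

Lemma nnm_defect : nnm defect.
Proof.
split.
  apply: measurable_fun_if => //=.
    by apply: measurable_fun_ltr => //; exact: measurable_nrm.
  apply: measurable_funTS; apply: emeasurable_funD; first exact: (nnm_eav d nnm_F).1.
  by case: H => _ [mf _] _ _; apply/measurable_EFinP; exact: measurableT_comp.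
move=> z; rewrite /defect; case: ifPn => // zb; rewrite sube_ge0//.
by case: H => _ _ _ /(_ z zb)[].
Qed.

Lemma defectE z : (nrm z < b)%R -> eav F d z = F z + defect z.
Proof. by move=> zb; rewrite /defect zb addeC subeK. Qed.

Lemma integral_bounded_fin (h : R * R -> R) (K : R * R -> \bar R) :
  measurable_fun setT h -> (forall y, 0 <= h y <= B)%R -> nnm K -> \int[plane]_y K y < +oo ->
  \int[plane]_y ((h y)%:E * K y) < +oo.
Proof.
move=> mh hB [mK K0] Kfin.
apply: (@le_lt_trans _ _ (\int[plane]_y (B%:E * K y))).
  apply: ge0_le_integral_nonmeasurable => y _.
    by apply: mule_ge0 => //; rewrite lee_fin; have /andP[] := hB y.
  by apply: lee_wpmul2r => //; rewrite lee_fin; have /andP[] := hB y.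
rewrite ge0_integralZl// ?lee_fin ?data_B0//.
by rewrite lte_mul_pinfty// ?lee_fin ?data_B0.
Qed.

(** Integrate [green_smoothing] against [E]. Since [g <= M_d g], one has [E <= M_d E + defect] in
    the disc. By self-adjointness the integral of [E] against [M_d (green b z)] equals that of
    [M_d E] against [green b z]; being finite, it cancels, and only the defect of [f] remains. *)
Lemma smoothed_gap z : (nrm z <= r)%R ->
  \int[plane]_y (E y * ell d (y - z)%R) <=
  \int[plane]_y (green b z y * defect y) +
  (4 * (b / (b - r)))%:E * \int[plane]_y (E y * eav (ell d) b y).
Proof.
move=> zr; have [[r_0 rb r00 r0b /andP[d0 db]] [mf mg] hfg hsub] := H.
have zb : (nrm z < b)%R by exact: le_lt_trans rb.
have b0 : (0 < b)%R by exact: le_lt_trans rb.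
set C := (4 * (b / (b - r)))%R.
have C0 : (0 <= C)%R by rewrite mulr_ge0// divr_ge0// ?(ltW b0)// subr_ge0 ltW.
have nE := nnm_E; have nF := nnm_F; have nD := nnm_defect; have ng := nnm_green zb.
have nl := @nnm_ell R d; have nlz := nnmB z nl; have nMl := nnm_eav b nl.
have nEg := nnm_eav d nE; have nMg := nnm_eav d ng.
have A : \int[plane]_y (E y * eav (green b z) d y) + \int[plane]_y (E y * ell d (y - z)%R) <=
   \int[plane]_y (E y * green b z y) + C%:E * \int[plane]_y (E y * eav (ell d) b y).
  have n1 := nnmM nE nMg; have n2 := nnmM nE nlz.
  have n3 := nnmM nE ng; have n4 := nnmM nE nMl.
  have n5 : nnm (fun y => C%:E * (E y * eav (ell d) b y)).
    by split; [exact: measurable_funeM n4.1|move=> y; rewrite mule_ge0//; exact: n4.2].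
  rewrite -(ge0_integralZl plane measurableT n4.1 (fun y _ => n4.2 y))//.
  rewrite -(plane_integralD n1 n2).
  rewrite -(plane_integralD n3 n5).
  apply: ge0_le_integral_nonmeasurable => y _; first by apply: adde_ge0; [exact: n1.2|exact: n2.2].
  rewrite muleCA -!ge0_muleDr//; [|exact: ng.2|by rewrite mule_ge0// nMl.2|exact: nMg.2|exact: nlz.2].
  by apply: lee_wpmul2l; [exact: nE.2|exact: green_smoothing].
have Bq := eav_adjoint d nE ng.
have Cq : \int[plane]_y (E y * green b z y) <= \int[plane]_y (eav E d y * green b z y) + \int[plane]_y (green b z y * defect y).
  have n1 := nnmM nEg ng; have n2 := nnmM ng nD.
  rewrite -(plane_integralD n1 n2).
  apply: ge0_le_integral_nonmeasurable => y _; first by rewrite mule_ge0; [|exact: nE.2|exact: ng.2].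
  have [yb|yb] := ltP (nrm y) b; last first.
    by rewrite /green ltNge yb/= !mule0 mul0e adde0.
  rewrite muleC [X in _ <= X + _]muleC -ge0_muleDr; [|exact: nEg.2|exact: nD.2].
  apply: lee_wpmul2l; first exact: ng.2.
  have [_ hg] := hsub y yb.
  have eE : eav G d y = eav F d y + eav E d y.
    rewrite -eavD//; apply: eq_eav => x; rewrite -EFinD; congr EFin; ring.
  rewrite -/(eav G d y) in hg; move: hg; rewrite [X in _ <= X -> _]eE defectE// => hg.
  rewrite EFinB leeBlDl// (le_trans hg)// -addeA leeD2l// addeC//.
have fin : \int[plane]_y (eav E d y * green b z y) \is a fin_num.
  rewrite -Bq ge0_fin_numE; last by apply: integral_ge0 => y _; rewrite mule_ge0; [|exact: nE.2|exact: nMg.2].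
  apply: integral_bounded_fin => //; [exact: measurable_funB|exact: E_B|].
  rewrite plane_eav//; exact: green_integral_fin.
rewrite Bq in A; rewrite -(leeD2lE _ _ fin) (le_trans A)// addeA leeD2r//.
Qed.

(** A discrete Jensen formula: self-adjointness moves [M_d] onto [ell s], and [ell_eav_comm]
    exchanges it for [M_s (ell d)]. The condition [s <= b] makes [ell s] vanish where the defect is
    cut off. *)
Lemma defect_ell (s : R) : (0 < s)%R -> (s <= b)%R ->
  \int[plane]_y (defect y * ell s y) + \int[plane]_y (F y * ell d y) = \int[plane]_y (F y * eav (ell d) s y).
Proof.
move=> s0 sb; have [[r_0 rb r00 r0b /andP[d0 db]] [mf mg] hfg hsub] := H.
have nF := nnm_F; have nD := nnm_defect.
have nl := @nnm_ell R d; have ns := @nnm_ell R s.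
have fin : \int[plane]_y (F y * ell s y) \is a fin_num.
  rewrite ge0_fin_numE; last by apply: integral_ge0 => y _; rewrite mule_ge0; [|exact: nF.2|exact: ell_ge0].
  by apply: integral_bounded_fin => //; [exact: F_B|exact: ell_integral_fin].
have e1 := eav_adjoint d nF ns.
have e2 : \int[plane]_y (eav F d y * ell s y) = \int[plane]_y (F y * ell s y) + \int[plane]_y (defect y * ell s y).
  have n1 := nnmM nF ns; have n2 := nnmM nD ns.
  rewrite -(plane_integralD n1 n2).
  apply: eq_integral => y _; have [yb|yb] := ltP (nrm y) b.
    by rewrite defectE// ge0_muleDl//; [exact: nF.2|exact: nD.2].
  by rewrite (ell_out s0 (le_trans sb yb)) !mule0 adde0.
have e3 : \int[plane]_y (F y * eav (ell s) d y) + \int[plane]_y (F y * ell d y) =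
    \int[plane]_y (F y * eav (ell d) s y) + \int[plane]_y (F y * ell s y).
  have n1 := nnmM nF (nnm_eav d ns); have n2 := nnmM nF nl.
  have n3 := nnmM nF (nnm_eav s nl); have n4 := nnmM nF ns.
  apply: (eq_trans (esym (plane_integralD n1 n2))); apply: (eq_trans _ (plane_integralD n3 n4)).
  apply: eq_integral => y _.
  apply: (eq_trans (esym (ge0_muleDr _ ((nnm_eav d ns).2 y) (ell_ge0 d y)))).
  apply: (eq_trans _ (ge0_muleDr _ ((nnm_eav s nl).2 y) (ell_ge0 s y))).
  by apply: (congr1 (fun x => F y * x)); exact: ell_eav_comm.
have key (p q a c u v : \bar R) : a \is a fin_num -> p = q -> q = a + c -> p + u = v + a -> c + u = v.
  move=> afin -> ->; rewrite -addeA addeC => h.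
  by rewrite -[LHS](addeK _ afin) h addeK.
exact: (key _ _ _ _ _ _ fin e1 e2 e3).
Qed.

Section total.
Context d' (T : measurableType d').
Variables (nu : {sigma_finite_measure set T -> \bar R}) (tau : T -> R) (gam : T -> \bar R) (Q : R).

(** With [gkernel] in place of [green] the bound depends on the radius alone, so it holds for the
    supremum over a circle and can be integrated in the radius. *)
Definition gapbound (t : R) : \bar R :=
  \int[plane]_y (gkernel b t (nrm y) * defect y) +
  (4 * (b / (b - r)))%:E * \int[plane]_y (E y * eav (ell d) b y).

Lemma smoothed_gap_bound z : (nrm z <= r)%R ->
  \int[plane]_y (E y * ell d (y - z)%R) <= gapbound (nrm z).
Proof.
move=> zr; apply: (le_trans (smoothed_gap zr)); rewrite leeD2r//.
have [[_ rb _ _ _] _ _ _] := H.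
have zb : (nrm z < b)%R by exact: le_lt_trans rb.
apply: ge0_le_integral_nonmeasurable => y _; first by rewrite mule_ge0; [|exact: (nnm_green zb).2|exact: nnm_defect.2].
by apply: lee_wpmul2r; [exact: nnm_defect.2|exact: green_le_gkernel].
Qed.

Lemma nn_defect_kernel : measurable_fun setT (fun u : mR * (mR * mR) => gkernel b u.1 (nrm u.2) * defect u.2).
Proof.
apply: emeasurable_funM; last exact: (measurableT_comp nnm_defect.1 measurable_snd).
have m : measurable_fun setT (fun u : mR * (mR * mR) => (u.1, nrm u.2) : mR * mR).
  apply: measurable_fun_pair => //.
  exact: (measurableT_comp (@measurable_nrm R) measurable_snd).
exact: (measurableT_comp (@measurable_gkernel b) m).
Qed.

Lemma measurable_gapbound : measurable_fun setT gapbound.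
Proof.
apply: emeasurable_funD => //.
apply: (@measurable_fun_fubini_tonelli_F _ _ mR (mR * mR)%type R plane (fun u => gkernel b u.1 (nrm u.2) * defect u.2)).
  exact: nn_defect_kernel.
by move=> u; rewrite mule_ge0; [|exact: gkernel_ge0|exact: nnm_defect.2].
Qed.

Lemma gapbound_ge0 t : 0 <= gapbound t.
Proof.
have [[r_0 rb _ _ _] _ _ _] := H.
apply: adde_ge0; first by apply: integral_ge0 => y _; rewrite mule_ge0; [|exact: gkernel_ge0|exact: nnm_defect.2].
apply: mule_ge0; first by rewrite lee_fin mulr_ge0// divr_ge0//; lra.
by apply: integral_ge0 => y _; rewrite mule_ge0; [|exact: nnm_E.2|apply: eav_ge0 => w; exact: ell_ge0].
Qed.

Hypotheses (mtau : measurable_fun setT tau) (mgam : measurable_fun setT gam) (gam0 : forall x, 0 <= gam x).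
Hypotheses (Q0 : (0 <= Q)%R)
  (hC : (4 * (b / (b - r)))%:E * \int[nu]_x gam x <= Q%:E)
  (hK : forall s : R, (0 <= s)%R -> (s < b)%R ->
     \int[nu]_x (gkernel b (tau x) s * gam x) <= (Q * (ln b - ln (Num.max s r0)))%:E).

(** By Tonelli the weight acts on the kernel first; [hK] bounds the outcome by [Q W], where
    [W + ell r0 = ell b], and [defect_ell] at [b] and [r0] turns the integral of [W] against the
    defect into a difference of smoothed circle means of [f]. The boundary term is absorbed through
    [hC] with the same [Q], and [E + F = G] joins the two contributions at [b]. The result is kept
    as a sum to avoid subtractions in the extended reals. *)
Lemma gapbound_total :
  \int[nu]_x (gapbound (tau x) * gam x) + Q%:E * \int[plane]_y (F y * eav (ell d) r0 y) <=
  Q%:E * \int[plane]_y (G y * eav (ell d) b y).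
Proof.
have [[r_0 rb r00 r0b /andP[d0 db]] [mf mg] hfg hsub] := H.
have b0 : (0 < b)%R by exact: le_lt_trans rb.
have nE := nnm_E; have nF := nnm_F; have nG := nnm_G; have nD := nnm_defect.
have nl := @nnm_ell R d; have nMl := nnm_eav b nl; have nMl0 := nnm_eav r0 nl.
pose C := (4 * (b / (b - r)))%R; have hC' : C%:E * \int[nu]_x gam x <= Q%:E := hC.
have C0 : (0 <= C)%R by rewrite mulr_ge0// divr_ge0// ?(ltW b0)// subr_ge0 ltW.
pose W y : \bar R := if (nrm y < b)%R then (ln b - ln (Num.max (nrm y) r0))%:E else 0.
have W0 y : 0 <= W y.
  rewrite /W; case: ifPn => // yb; rewrite lee_fin subr_ge0 ler_ln ?posrE ?lt_max ?r00 ?orbT//.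
  by rewrite ge_max !ltW.
have mW : measurable_fun setT W.
  apply: measurable_fun_if => //=; first by apply: measurable_fun_ltr => //; exact: measurable_nrm.
  apply: measurable_funTS; apply/measurable_EFinP; apply: measurable_funB => //.
  apply: (measurableT_comp (@measurable_ln R)); apply: measurable_maxr => //; exact: measurable_nrm.
have nW : nnm W by split.
have WE y : W y + ell r0 y = ell b y.
  have n0 := nrm_ge0 y; rewrite /W; case: ifPn => [yb|]; last first.
    by rewrite -leNgt => yb; rewrite !ell_out ?add0e//; lra.
  rewrite [RHS]ell_in; last exact: ltW.
  have [yr|yr] := leP (nrm y) r0.
    rewrite ell_in// /logpot; case: ifPn => // y0.
    by rewrite -EFinD; congr EFin; ring.
  rewrite [X in _ + X]ell_out//; last exact: ltW.
  by rewrite adde0 logpotE//; lra.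
have dW : \int[plane]_y (defect y * W y) + \int[plane]_y (F y * eav (ell d) r0 y) = \int[plane]_y (F y * eav (ell d) b y).
  have n1 := nnmM nD nW; have n2 := nnmM nD (@nnm_ell R r0).
  have hs : \int[plane]_y (defect y * W y) + \int[plane]_y (defect y * ell r0 y) = \int[plane]_y (defect y * ell b y).
    apply: (eq_trans (esym (plane_integralD n1 n2))); apply: eq_integral => y _.
    by rewrite -WE ge0_muleDr//; exact: ell_ge0.
  have key (p q a c u v : \bar R) : p + q = a -> q + c = u -> a + c = v -> p + u = v.
    by move=> <- <- <-; rewrite addeA.
  exact: (key _ _ _ _ _ _ hs (defect_ell r00 (ltW r0b)) (defect_ell b0 (lexx b))).
have Gq : \int[plane]_y (E y * eav (ell d) b y) + \int[plane]_y (F y * eav (ell d) b y) = \int[plane]_y (G y * eav (ell d) b y).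
  have n1 := nnmM nE nMl; have n2 := nnmM nF nMl.
  rewrite -(plane_integralD n1 n2).
  apply: eq_integral => y _; rewrite -ge0_muleDl; [|exact: nE.2|exact: nF.2].
  by rewrite -EFinD subrK.
have mk : measurable_fun setT (fun u : T * (mR * mR) => gkernel b (tau u.1) (nrm u.2) * defect u.2).
  have m : measurable_fun setT (fun u : T * (mR * mR) => (tau u.1, u.2) : mR * (mR * mR)).
    by apply: measurable_fun_pair => //; exact: (measurableT_comp mtau measurable_fst).
  exact: (measurableT_comp nn_defect_kernel m).
have k0 t y : 0 <= gkernel b t (nrm y) * defect y by rewrite mule_ge0; [|exact: gkernel_ge0|exact: nD.2].
pose I t := \int[plane]_y (gkernel b t (nrm y) * defect y).
have I0 t : 0 <= I t by apply: integral_ge0.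
pose e := \int[plane]_y (E y * eav (ell d) b y).
have e0 : 0 <= e by apply: integral_ge0 => y _; rewrite mule_ge0; [|exact: nE.2|exact: nMl.2].
have mI : measurable_fun setT (fun x => I (tau x)).
  by apply: (@measurable_fun_fubini_tonelli_F _ _ T (mR * mR)%type R plane (fun u => gkernel b (tau u.1) (nrm u.2) * defect u.2)).
have split1 : \int[nu]_x (gapbound (tau x) * gam x) = \int[nu]_x (I (tau x) * gam x) + \int[nu]_x (C%:E * e * gam x).
  rewrite -ge0_integralD//.
  - apply: eq_integral => x _; rewrite -ge0_muleDl//.
    by rewrite mule_ge0.
  - by move=> x _; rewrite mule_ge0.
  - exact: emeasurable_funM.
  - by move=> x _; rewrite !mule_ge0.
  - exact: measurable_funeM.
have part2 : \int[nu]_x (C%:E * e * gam x) <= Q%:E * e.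
  rewrite ge0_integralZl//; last by rewrite mule_ge0.
  rewrite muleAC; exact: lee_wpmul2r hC'.
have part1 : \int[nu]_x (I (tau x) * gam x) <= Q%:E * \int[plane]_y (defect y * W y).
  have mu_ : measurable_fun setT (fun u : T * (mR * mR) => gkernel b (tau u.1) (nrm u.2) * defect u.2 * gam u.1).
    by apply: emeasurable_funM => //; exact: (measurableT_comp mgam measurable_fst).
  have -> : \int[nu]_x (I (tau x) * gam x) = \int[nu]_x \int[plane]_y (gkernel b (tau x) (nrm y) * defect y * gam x).
    apply: eq_integral => x _; rewrite -ge0_integralZr//.
    exact: (measurableT_comp mk (pair1_measurable x)).
  rewrite (@fubini_tonelli _ _ T (mR * mR)%type R nu plane (fun u => gkernel b (tau u.1) (nrm u.2) * defect u.2 * gam u.1))//=; last first.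
    by move=> u; rewrite mule_ge0.
  rewrite -ge0_integralZl//; [|exact: (nnmM nD nW).1|by move=> y _; exact: (nnmM nD nW).2].
  apply: ge0_le_integral_nonmeasurable => y _.
    by apply: integral_ge0 => x _; rewrite mule_ge0.
  have [yb|yb] := ltP (nrm y) b; last first.
    rewrite /defect ltNge yb/= mul0e mule0.
    by rewrite integral0_eq// => x _; rewrite mule0 mul0e.
  under eq_integral do rewrite muleAC.
  rewrite ge0_integralZr//.
  - rewrite muleCA muleC; apply: lee_wpmul2l; first exact: nD.2.
    by rewrite /W yb -EFinM; apply: hK => //; exact: nrm_ge0.
  - apply: emeasurable_funM => //.
    have m : measurable_fun setT (fun x : T => (tau x, nrm y) : mR * mR) by exact: measurable_fun_pair.
    exact: (measurableT_comp (@measurable_gkernel b) m).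
  - by move=> x _; rewrite mule_ge0// gkernel_ge0.
  - exact: nD.2.
rewrite split1.
apply: (@le_trans _ _ (Q%:E * \int[plane]_y (defect y * W y) + Q%:E * e + Q%:E * \int[plane]_y (F y * eav (ell d) r0 y))).
  by rewrite leeD2r// leeD.
have i1 : 0 <= \int[plane]_y (defect y * W y) by apply: integral_ge0 => y _; rewrite mule_ge0; [|exact: nD.2|].
have i2 : 0 <= \int[plane]_y (F y * eav (ell d) r0 y) by apply: integral_ge0 => y _; rewrite mule_ge0; [|exact: nF.2|exact: nMl0.2].
have key (p q u v x : \bar R) : 0 <= p -> 0 <= q -> 0 <= u -> q + v = x -> p + u = v ->
    Q%:E * p + Q%:E * q + Q%:E * u <= Q%:E * x.
  move=> p0 q0 u0 <- <-; rewrite !ge0_muleDr ?adde_ge0//.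
  by rewrite addeA [X in X + _ <= _]addeC.
exact: (key _ _ _ _ _ i1 e0 i2 Gq dW).
Qed.

End total.
End data.
End core.

(** * Integrals of the kernel *)

Section estimates.
Context {R : realType}.
Implicit Types (a b c q s t x y : R).

(** Here [ln 2 = ln 8 - ln 4] is at least [1/5 + 1/6 + 1/7 + 1/8]. *)
Lemma ln2_ge : 317 / 500 <= ln 2 :> R.
Proof.
have step (n : R) : 0 < n -> (n + 1)^-1 <= ln (n + 1) - ln n.
  move=> n0; rewrite -ln_div ?posrE//; last lra.
  apply: le_trans (ln_ge1B _); last by apply: divr_gt0; lra.
  by rewrite invf_div le_eqVlt; apply/orP; left; apply/eqP; field; lra.
have h4 := @step 4 ltac:(lra); have h5 := @step 5 ltac:(lra).
have h6 := @step 6 ltac:(lra); have h7 := @step 7 ltac:(lra).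
have : ln 8 = ln 2 + ln 4 :> R by rewrite -lnM ?posrE//; congr ln; ring.
rewrite (_ : 4 + 1 = 5 :> R) in h4; last by ring.
rewrite (_ : 5 + 1 = 6 :> R) in h5; last by ring.
rewrite (_ : 6 + 1 = 7 :> R) in h6; last by ring.
rewrite (_ : 7 + 1 = 8 :> R) in h7; last by ring.
lra.
Qed.

Lemma ln4_ge : 317 / 250 <= ln 4 :> R.
Proof.
have -> : (4 : R) = 2 * 2 by ring.
by rewrite lnM ?posrE//; have := ln2_ge; lra.
Qed.

(** Bounded by [1/3 + 1/4 + 1/5 + 1/6 = 0.95]. It makes [3/7] a rational substitute for [1/e] in
    [ln x <= x / e]. *)
Lemma ln73_le1 : ln (7 / 3) <= 1 :> R.
Proof.
have step (n : R) : 0 < n -> ln (n + 1) - ln n <= n^-1.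
  move=> n0; rewrite -ln_div ?posrE//; last lra.
  apply: le_trans (ln_leB1 _) _; first by apply: divr_gt0; lra.
  by rewrite le_eqVlt; apply/orP; left; apply/eqP; field; lra.
have h3 := @step 3 ltac:(lra); have h4 := @step 4 ltac:(lra).
have h5 := @step 5 ltac:(lra); have h6 := @step 6 ltac:(lra).
rewrite (_ : 3 + 1 = 4 :> R) in h3; last by ring.
rewrite (_ : 4 + 1 = 5 :> R) in h4; last by ring.
rewrite (_ : 5 + 1 = 6 :> R) in h5; last by ring.
rewrite (_ : 6 + 1 = 7 :> R) in h6; last by ring.
rewrite ln_div ?posrE//; lra.
Qed.

Lemma ln_le37 x : 0 < x -> ln x <= 3 / 7 * x.
Proof.
move=> x0; have -> : ln x = ln (3 / 7 * x) + ln (7 / 3).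
  by rewrite -lnM ?posrE ?mulr_gt0//; congr ln; field.
by have := ln73_le1; have := ln_leB1 (_ : 0 < 3 / 7 * x); rewrite mulr_gt0// => /(_ isT); lra.
Qed.

(** With [u = y^{1/(2q)}] one has [ln y = 2 q ln u <= (6/7) q u] and [u^q = sqrt y]. The square root
    is an integrable singularity whatever [q] is. *)
Lemma log_pow_bound q l y : 1 <= q -> 0 <= l -> 1 <= y ->
  (l + ln y) `^ q <= (l + 6 / 7 * q) `^ q * Num.sqrt y.
Proof.
move=> q1 l0 y1; have q0 : 0 < q by lra.
have y0 : 0 < y by lra.
pose u := y `^ (2 * q)^-1.
have u1 : 1 <= u by have := @ge0_ler_powR R (2 * q)^-1; rewrite invr_ge0 => /(_ _ 1 y); rewrite powR1 !nnegrE; apply; lra.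
have lu : ln y = 2 * q * ln u by rewrite /u ln_powR mulrA divff ?mul1r//; lra.
have b1 : l + ln y <= (l + 6 / 7 * q) * u.
  have : 2 * q * ln u <= 2 * q * (3 / 7 * u) by apply: ler_wpM2l; [lra|apply: ln_le37; lra].
  have : l * 1 <= l * u by apply: ler_wpM2l.
  by rewrite lu mulrDl; lra.
have ly0 : 0 <= ln y by exact: ln_ge0.
have b0 : 0 <= (l + 6 / 7 * q) * u by lra.
apply: (@le_trans _ _ (((l + 6 / 7 * q) * u) `^ q)).
  by apply: ge0_ler_powR; rewrite ?nnegrE; lra.
rewrite powRM; [|lra|lra].
have -> : u `^ q = Num.sqrt y.
  rewrite /u -powRrM (_ : (2 * q)^-1 * q = 2^-1); first exact/powR12_sqrt/ltW.
  by field; lra.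
by [].
Qed.

(** The numerical origin of the factor 4. The right side is at least [(12/5) q (l + ln 2)]. A part
    [2 q l] of it pays for [2 l]; the rest is at least [(14/5) q ln 2], just above [(12/7) q]
    because [ln 2 >= 317/500]. *)
Lemma kernel_near_const q l L K : 1 <= q -> ln 2 <= l -> L = l + ln 2 -> 3 / 5 <= K ->
  2 * (l + 6 / 7 * q) <= 4 * (q * L) * K.
Proof.
move=> q1 l2 -> K3; have h2 := ln2_ge.
have : q * ln 2 * 1 <= q * l by rewrite mulr1 ler_wpM2l//; lra.
have : l <= q * l by rewrite ler_peMl//; lra.
have : q * (317 / 500) <= q * ln 2 by apply: ler_wpM2l => //; lra.
have : 4 * (q * (l + ln 2)) * (3 / 5) <= 4 * (q * (l + ln 2)) * K.
  by apply: ler_wpM2l => //; rewrite mulr_ge0// mulr_ge0; lra.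
lra.
Qed.

Lemma kernel_near_ratio b r s : 0 < r -> r < b -> s <= r + 2 / 5 * (b - r) ->
  3 / 5 <= b / (b - r) * ((b - s) / b).
Proof.
move=> r0 rb sr; rewrite (_ : _ * _ = (b - s) / (b - r)); last by field; apply/andP; split; lra.
by rewrite ler_pdivlMr; lra.
Qed.

(** Beyond [r + (2/5) (b - r)] the distance [s - t] is at least [(2/5) (b - r)], whence the 5, and
    [5 <= 4 ln 4] still fits the final constant. Before that radius [(b - s) / (b - r)] is at least
    [3/5], as the near case requires. *)
Lemma kernel_far_ratio b r s t : 0 <= t -> t <= r -> r < b -> r + 2 / 5 * (b - r) <= s -> s < b ->
  (b ^+ 2 - t * s) / (b * (s - t)) - 1 <= 5 * (b / (b - r)) * ((b - s) / b).
Proof.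
move=> t0 tr rb rs sb; have b0 : 0 < b by lra.
have st : 0 < s - t by lra.
have w0 : 0 < b - r by lra.
rewrite (_ : _ - 1 = (b - s) / b * ((b + t) / (s - t))); last by field; rewrite !gt_eqF.
rewrite [leRHS]mulrC; apply: ler_wpM2l; first by rewrite divr_ge0//; lra.
rewrite ler_pdivrMr// (_ : 5 * (b / (b - r)) * (s - t) = 5 * (b * (s - t)) / (b - r)); last by field; rewrite gt_eqF.
rewrite ler_pdivlMr//.
have : (b + t) * (b - r) <= 2 * b * (b - r) by apply: ler_wpM2r; lra.
have : b * (2 / 5 * (b - r)) <= b * (s - t) by apply: ler_wpM2l; lra.
lra.
Qed.

Lemma kernel_near b r s t : 0 <= t -> t <= r -> r < b -> 0 <= s -> s < b ->
  ln (b ^+ 2 - t * s) <= ln b + ln b.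
Proof.
move=> t0 tr rb s0 sb; have b0 : 0 < b by lra.
have ts0 : 0 <= t * s by exact: mulr_ge0.
have ts1 : t * s <= r * b by apply: ler_pM => //; exact: ltW.
have ts2 : r * b < b * b by rewrite ltr_pM2r.
by rewrite -lnM ?posrE// ler_ln ?posrE ?mulr_gt0// ?expr2; lra.
Qed.

(* With [y = a / |t|], [log_pow_bound] bounds powers of [l + ln y] by [1 + psi a t]. *)
Definition psi a t : R := Num.max (Num.sqrt (a / `|t|) - 1) 0.

Lemma psi_ge0 a t : 0 <= psi a t. Proof. by rewrite /psi le_max lexx orbT. Qed.

Lemma measurable_psi a : measurable_fun setT (psi a).
Proof.
rewrite (_ : psi a = (fun t => Num.max (Num.sqrt (a * `|t| `^ (-1)) - 1) 0)); last first.
  by apply/funext => t; rewrite powR_inv1.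
apply: measurable_maxr => //; apply: measurable_funB => //.
apply: (measurableT_comp (f := @Num.sqrt R)).
  by apply: continuous_measurable_fun => ?; exact: sqrt_continuous.
apply: measurable_funM => //; apply: (measurableT_comp (@measurable_powR R (-1))).
exact: normr_measurable.
Qed.

Lemma sqrt_inv_continuous a e x : 0 < e -> e <= x ->
  {for x, continuous (fun x => Num.sqrt a / Num.sqrt x - 1)}.
Proof.
move=> e0 ex; apply: cvgB; last exact: cvg_cst.
apply: cvgM; first exact: cvg_cst.
apply: cvgV; first by rewrite gt_eqF// sqrtr_gt0; lra.
exact: sqrt_continuous.
Qed.

Lemma integral_sqrt_inv a e : 0 < e -> e < a ->
  (\int[lebesgue_measure]_(x in `[e, a]) (Num.sqrt a / Num.sqrt x - 1)%:E <= a%:E)%E.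
Proof.
move=> e0 ea; have a0 : 0 < a by lra.
pose F x := 2 * Num.sqrt a * Num.sqrt x - x.
have dF x : 0 < x -> is_derive x 1 F (Num.sqrt a / Num.sqrt x - 1).
  move=> x0; have ds := is_derive1_sqrt x0.
  have -> : Num.sqrt a / Num.sqrt x - 1 = (2 * Num.sqrt a) *: (2 * Num.sqrt x)^-1 - 1.
    by rewrite /GRing.scale/=; field; rewrite gt_eqF// sqrtr_gt0.
  apply: is_deriveB; exact: is_deriveZ.
have cF x : 0 < x -> {for x, continuous F}.
  move=> x0; apply: differentiable_continuous; apply/derivable1_diffP.
  by have := dF x x0; case.
rewrite (@continuous_FTC2 _ _ F)//.
- rewrite -EFinB lee_fin /F -mulrA -expr2 sqr_sqrtr ?(ltW a0)//.
  have s1 : Num.sqrt e * Num.sqrt e = e by rewrite -expr2 sqr_sqrtr// ltW.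
  have s2 : Num.sqrt e <= Num.sqrt a by rewrite ler_sqrt//; lra.
  have : Num.sqrt e * Num.sqrt e <= Num.sqrt a * Num.sqrt e by apply: ler_wpM2r => //; exact: sqrtr_ge0.
  by rewrite -(mulrA 2 (Num.sqrt a) (Num.sqrt e)) s1; lra.
- apply: continuous_in_subspaceT => x; rewrite inE/= in_itv/= => /andP[ex xa].
  exact: (@sqrt_inv_continuous a e).
- split.
  + move=> x; rewrite in_itv/= => /andP[ex xa]; have := dF x (lt_trans e0 ex); by case.
  + by apply: cvg_at_right_filter; exact: cF.
  + by apply: cvg_at_left_filter; exact: cF.
- move=> x; rewrite in_itv/= => /andP[ex xa].
  by rewrite derive1E; have d := dF x (lt_trans e0 ex); rewrite derive_val.
Qed.

Lemma psiE a t : 0 < t -> t <= a -> psi a t = Num.sqrt a / Num.sqrt t - 1.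
Proof.
move=> t0 ta; have a0 : 0 < a by lra.
rewrite /psi gtr0_norm// sqrtrM ?(ltW a0)// sqrtrV ?(ltW t0)//; apply/max_idPl.
by rewrite subr_ge0 ler_pdivlMr ?sqrtr_gt0// mul1r ler_sqrt// ltW.
Qed.

Lemma psiN a t : psi a (- t) = psi a t.
Proof. by rewrite /psi normrN. Qed.

Lemma psi_out a t : 0 < a -> a <= `|t| -> psi a t = 0.
Proof.
move=> a0 ta; apply/max_idPr; rewrite subr_le0 -sqrtr1 ler_sqrt//.
by rewrite ler_pdivrMr ?mul1r//; lra.
Qed.

(** On either side of 0 the primitive [2 sqrt (a x) - x] yields at most [a]. The fundamental theorem
    of calculus applies away from 0 only, so the singularity is reached by Fatou's lemma. *)
Lemma integral_psi a : 0 < a ->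
  (\int[lebesgue_measure]_t (psi a t)%:E <= (2 * a)%:E)%E.
Proof.
move=> a0; pose e n : R := a / n.+2%:R.
have e0 n : 0 < e n by rewrite divr_gt0.
have ea n : e n < a by rewrite ltr_pdivrMr// ltr_pMr// ltr1n.
pose D1 n : set R := `[e n, a]%classic; pose D2 n : set R := `[(- a), (- e n)]%classic.
have d12 n : [disjoint D1 n & D2 n].
  apply/disj_setPS => t [] /=; rewrite /D1 /D2 /= !in_itv/= => /andP[h1 h2] /andP[h3 h4].
  by have := e0 n; lra.
pose u n t : \bar R := (psi a t * \1_(D1 n `|` D2 n) t)%:E.
have mu_ n : measurable_fun setT (u n).
  apply/measurable_EFinP; apply: measurable_funM; first exact: measurable_psi.
  by apply: measurable_indic; apply: measurableU; exact: measurable_itv.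
have u0 n t : (0 <= u n t)%E by rewrite lee_fin mulr_ge0// psi_ge0.
have ub n : (\int[lebesgue_measure]_t u n t <= (2 * a)%:E)%E.
  have -> : (\int[lebesgue_measure]_t u n t = \int[lebesgue_measure]_(t in D1 n `|` D2 n) (psi a t)%:E)%E.
    rewrite [RHS]integral_mkcond; apply: eq_integral => t _.
    rewrite /u patchE indicE; case: ifP => _; first by rewrite mulr1.
    by rewrite mulr0.
  rewrite ge0_integral_setU//=; last 4 first.
  - exact: measurable_itv.
  - exact: measurable_itv.
  - by apply: measurable_funTS; apply/measurable_EFinP; exact: measurable_psi.
  - by move=> t _; rewrite lee_fin psi_ge0.
  have i1 : (\int[lebesgue_measure]_(t in D1 n) (psi a t)%:E <= a%:E)%E.
    apply: le_trans (integral_sqrt_inv (e0 n) (ea n)); rewrite le_eqVlt; apply/orP; left; apply/eqP.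
    apply: eq_integral => t; rewrite inE /D1 /D2 /= in_itv/= => /andP[h1 h2].
    by rewrite psiE//; have := e0 n; lra.
  have i2 : (\int[lebesgue_measure]_(t in D2 n) (psi a t)%:E <= a%:E)%E.
    apply: le_trans (integral_sqrt_inv (e0 n) (ea n)); rewrite le_eqVlt; apply/orP; left; apply/eqP.
    rewrite -[RHS](_ : (\int[lebesgue_measure]_(x in `[e n, a]) (((fun x => Num.sqrt a / Num.sqrt (- x) - 1) \o -%R) x)%:E = _)%E); last first.
      by apply: eq_integral => x _ /=; rewrite opprK.
    rewrite -integration_by_substitution_oppr//; last 2 first.
    - exact: ltW.
    - apply: continuous_in_subspaceT => x; rewrite inE/= in_itv/= => /andP[h1 h2].
      apply: (@continuous_comp _ _ _ (fun x : R => - x) (fun x => Num.sqrt a / Num.sqrt x - 1)).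
        exact: opp_continuous.
      by apply: (@sqrt_inv_continuous a (e n)) => //; lra.
    apply: eq_integral => t; rewrite inE /D1 /D2 /= in_itv/= => /andP[h1 h2].
    by rewrite -psiN psiE//; have := e0 n; lra.
  by rewrite (le_trans (leeD i1 i2))// -EFinD lee_fin; lra.
apply: (@le_trans _ _ (\int[lebesgue_measure]_t limn_einf (fun n => u n t))%E); last first.
  apply: (@le_trans _ _ (limn_einf (fun n => \int[lebesgue_measure]_t u n t)%E)).
    by apply: fatou.
  by apply: limn_einf_le => n; exists n.
apply: ge0_le_integral_nonmeasurable => t _; first by rewrite lee_fin psi_ge0.
apply: limn_einf_ge => c /ltW; rewrite lee_fin => ct.
have [ta|ta] := leP a `|t|.
  by near=> n; rewrite lee_fin (le_trans ct)// psi_out// mulr_ge0// psi_ge0.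
(* At the pole itself [psi] is 0, because division by zero gives 0. *)
have [t0|t0] := eqVneq t 0.
  near=> n; rewrite lee_fin (le_trans ct)// t0 /psi normr0 invr0 mulr0 sqrtr0.
  by rewrite (max_idPr _) ?sub0r ?oppr_le0// mul0r.
have tp : 0 < `|t| by rewrite normr_gt0.
near=> n; have en : e n <= `|t|.
  rewrite /e ler_pdivrMr// mulrC -ler_pdivrMr//.
  apply: (@le_trans _ _ n%:R); last by rewrite ler_nat; lia.
  by near: n; exact: nbhs_infty_ger.
rewrite lee_fin (le_trans ct)// indicE mem_set ?mulr1//.
have [tpos|tneg] := leP 0 t.
  by left; rewrite /D1/= in_itv/=; move: en ta; rewrite ger0_norm// => -> /ltW ->.
right; rewrite /D2/= in_itv/=; move: en ta; rewrite ltr0_norm// => h1 h2.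
by apply/andP; split; lra.
Unshelve. all: by end_near. Qed.

End estimates.

(** * Weights and Holder's inequality *)

Section holder.
Context {R : realType} d (T : measurableType d) (nu : {measure set T -> \bar R}).
Local Open Scope ereal_scope.
Variables (E : set T) (g : T -> R).

Definition extend0 (t : T) : R := if t \in E then g t else 0%R.

Hypotheses (mE : measurable E) (mg : measurable_fun E g) (nu0 : 0 < nu setT).

Lemma measurable_extend0 : measurable_fun setT extend0.
Proof.
rewrite (_ : extend0 = g \_ E); first by apply/(measurable_restrictT _ _).1.
by apply/funext => t; rewrite patchE.
Qed.

Local Notation N p := (Lnorm nu p (EFin \o extend0)).

(** Holder's inequality is applied to [h] cut off to [E], since the weight vanishes elsewhere. For
    [p = +oo] the norm is an essential supremum whose definition tests [0 < nu setT]; that case is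
    done directly. *)
Lemma holder_extend0 (p : \bar R) (q A m : R) (h : T -> R) :
  1 < p ->
  ((p = +oo /\ q = 1%R) \/ (exists p' : R, p = p'%:E /\ (p'^-1 + q^-1 = 1)%R)) ->
  N p < +oo -> measurable_fun setT h -> (forall t, 0 <= h t)%R -> (0 <= A)%R -> (0 <= m)%R ->
  \int[nu]_(t in E) (h t `^ q)%:E <= (A `^ q * m)%:E ->
  \int[nu]_t ((h t)%:E * `|(extend0 t)%:E|) <= (A * m `^ q^-1)%:E * N p.
Proof.
move=> p1 pq Np mh h0 A0 m0 hE.
pose h1 t := (h t * \1_E t)%R.
have mh1 : measurable_fun setT h1 by apply: measurable_funM => //; exact: measurable_indic.
have h10 t : (0 <= h1 t)%R by rewrite mulr_ge0.
have mx := measurable_extend0.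
have hh1 : \int[nu]_t ((h t)%:E * `|(extend0 t)%:E|) = \int[nu]_t `|(extend0 t * h1 t)%:E|.
  apply: eq_integral => t _; rewrite EFinM abseM muleC.
  rewrite /h1 indicE /extend0; case: ifP => _; last by rewrite abse0 !mul0e.
  by rewrite mulr1 (gee0_abs (_ : 0 <= (h t)%:E))// lee_fin.
rewrite {}hh1; case: pq => [[pE qE]|[p' [pE pq]]].
  rewrite pE qE in Np hE *; rewrite invr1 !powRr1// in hE *.
  have Nge : \forall t \ae nu, `|(extend0 t)%:E| <= N +oo.
    have := ess_sup_inf.ess_sup_ge (nu) (abse \o (EFin \o extend0)).
    by rewrite unlock /= nu0.
  have N0 : 0 <= N +oo by exact: Lnorm_ge0.
  apply: (@le_trans _ _ (\int[nu]_t (N +oo * (h1 t)%:E))).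
    apply: ae_ge0_le_integral => //.
    - by apply/measurable_EFinP; apply: measurableT_comp => //; exact: measurable_funM.
    - by move=> t _; apply: mule_ge0 => //; rewrite lee_fin.
    - by apply: measurable_funeM; exact/measurable_EFinP.
    - apply: filterS Nge => t Nt _.
      have h1t : 0 <= (h1 t)%:E by rewrite lee_fin.
      rewrite EFinM abseM (gee0_abs h1t).
      exact: lee_wpmul2r.
  rewrite ge0_integralZl//; [|exact/measurable_EFinP|by move=> t _; rewrite lee_fin].
  rewrite muleC; apply: lee_wpmul2r => //.
  apply: le_trans hE; rewrite [leRHS]integral_mkcond le_eqVlt; apply/orP; left; apply/eqP.
  apply: eq_integral => t _; rewrite /h1 patchE indicE; case: ifP => _.
    by rewrite mulr1 powRr1.
  by rewrite mulr0.
have p'1 : (1 < p')%R by rewrite -lte_fin -pE.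
have p'0 : (0 < p')%R by lra.
have q0 : (0 < q)%R.
  rewrite -invr_gt0; have : (p'^-1 < 1)%R by rewrite invf_lt1.
  by lra.
have := hoelder nu mx mh1 p'0 q0 pq; rewrite Lnorm1 /= => /le_trans; apply.
rewrite pE muleC; apply: lee_wpmul2r; first exact: Lnorm_ge0.
have IE : \int[nu]_t (`|(h1 t)%:E| `^ q) = \int[nu]_(t in E) (h t `^ q)%:E.
  rewrite [RHS]integral_mkcond; apply: eq_integral => t _.
  rewrite patchE /h1 indicE; case: ifP => _.
    by rewrite mulr1 /= ger0_norm.
  by rewrite mulr0 /= normr0 powR0// gt_eqF.
rewrite unlock /= IE.
have -> : (A * m `^ q^-1)%:E = (A `^ q * m)%:E `^ q^-1.
  rewrite poweR_EFin powRM ?powR_ge0// -powRrM divff ?gt_eqF// powRr1//.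
move: hE; have : 0 <= \int[nu]_(t in E) (h t `^ q)%:E.
  by apply: integral_ge0 => t _; rewrite lee_fin powR_ge0.
case: (\int[nu]_(t in E) (h t `^ q)%:E) => [I||]//=.
rewrite !lee_fin => I0 IA; apply: ge0_ler_powR; rewrite ?nnegrE ?invr_ge0 ?(ltW q0)//.
exact: le_trans IA.
Qed.

End holder.

Section lebesgue.
Context {R : realType}.
Local Notation mR := (measurableTypeR R).
Local Open Scope ereal_scope.

Lemma cmu_lebesgue (A : set R) : (@cmu R) A = lebesgue_measure A.
Proof. by []. Qed.

(** [E] and [g] are Lebesgue measurable, while the kernels are Borel in the radius. Hence the
    estimates live on a space [T] with a map [tau] to the Borel line; in the end [tau] is this
    identity. *)
Lemma measurable_LebT_id : measurable_fun setT (id : LebT R -> mR).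
Proof. by move=> _ A mA; rewrite setTI; exact: sub_caratheodory. Qed.

Lemma measurable_LebT_set (A : set R) : measurable (A : set mR) -> measurable (A : set (LebT R)).
Proof. exact: sub_caratheodory. Qed.

Lemma integral_cmu (f : R -> \bar R) : measurable_fun setT (f : mR -> \bar R) ->
  (forall x, 0 <= f x) -> \int[cmu]_t f t = \int[lebesgue_measure]_t f t.
Proof.
move=> mf f0; apply/esym.
rewrite -[RHS]mul1e.
apply: (@ge0_integral_transport _ _ (LebT R) mR R cmu lebesgue_measure id measurable_LebT_id (NngNum (@ler01 R)) f) => //.
by move=> A mA; rewrite mul1e.
Qed.

Lemma cmu_setT_gt0 : 0 < @cmu R setT.
Proof.
have m01 : measurable (`[0%R, 1%R]%classic : set (LebT R)).
  by apply: measurable_LebT_set; exact: measurable_itv.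
apply: (@lt_le_trans _ _ (@cmu R `[0%R, 1%R]%classic)).
  by rewrite cmu_lebesgue lebesgue_measure_itv/= lte_fin ltr01 oppr0 adde0 lte01.
by apply: le_measure; rewrite ?inE.
Qed.

End lebesgue.

Section kernel_estimate.
Context {R : realType} d (T : measurableType d) (nu : {measure set T -> \bar R}).
Local Open Scope ereal_scope.
Variables (tau : T -> R) (E : set T) (g : T -> R).
Hypotheses (mtau : measurable_fun setT tau)
  (nu_tau : forall f : R -> \bar R, measurable_fun setT f -> (forall x, 0 <= f x) ->
     \int[nu]_t f (tau t) = \int[lebesgue_measure]_x f x)
  (mE : measurable E) (mg : measurable_fun E g) (nu0 : 0 < nu setT).

Local Notation gam := (fun t => `|(extend0 E g t)%:E|).
Local Notation N p := (Lnorm nu p (EFin \o extend0 E g)).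

Lemma nu_tau1 (s : R) : nu (tau @^-1` [set s]) = 0.
Proof.
have m1 : measurable (tau @^-1` [set s]).
  by rewrite -[X in measurable X]setTI; apply: mtau => //; exact: measurable_set1.
transitivity (\int[nu]_t (\1_(tau @^-1` [set s]) t)%:E); first by rewrite integral_indic// setIT.
transitivity (\int[lebesgue_measure]_(x in [set: R]) (\1_[set s] x)%:E); last first.
  rewrite integral_indic ?setIT; [exact: lebesgue_measure_set1|exact: measurableT|exact: measurable_set1].
rewrite -(nu_tau (f := fun x => (\1_[set s] x)%:E))//.
by apply/measurable_EFinP; apply: measurable_indic; exact: measurable_set1.
Qed.

(** The worst set of measure [m] is an interval about [s] of half-length [a = m / 2]. Farther away
    the logarithm is at most [l = ln (b / a)]; inside, [log_pow_bound] at [y = a / |t - s|] bounds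
    the power by [L^q (1 + psi)]. The terms 1 and [psi] contribute at most [m] each, and
    [2 <= 2^q]. *)
Lemma log_integral (b r m s q : R) : (0 < r)%R -> (r < b)%R -> (0 < m)%R -> (m <= r)%R -> nu E = m%:E ->
  (1 <= q)%R ->
  \int[nu]_(t in E) ((if tau t == s then 0 else Num.max 0 (ln b - ln `|tau t - s|)) `^ q)%:E
   <= ((2 * (ln (2 * b / m) + 6 / 7 * q)) `^ q * m)%:E.
Proof.
move=> r0 rb m0 mr nuE q1.
have b0 : (0 < b)%R by lra.
pose a := (m / 2)%R; have a0 : (0 < a)%R by rewrite divr_gt0.
set l := ln (2 * b / m).
have lE : l = (ln b - ln a)%R by rewrite -ln_div ?posrE// /l; congr ln; rewrite /a; field; rewrite gt_eqF.
have l0 : (0 <= l)%R by rewrite /l ln_ge0// ler_pdivlMr// mul1r; lra.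
pose L := (l + 6 / 7 * q)%R; have L0 : (0 <= L)%R by rewrite /L; lra.
have pw t : ((if t == s then 0 else Num.max 0 (ln b - ln `|t - s|)) `^ q <= L `^ q * (1 + psi a (t - s)))%R.
  have p0 := psi_ge0 a (t - s); have Lq := powR_ge0 L q.
  case: ifPn => ts; first by rewrite powR0 ?gt_eqF//; [rewrite mulr_ge0//; lra|lra].
  have x0 : (0 < `|t - s|)%R by rewrite normr_gt0 subr_eq0.
  have [xa|ax] := leP (`|t - s|)%R a.
    have y1 : (1 <= a / `|t - s|)%R by rewrite ler_pdivlMr// mul1r.
    have hE : (ln b - ln `|t - s| = l + ln (a / `|t - s|))%R by have := ln_div a0 x0; rewrite lE; lra.
    have ly : (0 <= ln (a / `|t - s|))%R by exact: ln_ge0.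
    rewrite (max_idPr _); last by rewrite hE; lra.
    rewrite hE (le_trans (log_pow_bound q1 l0 y1))// ler_wpM2l// /psi.
    have : (Num.sqrt (a / `|t - s|) - 1 <= Num.max (Num.sqrt (a / `|t - s|) - 1) 0)%R by rewrite le_max lexx.
    lra.
  apply: (@le_trans _ _ (L `^ q * 1)%R); last by apply: ler_wpM2l => //; lra.
  rewrite mulr1; apply: ge0_ler_powR; rewrite ?nnegrE ?le_max ?lexx//; first lra.
  rewrite ge_max L0/=.
  have : (ln a <= ln `|t - s|)%R by rewrite ler_ln ?posrE// ltW.
  rewrite /L lE; lra.
have mpsi : measurable_fun setT (fun t => psi a (tau t - s)).
  apply: (measurableT_comp (measurable_psi a)); exact: measurable_funB.
apply: (@le_trans _ _ (\int[nu]_(t in E) ((L `^ q)%:E * (1 + psi a (tau t - s))%:E))).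
  by apply: ge0_le_integral_nonmeasurable => t _; rewrite -?EFinM lee_fin ?powR_ge0//; exact: pw.
have p1 t : (0 <= 1 + psi a (tau t - s))%R by have := psi_ge0 a (tau t - s); lra.
rewrite ge0_integralZl//; [|apply: measurable_funTS; apply/measurable_EFinP; exact: measurable_funD|by move=> t _; rewrite lee_fin|by rewrite lee_fin powR_ge0].
have i1 : \int[nu]_(t in E) (1 + psi a (tau t - s))%:E <= (2 * m)%:E.
  under eq_integral do rewrite EFinD.
  rewrite ge0_integralD//; last 2 first.
  - by move=> t _; rewrite lee_fin psi_ge0.
  - by apply: measurable_funTS; apply/measurable_EFinP.
  rewrite integral_cst// mul1e nuE.
  have -> : (2 * m)%:E = m%:E + m%:E by rewrite -EFinD; congr EFin; ring.
  rewrite leeD2l//; apply: (@le_trans _ _ (\int[nu]_t (psi a (tau t - s))%:E)).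
    apply: ge0_subset_integral => //; first exact/measurable_EFinP.
    by move=> t _; rewrite lee_fin psi_ge0.
  have mp : measurable_fun setT (fun x : R => (psi a (x - s))%:E).
    apply/measurable_EFinP; apply: (measurableT_comp (measurable_psi a)); exact: measurable_funB.
  rewrite (nu_tau (f := fun x : R => (psi a (x - s))%:E))//; last by move=> x; rewrite lee_fin psi_ge0.
  have -> : m%:E = (2 * a)%:E by congr EFin; rewrite /a; field.
  rewrite (@lebesgue_translation R (- s) (fun x => (psi a x)%:E)).
  - exact: integral_psi.
  - by apply/measurable_EFinP; exact: measurable_psi.
  - by move=> x; rewrite lee_fin psi_ge0.
apply: (@le_trans _ _ ((L `^ q)%:E * (2 * m)%:E)).
  by apply: lee_wpmul2l => //; rewrite lee_fin powR_ge0.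
rewrite -EFinM lee_fin mulrA ler_pM2r// powRM// mulrC ler_wpM2r ?powR_ge0//.
by apply: le1r_powR; lra.
Qed.

Lemma gamma_integral (p : \bar R) (q m : R) :
  1 < p ->
  ((p = +oo /\ q = 1%R) \/ (exists p' : R, p = p'%:E /\ (p'^-1 + q^-1 = 1)%R)) ->
  N p < +oo -> (0 <= m)%R -> nu E = m%:E ->
  \int[nu]_t gam t <= (m `^ q^-1)%:E * N p.
Proof.
move=> p1 pq Np m0 nuE.
have := @holder_extend0 R d T nu E g mE mg nu0 p q 1 m (fun=> 1%R) p1 pq Np (measurable_cst _) (fun _ => ler01) ler01 m0.
rewrite mul1r powR1 => h.
have -> : \int[nu]_t gam t = \int[nu]_t (1 * gam t) by apply: eq_integral => t _; rewrite mul1e.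
apply: h; rewrite mul1r.
by rewrite integral_cst// mul1e nuE.
Qed.

(** The factor [ln b - ln (max s r0)] must appear although it tends to 0 as [s] tends to [b]. For
    [s] near the radii of [E] it is bounded below, and Holder's inequality handles the logarithmic
    pole; for larger [s] the kernel itself is at most a multiple of it. *)
Lemma kernel_integral (p : \bar R) (b r r0 m q n s : R) :
  1 < p ->
  ((p = +oo /\ q = 1%R) \/ (exists p' : R, p = p'%:E /\ (p'^-1 + q^-1 = 1)%R)) ->
  (1 <= q)%R -> N p = n%:E -> (0 < r0)%R -> (r0 < r)%R -> (r < b)%R -> (0 < m)%R -> (m <= r)%R -> nu E = m%:E ->
  (forall t, E t -> 0 <= tau t <= r)%R -> (0 <= s)%R -> (s < b)%R ->
  \int[nu]_t (gkernel b (tau t) s * gam t) <=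
  (4 * q * (b / (b - r)) * n * m `^ q^-1 * ln (4 * b / m) * (ln b - ln (Num.max s r0)))%:E.
Proof.
move=> p1 pq q1 Nn r00 r0r rb m0 mr nuE Er s0 sb.
have b0 : (0 < b)%R by lra.
have n0 : (0 <= n)%R by rewrite -lee_fin -Nn Lnorm_ge0.
have Np : N p < +oo by rewrite Nn ltry.
have l2 := @ln2_ge R; have l4 := @ln4_ge R.
set L := ln (4 * b / m); pose l := ln (2 * b / m).
have l0 : (ln 2 <= l)%R by rewrite /l ler_ln ?posrE ?divr_gt0 ?mulr_gt0// ler_pdivlMr//; lra.
have Ll : (L = l + ln 2)%R by rewrite -lnM ?posrE ?divr_gt0 ?mulr_gt0//; congr ln; field; rewrite gt_eqF.
have L4 : (ln 4 <= L)%R by rewrite /L ler_ln ?posrE ?divr_gt0 ?mulr_gt0// ler_pdivlMr//; lra.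
have mq := powR_ge0 m q^-1.
have mx := measurable_extend0 mE mg.
have mgam : measurable_fun setT gam by apply: measurableT_comp => //; exact/measurable_EFinP.
have X0 : (0 < Num.max s r0)%R by rewrite lt_max r00 orbT.
have Xb : (Num.max s r0 < b)%R by rewrite gt_max sb; lra.
have lX : ((b - Num.max s r0) / b <= ln b - ln (Num.max s r0))%R.
  rewrite -ln_div ?posrE// (le_trans _ (ln_ge1B _)) ?divr_gt0//.
  by rewrite invf_div mulrBl divff ?gt_eqF.
set D := (ln b - ln (Num.max s r0))%R in lX *.
have w0 : (0 < b - r)%R by lra.
have nm : (0 <= n * m `^ q^-1)%R by exact: mulr_ge0.
have [sc|sc] := leP s (r + 2 / 5 * (b - r))%R.
  pose h t : R := if tau t == s then 0%R else Num.max 0%R (ln b - ln `|tau t - s|)%R.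
  have mh : measurable_fun setT h.
    apply: measurable_fun_ifT => //; first exact: measurable_fun_eqr.
    apply: measurable_maxr => //; apply: measurable_funB => //.
    apply: (measurableT_comp (@measurable_ln R)); apply: measurableT_comp; first exact: normr_measurable.
    exact: measurable_funB.
  have h0 t : (0 <= h t)%R by rewrite /h; case: ifP => // _; rewrite le_max lexx.
  pose A := (2 * (l + 6 / 7 * q))%R.
  have A0 : (0 <= A)%R by rewrite /A; lra.
  have hol := holder_extend0 mE mg nu0 p1 pq Np mh h0 A0 (ltW m0) (log_integral s (lt_trans r00 r0r) rb m0 mr nuE q1).
  apply: (@le_trans _ _ (\int[nu]_t ((h t)%:E * gam t))).
    apply: ae_ge0_le_integral => //.
    - by move=> t _; rewrite mule_ge0// gkernel_ge0.
    - apply: emeasurable_funM => //.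
      have m1 : measurable_fun setT (fun t => (tau t, s)) by exact: measurable_fun_pair.
      exact: (measurableT_comp (measurable_gkernel b) m1).
    - by move=> t _; rewrite mule_ge0// lee_fin.
    - by apply: emeasurable_funM => //; exact/measurable_EFinP.
    (* Where [tau t = s] the kernel is +oo but [h] is 0, so the comparison holds only off this null
       set. *)
    exists (tau @^-1` [set s]); split => //.
    + by rewrite -[X in measurable X]setTI; apply: mtau => //; exact: measurable_set1.
    + exact: nu_tau1.
    + move=> t /= /not_implyP[_ ht]; apply: contrapT => ts; apply: ht.
      have [Et|Et] := pselect (E t); last first.
        have -> : extend0 E g t = 0%R by rewrite /extend0 memNset.
    by rewrite ?normr0 ?abse0 !mule0.
      apply: lee_wpmul2r => //; rewrite /gkernel /h sb.
      have -> : (tau t == s) = false by apply/eqP => e; apply: ts.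
      have /andP[t0 tr] := Er t Et.
      have x0 : (0 < `|tau t - s|)%R by rewrite normr_gt0 subr_eq0; apply/eqP.
      rewrite maxC -EFin_max lee_fin ge_max le_max lexx/= le_max; apply/orP; right.
      by rewrite lerD2r lerBlDr; exact: kernel_near t0 tr rb s0 sb.
  apply: (le_trans hol); rewrite Nn -EFinM lee_fin.
  have D6 : (3 / 5 <= b / (b - r) * D)%R.
    apply: (@le_trans _ _ (b / (b - r) * ((b - Num.max s r0) / b))%R).
      apply: (kernel_near_ratio (lt_trans r00 r0r) rb); rewrite ge_max sc/=.
      by apply: le_trans (ltW r0r) _; rewrite lerDl mulr_ge0// ltW.
    by apply: ler_wpM2l => //; rewrite divr_ge0// ltW.
  rewrite (_ : 4 * q * (b / (b - r)) * n * m `^ q^-1 * L * D = (4 * (q * L) * (b / (b - r) * D)) * (n * m `^ q^-1))%R; last by ring.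
  rewrite -[leLHS]mulrA [(m `^ q^-1 * n)%R]mulrC; apply: ler_wpM2r => //.
  exact: kernel_near_const.
have sr0 : Num.max s r0 = s by apply/max_idPl; lra.
rewrite /D sr0 in lX *; clear D; pose D := (ln b - ln s)%R; rewrite -/D in lX *.
have sp : (0 < s)%R by lra.
pose c := (5 * (b / (b - r)) * D)%R.
have D0 : (0 <= D)%R by apply: le_trans lX; rewrite divr_ge0 ?ltW// subr_gt0.
have bw0 : (0 <= b / (b - r))%R by rewrite divr_ge0// ltW.
have c0 : (0 <= c)%R by apply: mulr_ge0 => //; exact: mulr_ge0.
apply: (@le_trans _ _ (\int[nu]_t (c%:E * gam t))).
  apply: ge0_le_integral_nonmeasurable => t _; first by rewrite mule_ge0// gkernel_ge0.
  have [Et|Et] := pselect (E t); last first.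
    have -> : extend0 E g t = 0%R by rewrite /extend0 memNset.
    by rewrite ?normr0 ?abse0 !mule0.
  apply: lee_wpmul2r => //; rewrite /gkernel sb.
  have /andP[t0 tr] := Er t Et.
  have st0 : (0 < s - tau t)%R by lra.
  have -> : (tau t == s) = false by apply/eqP; lra.
  rewrite ge_max !lee_fin c0 andbT distrC gtr0_norm//.
  have ts1 : (tau t * s <= r * b)%R by apply: ler_pM => //; exact: ltW.
  have ts2 : (r * b < b * b)%R by rewrite ltr_pM2r.
  have n1 : (0 < b ^+ 2 - tau t * s)%R by rewrite expr2; lra.
  have -> : (ln (b ^+ 2 - tau t * s) - ln b - ln (s - tau t) = ln ((b ^+ 2 - tau t * s) / (b * (s - tau t))))%R.
    by rewrite ln_div ?posrE ?mulr_gt0// lnM ?posrE//; ring.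
  apply: (le_trans (ln_leB1 _)); first by rewrite divr_gt0 ?mulr_gt0.
  apply: (@le_trans _ _ (5 * (b / (b - r)) * ((b - s) / b))%R); last first.
    by apply: ler_wpM2l => //; exact: mulr_ge0.
  by apply: kernel_far_ratio => //; exact: ltW.
rewrite ge0_integralZl//.
apply: (@le_trans _ _ (c%:E * ((m `^ q^-1)%:E * N p))).
  by apply: lee_wpmul2l; [rewrite lee_fin|exact: gamma_integral (ltW m0) nuE].
rewrite Nn -!EFinM lee_fin (mulrC _ n).
rewrite (_ : 4 * q * (b / (b - r)) * n * m `^ q^-1 * L * D = (4 * (q * L) * (b / (b - r) * D)) * (n * m `^ q^-1))%R; last by ring.
apply: ler_wpM2r => //; rewrite /c -mulrA; apply: ler_wpM2r.
  exact: mulr_ge0.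
have : (L <= q * L)%R by rewrite ler_peMl//; lra.
lra.
Qed.

End kernel_estimate.

(** * Subharmonic functions and their truncations *)

Section subharmonic_class.
Local Open Scope ereal_scope.
Context {R : realType}.
Implicit Types (z w y : R * R) (u v V : R * R -> \bar R).

(** The circle means of the statement integrate functions that may be -oo. Subtracting from an upper
    bound [B] gives nonnegative integrands, for which monotonicity and Fatou's lemma are
    available. *)
Lemma circle_mean_bounded (F : R -> \bar R) (B : R) : (0 <= B)%R -> measurable_fun setT F ->
  (forall x, F x <= B%:E) ->
  ((2 * pi)^-1)%:E * \int[lebesgue_measure]_(x in @circ_dom R) F x = B%:E - \int[circ_prob]_x (B%:E - F x).
Proof.
move=> B0 mF FB.
have mFp : measurable_fun setT F^\+ by exact: measurable_funepos.
have mFn : measurable_fun setT F^\- by exact: measurable_funeneg.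
have Gp x : 0 <= B%:E - F x by rewrite subre_ge0.
have mG : measurable_fun setT (fun x => B%:E - F x) by exact: emeasurable_funB.
have pw x : (B%:E - F x) + F^\+ x = B%:E + F^\- x.
  rewrite funeposE funenegE; have := FB x; case: (F x) => [a||]//= _; last first.
    by rewrite maxNye maxye adde0.
  rewrite -!EFin_max -!EFinD; congr EFin.
  by case: (leP a 0%R) => a0; case: (leP (- a) 0)%R => a1; lra.
have e1 : \int[circ_prob]_x (B%:E - F x) + \int[circ_prob]_x F^\+ x = B%:E + \int[circ_prob]_x F^\- x.
  have BE : B%:E = \int[@circ_prob R]_x B%:E by rewrite integral_cst//= circ_prob_setT mule1.
  rewrite [in RHS]BE -!ge0_integralD//.
  by apply: eq_integral => x _.
have pfin : \int[circ_prob]_x F^\+ x \is a fin_num.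
  rewrite ge0_fin_numE; last exact: integral_ge0.
  apply: (@le_lt_trans _ _ (\int[@circ_prob R]_x B%:E)); last first.
    by rewrite integral_cst//= circ_prob_setT mule1 ltry.
  apply: ge0_le_integral_nonmeasurable => x _ //.
  by rewrite funeposE ge_max FB.
have c0 : (0 <= (2 * pi)^-1 :> R)%R by rewrite invr_ge0 ltW// two_pi_gt0.
have sub (p q n : \bar R) : p \is a fin_num -> 0 <= q -> 0 <= n -> q + p = B%:E + n -> p - n = B%:E - q.
  case: p q n => [p||] [q||] [n||]//= _ _ _.
  by rewrite -!EFinD => -[h]; congr EFin; lra.
rewrite integralE muleBr ?c0//; last first.
  rewrite fin_num_adde_defr//.
  have := pfin; rewrite circ_probE//; case: integral => //=.
  - by rewrite gt0_muley// lte_fin invr_gt0 two_pi_gt0.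
  - by rewrite gt0_muleNy// lte_fin invr_gt0 two_pi_gt0.
rewrite -!circ_probE//; apply: sub => //; exact: integral_ge0.
Qed.

(* [subharmonic] without the requirement that the function is not [-oo]. *)
Definition subh v : Prop :=
  [/\ forall z, v z != +oo, usc v &
    forall z, exists2 rho : R, (0 < rho)%R & forall s : R, (0 < s < rho)%R ->
      v z <= ((2 * pi)^-1)%:E * \int[lebesgue_measure]_(x in @circ_dom R) v (cpt z s x)].

Lemma subharmonic_subh v : subharmonic v -> subh v.
Proof. by case=> v1 _ v3 v4; split. Qed.

Definition tr (n : nat) v z : R := fine (maxe (v z) (- n%:R)%:E).

Lemma trE n v z : v z != +oo -> (tr n v z)%:E = maxe (v z) (- n%:R)%:E.
Proof. by rewrite /tr; case: (v z) => [a||]//= _; rewrite ?maxNye// -EFin_max. Qed.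

Lemma measurable_subh v : subh v -> measurable_fun setT v.
Proof. by case=> _ uv _; exact: usc_measurable. Qed.

Lemma subh_bounded v (X : R) z : subh v ->
  exists2 B : R, (0 <= B)%R & forall w, (nrm (w - z)%R <= X)%R -> v w <= B%:E.
Proof.
case=> vf uv _; have [B hB] := usc_bounded z X uv vf.
exists `|B|%R => // w /hB h; apply: (le_trans h); rewrite lee_fin; exact: ler_norm.
Qed.

Lemma subh_mean v z (s B : R) : subh v -> (0 <= B)%R -> (forall x, v (cpt z s x) <= B%:E) ->
  ((2 * pi)^-1)%:E * \int[lebesgue_measure]_(x in @circ_dom R) v (cpt z s x) =
  B%:E - \int[circ_prob]_x (B%:E - v (cpt z s x)).
Proof.
move=> sv B0 vB; apply: circle_mean_bounded => //.
by apply: measurable_circle; exact: measurable_subh.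
Qed.

Lemma le_leB_mean (F G : R -> \bar R) (B : R) : (forall x, F x <= G x) -> (forall x, G x <= B%:E) ->
  B%:E - \int[circ_prob]_x (B%:E - F x) <= B%:E - \int[circ_prob]_x (B%:E - G x).
Proof.
move=> FG GB; apply: leeB => //; apply: ge0_le_integral_nonmeasurable => x _.
  by rewrite subre_ge0.
exact: leeB.
Qed.

Lemma subh_max u v : subh u -> subh v -> subh (fun z => maxe (u z) (v z)).
Proof.
move=> su sv; have [u1 u2 u3] := su; have [v1 v2 v3] := sv.
have mx : measurable_fun setT (fun z => maxe (u z) (v z)).
  by apply: measurable_maxe; exact: measurable_subh.
split.
- by move=> z; have := u1 z; have := v1 z; case: (u z) => [a||]; case: (v z) => [b||]//= _ _; rewrite ?maxNye ?maxeNy// -EFin_max.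
- move=> z c; rewrite gt_max => /andP[uc vc].
  by near=> w; rewrite gt_max; apply/andP; split; near: w; [exact: u2|exact: v2].
move=> z; have [r1 r10 h1] := u3 z; have [r2 r20 h2] := v3 z.
have [B1 B10 b1] := subh_bounded 1 z su; have [B2 B20 b2] := subh_bounded 1 z sv.
exists (Num.min 1 (Num.min r1 r2))%R; first by rewrite !lt_min r10 r20 ltr01.
move=> s /andP[s0]; rewrite !lt_min => /and3P[s1 s2 s3].
pose B := (B1 + B2)%R; have B0 : (0 <= B)%R by exact: addr_ge0.
have cin x : (nrm (cpt z s x - z)%R <= 1)%R by rewrite nrm_cptB gtr0_norm// ltW.
have uB x : u (cpt z s x) <= B%:E by rewrite (le_trans (b1 _ (cin x)))// lee_fin lerDl.
have vB x : v (cpt z s x) <= B%:E by rewrite (le_trans (b2 _ (cin x)))// lee_fin lerDr.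
have mB x : maxe (u (cpt z s x)) (v (cpt z s x)) <= B%:E by rewrite ge_max uB vB.
rewrite (@circle_mean_bounded (fun x => maxe (u (cpt z s x)) (v (cpt z s x))) B)//; last first.
  exact: (measurable_circle s z mx).
rewrite ge_max; apply/andP; split.
  apply: le_trans (h1 s _) _; first by rewrite s0 s2.
  by rewrite (subh_mean su B0 uB); apply: le_leB_mean => // x; rewrite le_max lexx.
apply: le_trans (h2 s _) _; first by rewrite s0 s3.
by rewrite (subh_mean sv B0 vB); apply: le_leB_mean => // x; rewrite le_max lexx orbT.
Unshelve. all: by end_near. Qed.

Lemma subh_cst (c : R) : subh (fun=> c%:E).
Proof.
split => //.
  by move=> z a ca; near=> w.
move=> z; exists 1%R => // s _.
rewrite (@circle_mean_bounded (fun=> c%:E) `|c|%R)//; last by move=> x; rewrite lee_fin ler_norm.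
rewrite integral_cst//= circ_prob_setT mule1 -!EFinB lee_fin; lra.
Unshelve. all: by end_near. Qed.

Lemma tr_loc_bounded n v : subh v -> loc_bounded (tr n v).
Proof.
move=> sv X; have [B B0 hB] := subh_bounded X 0%R sv; have [v1 _ _] := sv.
exists (B + n%:R)%R => w wX; have := hB w; rewrite subr0 => /(_ wX) vB.
rewrite ler_norml -!lee_fin trE//; apply/andP; split.
  by rewrite le_max; apply/orP; right; rewrite lee_fin; lra.
by rewrite ge_max (le_trans vB) ?lee_fin ?lerDl//=; have := ler0n R n; lra.
Qed.

(** A maximum with a constant keeps the submean inequality and makes the function locally bounded,
    so that [rsub_submean] applies to it on circles of every radius. *)
Lemma tr_rsub n v : subh v -> rsub (tr n v).
Proof.
move=> sv; have [v1 v2 v3] := sv; split; last 2 first.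
- exact: tr_loc_bounded.
- move=> z; have [r1 r10 h1] := v3 z; exists (Num.min 1 r1)%R; first by rewrite lt_min r10 ltr01.
  move=> s /andP[s0]; rewrite lt_min => /andP[s1 s2].
  have [B B0 hB] := subh_bounded 1 z sv.
  have cin x : (nrm (cpt z s x - z)%R <= 1)%R by rewrite nrm_cptB gtr0_norm// ltW.
  have vB x : v (cpt z s x) <= B%:E by exact: hB.
  have mt : measurable_fun setT (tr n v).
    apply/measurable_EFinP; rewrite (_ : EFin \o _ = (fun z => maxe (v z) (- n%:R)%:E)); last first.
      by apply/funext => w; exact: trE.
    by apply: measurable_maxe => //; exact: measurable_subh.
  have bt := bmf_cpt z s mt (tr_loc_bounded n sv).
  have ntr x : (- n%:R <= tr n v (cpt z s x))%R by rewrite -lee_fin trE// le_max lexx orbT.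
  have c1 : (- n%:R <= cav (tr n v) z s)%R.
    by rewrite -(avg_cst (- n%:R)); apply: le_avg => //; exact: bmf_cst.
  rewrite -lee_fin trE// ge_max lee_fin c1 andbT.
  apply: le_trans (h1 s _) _; first by rewrite s0 s2.
  rewrite (subh_mean sv B0 vB).
  apply: (@le_trans _ _ (B%:E - \int[circ_prob]_x (B%:E - (tr n v (cpt z s x))%:E))).
    apply: leeB => //; apply: ge0_le_integral_nonmeasurable => x _.
      by rewrite subre_ge0// trE// ge_max vB lee_fin; have := ler0n R n; lra.
    by apply: leeB => //; rewrite trE// le_max lexx.
  under eq_integral do rewrite -EFinB.
  rewrite avgE; last by apply: bmfB => //; exact: bmf_cst.
  rewrite avgB// ?avg_cst; last exact: bmf_cst.
  by rewrite -EFinB lee_fin /cav; lra.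
move=> z c; rewrite /= trE// gt_max => /andP[vc nc].
by near=> w; rewrite /= trE// gt_max nc andbT; near: w; exact: v2.
Unshelve. all: by end_near. Qed.

End subharmonic_class.

Section truncation.
Local Open Scope ereal_scope.
Context {R : realType}.
Implicit Types (z w y : R * R) (u v V : R * R -> \bar R).

(** Adding [n] makes the truncation nonnegative and the cut-off makes it bounded on the whole plane.
    The margin 1 leaves room for smoothing circles of radius [d < 1] about points of the disc of
    radius [b]. *)
Definition cutf (b : R) (n : nat) v z : R := if (nrm z <= b + 1)%R then (tr n v z + n%:R)%R else 0%R.

Lemma tr_ge n v z : subh v -> (- n%:R <= tr n v z)%R.
Proof. by case=> v1 _ _; rewrite -lee_fin trE// le_max lexx orbT. Qed.

Lemma cutf_ge0 b n v z : subh v -> (0 <= cutf b n v z)%R.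
Proof. by move=> sv; rewrite /cutf; case: ifP => // _; have := tr_ge n z sv; lra. Qed.

Lemma measurable_tr n v : subh v -> measurable_fun setT (tr n v).
Proof. by move=> sv; have [ut _ _] := tr_rsub n sv; apply/measurable_EFinP; exact: usc_measurable. Qed.

Lemma measurable_cutf b n v : subh v -> measurable_fun setT (cutf b n v).
Proof.
move=> sv; apply: measurable_fun_if => //=.
  by apply: measurable_fun_ler => //; exact: measurable_nrm.
by apply: measurable_funTS; apply: measurable_funD => //; exact: measurable_tr.
Qed.

Lemma nnm_cutf b n v : subh v -> nnm (fun z => (cutf b n v z)%:E).
Proof.
move=> sv; split; first by apply/measurable_EFinP; exact: measurable_cutf.
by move=> z; rewrite lee_fin cutf_ge0.
Qed.

Lemma le_cutf b n v (c : R) z : subh v -> (0 <= c + n%:R)%R -> v z <= c%:E -> (cutf b n v z <= c + n%:R)%R.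
Proof.
move=> sv c0 vc; have [v1 _ _] := sv; rewrite /cutf; case: ifP => // _.
by rewrite lerD2r -lee_fin trE// ge_max vc lee_fin; lra.
Qed.

Lemma cutf_ge b n v (c : R) z : subh v -> (nrm z <= b + 1)%R -> c%:E <= v z -> (c + n%:R <= cutf b n v z)%R.
Proof.
move=> sv zb vc; have [v1 _ _] := sv; rewrite /cutf zb lerD2r -lee_fin trE// le_max vc//.
Qed.

Lemma cutf_mono b n u v z : subh u -> subh v -> u z <= v z -> (cutf b n u z <= cutf b n v z)%R.
Proof.
move=> [u1 _ _] [v1 _ _] uv; rewrite /cutf; case: ifP => // _.
by rewrite lerD2r -lee_fin !trE// ge_max !le_max uv lexx orbT.
Qed.

Lemma cutf_submean b n v z s : subh v -> (0 <= s)%R -> (nrm z + s <= b + 1)%R ->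
  (cutf b n v z)%:E <= eav (fun y => (cutf b n v y)%:E) s z.
Proof.
move=> sv; rewrite le_eqVlt => /orP[/eqP <- _|s0 zs].
  rewrite -[leLHS](@eav_cst R _ 0%R z); last by rewrite lee_fin cutf_ge0.
  by apply: le_eav => [y|x]; rewrite ?lee_fin ?cutf_ge0// /cpt !mul0r !addr0 -surjective_pairing.
have zb : (nrm z <= b + 1)%R by lra.
have -> : eav (fun y => (cutf b n v y)%:E) s z = \int[circ_prob]_x (tr n v (cpt z s x) + n%:R)%:E.
  apply: eq_integral => x _; congr EFin; rewrite /cutf ifT//.
  by rewrite (le_trans (nrm_cpt_le _ _ _))// gtr0_norm.
have bt := bmf_cpt z s (measurable_tr n sv) (tr_loc_bounded n sv).
rewrite avgE; last by apply: bmfD => //; exact: bmf_cst.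
rewrite avgD//; last exact: bmf_cst.
rewrite avg_cst /cutf zb lee_fin lerD2r; apply: (@rsub_submean R (tr n v)) => //; exact: tr_rsub.
Qed.

Lemma ell_mass (d : R) : (0 < d)%R -> exists2 m : R, (0 < m)%R & \int[plane]_y ell d y = m%:E.
Proof.
move=> d0; have := @ell_integral_fin R d d0; have := @ell_integral_gt0 R d d0.
by case: (\int[plane]_y ell d y) => [m||]//=; rewrite lte_fin => m0 _; exists m.
Qed.

Lemma shift_integral (F : R * R -> \bar R) z d : nnm F ->
  \int[plane]_y (F y * ell d (y - z)%R) = \int[plane]_w (eav F (nrm w) z * ell d w).
Proof.
move=> nF; have nl := @nnm_ell R d.
rewrite -(radial_average z nF nl (fun t y => ell_rot d t y)).
have nK := nnmM nF (nnmB z nl); rewrite -(@plane_translation R z _ nK.1 nK.2).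
apply: eq_integral => -[a1 a2] _; rewrite (_ : (_ - z = (a1, a2))%R); last first.
  by case: z {nK} => z1 z2; congr (_, _) => /=; ring.
by congr (F _ * _); case: z {nK} => z1 z2; congr (_, _) => /=; ring.
Qed.

Lemma ell_weight_le (H : R * R -> \bar R) (d c m : R) : (0 < d)%R -> (0 <= c)%R -> nnm H ->
  \int[plane]_y ell d y = m%:E -> (forall w, (nrm w < d)%R -> H w <= c%:E) ->
  \int[plane]_w (H w * ell d w) <= (c * m)%:E.
Proof.
move=> d0 c0 nH dm Hc; have [mH H0] := nH.
apply: (@le_trans _ _ (\int[plane]_w (c%:E * ell d w))).
  apply: ge0_le_integral_nonmeasurable => w _; first by rewrite mule_ge0// ell_ge0.
  have [wd|wd] := ltP (nrm w) d; first by apply: lee_wpmul2r; [exact: ell_ge0|exact: Hc].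
  by rewrite (ell_out d0 wd) !mule0.
rewrite (ge0_integralZl plane measurableT (nnm_ell d).1 (fun y _ => ell_ge0 d y)) ?lee_fin//.
by rewrite dm EFinM.
Qed.

Lemma ell_weight_ge (H : R * R -> \bar R) (d c m : R) : (0 < d)%R -> (0 <= c)%R -> nnm H ->
  \int[plane]_y ell d y = m%:E -> (forall w, (nrm w < d)%R -> c%:E <= H w) ->
  (c * m)%:E <= \int[plane]_w (H w * ell d w).
Proof.
move=> d0 c0 nH dm Hc; have [mH H0] := nH.
rewrite EFinM -dm -(ge0_integralZl plane measurableT (nnm_ell d).1 (fun y _ => ell_ge0 d y)) ?lee_fin//.
apply: ge0_le_integral_nonmeasurable => w _; first by rewrite mule_ge0 ?lee_fin// ell_ge0.
have [wd|wd] := ltP (nrm w) d; first by apply: lee_wpmul2r; [exact: ell_ge0|exact: Hc].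
by rewrite (ell_out d0 wd) !mule0.
Qed.

Lemma measurable_radial_eav (F : R * R -> \bar R) z : nnm F -> nnm (fun w => eav F (nrm w) z).
Proof.
move=> [mF F0]; split; last by move=> w; exact: eav_ge0.
have m1 : measurable_fun setT (fun u : (R * R) * R => cpt z (nrm u.1) u.2).
  have mn : measurable_fun setT (fun u : (measurableTypeR R * measurableTypeR R) * measurableTypeR R => nrm u.1).
    exact: (measurableT_comp (@measurable_nrm R) measurable_fst).
  have mc : measurable_fun setT (fun u : (measurableTypeR R * measurableTypeR R) * measurableTypeR R => cos u.2).
    by apply: (measurableT_comp (@measurable_cos R)).
  have ms : measurable_fun setT (fun u : (measurableTypeR R * measurableTypeR R) * measurableTypeR R => sin u.2).
    by apply: (measurableT_comp (@measurable_sin R)).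
  by apply: measurable_fun_pair; apply: measurable_funD => //; exact: measurable_funM.
rewrite /eav.
pose K (u : (measurableTypeR R * measurableTypeR R) * measurableTypeR R) := F (cpt z (nrm u.1) u.2).
apply: (@measurable_fun_fubini_tonelli_F _ _ _ _ R circ_prob K) => [|u]; last exact: F0.
exact: (measurableT_comp mF m1).
Qed.

Lemma smoothed_ge b n v z (d m : R) : subh v -> (nrm z <= b)%R -> (0 < d)%R -> (d < 1)%R ->
  \int[plane]_y ell d y = m%:E ->
  (cutf b n v z * m)%:E <= \int[plane]_y ((cutf b n v y)%:E * ell d (y - z)%R).
Proof.
move=> sv zb d0 d1 dm; have nF := nnm_cutf b n sv.
rewrite (shift_integral z d nF); apply: ell_weight_ge => //; first exact: cutf_ge0.
  exact: measurable_radial_eav.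
by move=> w wd; apply: cutf_submean => //; [exact: nrm_ge0|lra].
Qed.

(** Upper semicontinuity bounds [v] by [c] within [eta] of [z], and [n0] makes [c + n] nonnegative.
    Together with [smoothed_ge], where the submean inequality gives the lower bound, this lets
    [ell d] act as an approximate identity of mass [m]. *)
Lemma smoothed_le v z (c : R) : subh v -> v z < c%:E ->
  exists (n0 : nat) (eta : R), (0 < eta)%R /\ forall b n d m, (n0 <= n)%N -> (0 < d)%R -> (d < eta)%R ->
  \int[plane]_y ell d y = m%:E ->
  \int[plane]_y ((cutf b n v y)%:E * ell d (y - z)%R) <= ((c + n%:R) * m)%:E.
Proof.
move=> sv vc; have [v1 v2 _] := sv.
have /near_nrmP[eta eta0 he] := v2 _ _ vc.
exists (Num.truncn `|c|).+1, eta; split => // b n d m n0 d0 de dm.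
have c0 : (0 <= c + n%:R)%R.
  have : (`|c| <= n%:R)%R by rewrite (le_trans (ltW (truncnS_gt _)))// ler_nat.
  by have := ler_norm (- c)%R; rewrite normrN; lra.
have nF := nnm_cutf b n sv.
rewrite (shift_integral z d nF); apply: ell_weight_le => //; first exact: measurable_radial_eav.
move=> w wd; rewrite -[leRHS](@eav_cst R _ (nrm w) z) ?lee_fin//.
apply: le_eav => [y|x]; rewrite lee_fin; first exact: cutf_ge0.
apply: le_cutf => //; apply/ltW/he; rewrite nrm_cptB ger0_norm ?nrm_ge0//; exact: lt_trans de.
Qed.

Lemma ell_massZ (c : \bar R) (d m : R) : 0 <= c -> \int[plane]_y ell d y = m%:E ->
  c * m%:E = \int[plane]_y (c * ell d y).
Proof.
move=> c0 <-; have nl := @nnm_ell R d.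
by rewrite (ge0_integralZl plane measurableT nl.1 (fun y _ => nl.2 y) c0).
Qed.

(** Once [M_s] has been moved onto the truncation, [ell d] averages over small circles about 0.
    Means of different radii commute, so the submean inequality can be used under [M_s]. *)
Lemma smoothed_mean_ge b n v (s d m : R) : subh v -> (0 <= s)%R -> (s <= b)%R -> (0 < d)%R -> (d < 1)%R ->
  \int[plane]_y ell d y = m%:E ->
  eav (fun y => (cutf b n v y)%:E) s 0%R * m%:E <= \int[plane]_y ((cutf b n v y)%:E * eav (ell d) s y).
Proof.
move=> sv s0 sb d0 d1 dm; have nF := nnm_cutf b n sv; have nl := @nnm_ell R d.
have nH := nnm_eav s nF.
rewrite (eav_adjoint s nF nl).
have -> : \int[plane]_y (eav (fun z => (cutf b n v z)%:E) s y * ell d y) =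
  \int[plane]_y (eav (eav (fun z => (cutf b n v z)%:E) s) (nrm y) 0%R * ell d y).
  rewrite -(shift_integral _ _ nH); apply: eq_integral => y _.
  by rewrite subr0.
rewrite (ell_massZ (nH.2 _) dm).
apply: ge0_le_integral_nonmeasurable => w _; first by rewrite mule_ge0 ?nH.2// ell_ge0.
have [wd|wd] := ltP (nrm w) d; last by rewrite (ell_out d0 wd) !mule0.
apply: lee_wpmul2r; first exact: ell_ge0.
rewrite eav_comm//; apply: le_eav => [y|x]; first by rewrite lee_fin cutf_ge0.
apply: cutf_submean => //; first exact: nrm_ge0.
by have := nrm_cpt_le 0%R s x; rewrite nrm0 (ger0_norm s0); lra.
Qed.

Definition cmean v (s : R) : \bar R :=
  ((2 * pi)^-1)%:E * \int[lebesgue_measure]_(x in @circ_dom R) v (cpt 0%R s x).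

(** Upper semicontinuity gives no uniform control along a circle. So [V] is replaced by a Lipschitz
    majorant whose mean at radius [s] is still below [c]; the means of the majorant depend
    continuously on the centre. *)
Lemma smoothed_mean_le V b (s c : R) : subh V -> (0 < s)%R -> (s <= b)%R -> cmean V s < c%:E ->
  exists (n0 : nat) (eta : R), (0 < eta)%R /\ forall n d m, (n0 <= n)%N -> (0 < d)%R -> (d < eta)%R ->
  \int[plane]_y ell d y = m%:E ->
  \int[plane]_y ((cutf b n V y)%:E * eav (ell d) s y) <= ((c + n%:R) * m)%:E.
Proof.
move=> sV s0 sb cm; have [V1 V2 _] := sV.
have [B B0 hB] := subh_bounded (b + 1) 0%R sV.
have sX : (`|s| <= b + 1)%R by rewrite gtr0_norm//; lra.
have cB x : V (cpt 0%R s x) <= B%:E by apply: hB; rewrite nrm_cptB.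
have cint : (B - c)%:E < \int[circ_prob]_x (B%:E - V (cpt 0%R s x)).
  move: cm; rewrite /cmean (subh_mean sV B0 cB).
  have : 0 <= \int[circ_prob]_x (B%:E - V (cpt 0%R s x)).
    by apply: integral_ge0 => x _; rewrite subre_ge0.
  case: integral => [I||]//= _; last by rewrite ltry.
  by rewrite -EFinB !lte_fin; lra.
have [L [phi [L0 lphi phiB Vphi cphi]]] := usc_majorant V2 sX B0 hB cint.
have mphi := lipschitz_measurable L0 lphi.
have lbphi := lipschitz_loc_bounded L0 lphi.
have bphi z := bmf_cpt z s mphi lbphi.
have {cphi} : (cav phi 0%R s < c)%R.
  move: cphi; under eq_integral do rewrite -EFinB.
  rewrite avgE; last by apply: bmfB => //; exact: bmf_cst.
  rewrite avgB ?avg_cst//; last exact: bmf_cst.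
  by rewrite lte_fin -/(cav phi 0%R s); lra.
set A := cav phi 0%R s => Ac.
have [M hM] := lbphi (b + 1)%R.
have L1 : (0 < L + 1)%R by rewrite ltr_wpDl.
exists (Num.truncn (`|M| + `|c|)).+1, (Num.min 1 ((c - A) / (L + 1)))%R; split.
  by rewrite lt_min ltr01 divr_gt0// subr_gt0.
move=> n d m n0 d0; rewrite lt_min => /andP[d1 d2] dm.
have nM : (`|M| + `|c| <= n%:R)%R by rewrite (le_trans (ltW (truncnS_gt _)))// ler_nat.
have aM := ler_norm M; have ac := ler_norm (- c)%R; rewrite normrN in ac.
have M0 := normr_ge0 M; have c0 := normr_ge0 c.
have nF := nnm_cutf b n sV; have nl := @nnm_ell R d.
rewrite (eav_adjoint s nF nl); apply: ell_weight_le => //; first lra.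
  exact: nnm_eav.
move=> w wd.
apply: (@le_trans _ _ (\int[circ_prob]_x (phi (cpt w s x) + n%:R)%:E)).
  apply: ge0_le_integral_nonmeasurable => x _; first by rewrite lee_fin cutf_ge0.
  have wb : (nrm (cpt w s x) <= b + 1)%R by have := nrm_cpt_le w s x; rewrite (gtr0_norm s0); lra.
  rewrite lee_fin; apply: le_cutf => //.
    by have := hM _ wb; rewrite ler_norml => /andP[]; lra.
  by apply: Vphi; rewrite subr0.
rewrite avgE; last by apply: bmfD => //; exact: bmf_cst.
rewrite avgD ?avg_cst//; last exact: bmf_cst.
rewrite lee_fin lerD2r.
have : (cav phi w s - A <= L * nrm w)%R.
  apply: le_trans (ler_norm _) _; apply: avg_dist => // x.
  apply: (le_trans (lphi _ _)); rewrite (_ : cpt w s x - cpt 0 s x = w)%R//.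
  by case: w wd => w1 w2 wd; rewrite /cpt; congr (_, _) => /=; ring.
have : (L * nrm w <= L * d)%R by apply: ler_wpM2l => //; exact: ltW.
by move: d2; rewrite ltr_pdivlMr// mulrDr mulr1 (mulrC d) -/(cav phi w s); lra.
Qed.

End truncation.

Section circle_means.
Local Open Scope ereal_scope.
Context {R : realType}.
Implicit Types (z w y : R * R) (u v V : R * R -> \bar R).

Lemma eav_cutf b n v z s : subh v -> (0 < s)%R -> (nrm z + s <= b + 1)%R ->
  eav (fun y => (cutf b n v y)%:E) s z = (cav (tr n v) z s + n%:R)%:E.
Proof.
move=> sv s0 zs.
have -> : eav (fun y => (cutf b n v y)%:E) s z = \int[circ_prob]_x (tr n v (cpt z s x) + n%:R)%:E.
  apply: eq_integral => x _; congr EFin; rewrite /cutf ifT//.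
  by rewrite (le_trans (nrm_cpt_le _ _ _))// gtr0_norm.
have bt := bmf_cpt z s (measurable_tr n sv) (tr_loc_bounded n sv).
rewrite avgE; last by apply: bmfD => //; exact: bmf_cst.
by rewrite avgD ?avg_cst//; exact: bmf_cst.
Qed.

Lemma cmean_le_tr v n s : subh v -> (0 < s)%R -> cmean v s <= (cav (tr n v) 0%R s)%:E.
Proof.
move=> sv s0; have [v1 _ _] := sv; have [B B0 hB] := subh_bounded s 0%R sv.
have vB x : v (cpt 0%R s x) <= B%:E by apply: hB; rewrite nrm_cptB gtr0_norm.
rewrite /cmean (subh_mean sv B0 vB).
apply: (@le_trans _ _ (B%:E - \int[circ_prob]_x (B%:E - (tr n v (cpt 0%R s x))%:E))).
  apply: le_leB_mean => x; rewrite trE//; first by rewrite le_max lexx.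
  by rewrite ge_max vB lee_fin; have := ler0n R n; lra.
have bt := bmf_cpt 0%R s (measurable_tr n sv) (tr_loc_bounded n sv).
under eq_integral do rewrite -EFinB.
rewrite avgE; last by apply: bmfB => //; exact: bmf_cst.
rewrite avgB// ?avg_cst; last exact: bmf_cst.
by rewrite -EFinB lee_fin /cav; lra.
Qed.

Lemma cutf_data b r r0 n d B v V : (0 <= r)%R -> (r < b)%R -> (0 < r0)%R -> (r0 < b)%R ->
  (0 < d)%R -> (d <= (b - r) / 8)%R -> (d < 1)%R -> subh v -> subh V -> (forall z, v z <= V z) ->
  (0 <= B)%R -> (forall z, (nrm z <= b + 1)%R -> V z <= B%:E) ->
  smoothing_data b r r0 d (B + n%:R) (cutf b n v) (cutf b n V).
Proof.
move=> r_0 rb r00 r0b d0 db d1 sv sV vV B0 VB; split.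
- by split => //; rewrite d0.
- by split; exact: measurable_cutf.
- move=> z; split; [exact: cutf_ge0|exact: cutf_mono|].
  have [zb|zb] := leP (nrm z) (b + 1)%R; first by apply: le_cutf => //; [rewrite addr_ge0|exact: VB].
  by rewrite /cutf [(nrm z <= _)%R]leNgt zb/= addr_ge0.
- by move=> z zb; split; apply: cutf_submean => //; [exact: ltW|lra|exact: ltW|lra].
Qed.

Lemma measurable_odisc (x : R) : measurable [set y : R * R | (nrm y < x)%R].
Proof.
have := @measurable_nrm R measurableT _ (measurable_itv `]-oo, x[); rewrite setTI.
by congr measurable; apply/seteqP; split => y /=; rewrite in_itv.
Qed.

Definition dind (x : R) y : \bar R := (\1_[set y : R * R | (nrm y < x)%R] y)%:E.

Lemma nnm_dind x : nnm (dind x).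
Proof.
split; last by move=> y; rewrite lee_fin.
apply/measurable_EFinP; apply: measurable_indic; exact: measurable_odisc.
Qed.

Lemma dind_mass (x : R) : (0 < x)%R -> exists2 a : R, (0 < a)%R & \int[plane]_y dind x y = a%:E.
Proof.
move=> x0; pose D := [set y : R * R | (nrm y < x)%R].
have mD : measurable D by exact: measurable_odisc.
have e : \int[plane]_y dind x y = plane D by rewrite /dind integral_indic// setIT.
have fin : \int[plane]_y dind x y < +oo.
  apply: (@le_lt_trans _ _ (plane [set y : R * R | nrm y <= x]%R)); last exact: plane_disc_fin.
  rewrite e; apply: le_measure; rewrite ?inE//; last by move=> y /= /ltW.
  have := measurable_disc (0%R : R * R) x; rewrite (_ : [set y : R * R | nrm (y - 0) <= x]%R = [set y : R * R | nrm y <= x]%R)//.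
  by apply/seteqP; split => y /=; rewrite subr0.
have pos : 0 < \int[plane]_y dind x y.
  rewrite lt0e; apply/andP; split; last by apply: integral_ge0 => y _; exact: (nnm_dind x).2.
  apply/eqP => e0; have := ell_integral_gt0 x0; rewrite ltNge => /negP; apply.
  apply: (@le_trans _ _ (\int[plane]_y (+oo * dind x y))).
    apply: ge0_le_integral_nonmeasurable => y _; first exact: ell_ge0.
    have [yx|yx] := ltP (nrm y) x; last by rewrite ell_out// mule_ge0// (nnm_dind x).2.
    by rewrite /dind indicE mem_set// mule1 leey.
  rewrite (ge0_integralZl plane measurableT (nnm_dind x).1 (fun y _ => (nnm_dind x).2 y))//.
  by rewrite e0 mule0.
move: fin pos; case: (\int[plane]_y dind x y) => [a||]//= _.
by rewrite lte_fin => a0; exists a.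
Qed.

Lemma dind_rot x t y : dind x (rotp t y) = dind x y.
Proof.
rewrite /dind !indicE; set D := [set y : R * R | (nrm y < x)%R].
suff -> : (rotp t y \in D) = (y \in D) by [].
by apply/idP/idP => /set_mem /= h; apply/mem_set; move: h; rewrite /D/= nrm_rot.
Qed.

Lemma dind_average (H : R * R -> \bar R) x z : nnm H ->
  \int[plane]_y (H y * dind x (y - z)%R) = \int[plane]_w (eav H (nrm w) z * dind x w).
Proof.
move=> nH; have nl := nnm_dind x.
rewrite -(radial_average z nH nl (fun t y => dind_rot x t y)).
have nK := nnmM nH (nnmB z nl); rewrite -(@plane_translation R z _ nK.1 nK.2).
apply: eq_integral => -[a1 a2] _; rewrite (_ : (_ - z = (a1, a2))%R); last first.
  by case: z {nK} => z1 z2; congr (_, _) => /=; ring.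
by congr (H _ * _); case: z {nK} => z1 z2; congr (_, _) => /=; ring.
Qed.

Lemma cmean_lt_pinfty v s : subh v -> (0 < s)%R -> cmean v s < +oo.
Proof. by move=> sv s0; exact: le_lt_trans (cmean_le_tr 0 sv s0) (ltry _). Qed.

(* Circle means increase with the radius, so a mean [-oo] on one circle
   would make the integral of [v] over the disc inside it [-oo],
   against the submean property at a point where [v] is finite. *)
Lemma cmean_fin v s z0 : subh v -> v z0 != -oo -> (0 < s)%R -> exists x : R, cmean v s = x%:E.
Proof.
move=> sv vz s0; have [v1 _ _] := sv.
suff : cmean v s != -oo.
  by have := cmean_lt_pinfty sv s0; case: (cmean v s) => [x||]//= _ _; exists x.
apply/eqP => cE; have [al alE] : exists al : R, v z0 = al%:E.
  by have := v1 z0; move: vz; case: (v z0) => [a||]//= _ _; exists a.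
have t0 := nrm_ge0 z0; pose rho := (nrm z0 + s)%R; pose b := (2 * nrm z0 + s + 1)%R.
have rho0 : (0 < rho)%R by rewrite /rho; lra.
have sb : (s < b)%R by rewrite /b; lra.
have b0 : (0 < b)%R by lra.
have [B B0 hB] := subh_bounded (b + 1) 0%R sv.
have vB w : (nrm w <= b + 1)%R -> v w <= B%:E by move=> h; apply: hB; rewrite subr0.
have alB : (al <= B)%R by rewrite -lee_fin -alE; apply: vB; rewrite /b; lra.
have [as_ as0 asE] := dind_mass s0; have [ar ar0 arE] := dind_mass rho0.
suff main (c : R) : (c <= B)%R -> ((B - c) * as_ <= (B - al) * ar)%R.
  have q0 : (0 <= (B - al) * ar / as_)%R.
    by apply: divr_ge0; [apply: mulr_ge0; [rewrite subr_ge0|exact: ltW]|exact: ltW].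
  have := main (B - ((B - al) * ar / as_ + 1))%R.
  have -> : ((B - (B - ((B - al) * ar / as_ + 1))) * as_ = (B - al) * ar + as_)%R.
    by field; rewrite gt_eqF.
  by move=> /(_ ltac:(lra)); lra.
move=> cB; have cm : cmean v s < c%:E by rewrite cE ltNyr.
have [n0 [eta [eta0 hup]]] := smoothed_mean_le sv s0 (ltW sb) cm.
pose n := maxn n0 (Num.truncn (`|al| + `|c|)).+1.
have n0n : (n0 <= n)%N by exact: leq_maxl.
have nM : (`|al| + `|c| <= n%:R)%R.
  by rewrite (le_trans (ltW (truncnS_gt _)))// ler_nat leq_maxr.
have aal := ler_norm (- al)%R; have ac := ler_norm (- c)%R; rewrite !normrN in aal ac.
have nal := normr_ge0 al; have nc := normr_ge0 c.
pose F y := (cutf b n v y)%:E; have nF : nnm F := nnm_cutf b n sv.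
pose K := (B + n%:R)%R; have K0 : (0 <= K)%R by rewrite addr_ge0.
have FK y : (cutf b n v y <= K)%R.
  have [yb|yb] := leP (nrm y) (b + 1)%R; first by apply: le_cutf => //; exact: vB.
  by rewrite /cutf [(nrm y <= _)%R]leNgt yb.
pose H y := (K - cutf b n v y)%:E.
have nH : nnm H.
  split; last by move=> y; rewrite lee_fin subr_ge0.
  by apply/measurable_EFinP; apply: measurable_funB => //; exact: measurable_cutf.
have HF t z : eav H t z + eav F t z = K%:E.
  rewrite -eavD// -[RHS](@eav_cst R _ t z) ?lee_fin//; apply: eq_eav => x.
  by rewrite -EFinD subrK.
(* With both functions equal to [v], [defect_ell] shows that smoothed circle means increase with the
   radius, as [ell] does; the bound at [s] thus passes to smaller circles. *)
have small t : (0 < t)%R -> (t < s)%R -> eav F t 0%R <= (c + n%:R)%:E.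
  move=> tp ts; pose d := (Num.min eta (Num.min 1 (b / 8)) / 2)%R.
  have mp : (0 < Num.min eta (Num.min 1 (b / 8)))%R by rewrite !lt_min eta0 ltr01 divr_gt0.
  have m1 : (Num.min eta (Num.min 1 (b / 8)) <= eta)%R by rewrite ge_min lexx.
  have m2 : (Num.min eta (Num.min 1 (b / 8)) <= 1)%R by rewrite !ge_min lexx orbT.
  have m3 : (Num.min eta (Num.min 1 (b / 8)) <= b / 8)%R by rewrite !ge_min lexx !orbT.
  have d0 : (0 < d)%R by rewrite /d; lra.
  have de : (d < eta)%R by rewrite /d; lra.
  have d1 : (d < 1)%R by rewrite /d; lra.
  have db : (d <= (b - 0) / 8)%R by rewrite /d; lra.
  have [m m0 mE] := ell_mass d0.
  have dat := cutf_data n (lexx 0%R) b0 s0 sb d0 db d1 sv sv (fun z => lexx (v z)) B0 vB.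
  have i1 := smoothed_mean_ge n sv (ltW tp) (le_trans (ltW ts) (ltW sb)) d0 d1 mE.
  have i2 := hup n d m n0n d0 de mE.
  have j1 := defect_ell dat tp (le_trans (ltW ts) (ltW sb)).
  have j2 := defect_ell dat s0 (ltW sb).
  have i3 : \int[plane]_y ((cutf b n v y)%:E * eav (ell d) t y) <= \int[plane]_y ((cutf b n v y)%:E * eav (ell d) s y).
    rewrite -[leLHS]j1 -[leRHS]j2 leeD2r//.
    apply: ge0_le_integral_nonmeasurable => y _; first by rewrite mule_ge0; [|exact: (nnm_defect dat).2|exact: ell_ge0].
    by apply: lee_wpmul2l; [exact: (nnm_defect dat).2|apply: le_ell => //; exact: ltW].
  have := le_trans i1 (le_trans i3 i2); rewrite EFinM lee_pmul2r//.
have key1 (p q : \bar R) (c' : R) : q <= c'%:E -> 0 <= q -> p + q = K%:E -> (K - c')%:E <= p.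
  case: p q => [p||] [q||]//=; rewrite ?lee_fin//.
  by move=> qc _ [<-]; lra.
have key2 (p q : \bar R) (c' : R) : c'%:E <= q -> 0 <= p -> p + q = K%:E -> p <= (K - c')%:E.
  case: p q => [p||] [q||]//=; rewrite ?lee_fin//.
  by move=> qc _ [<-]; lra.
have F0 t z : 0 <= eav F t z by apply: eav_ge0 => y; exact: nF.2.
have H0 t z : 0 <= eav H t z by apply: eav_ge0 => y; exact: nH.2.
have lower : ((B - c) * as_)%:E <= \int[plane]_y (H y * dind s (y - 0)%R).
  rewrite dind_average// EFinM -asE.
  rewrite -(ge0_integralZl plane measurableT (nnm_dind s).1 (fun y _ => (nnm_dind s).2 y)) ?lee_fin ?subr_ge0//.
  apply: ge0_le_integral_nonmeasurable => w _; first by rewrite mule_ge0 ?(nnm_dind s).2// lee_fin subr_ge0.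
  have [ws|ws] := ltP (nrm w) s; last first.
    by rewrite /dind indicE memNset ?mule0//= => h; move: (lt_le_trans h ws); rewrite ltxx.
  apply: lee_wpmul2r; first exact: (nnm_dind s).2.
  have -> : (B - c = K - (c + n%:R))%R by rewrite /K; ring.
  apply: (key1 _ _ _ _ (F0 _ _) (HF _ _)).
  have := nrm_ge0 w; rewrite le_eqVlt => /orP[/eqP <-|wp]; last exact: small.
  have s2 : (0 < s / 2)%R by rewrite divr_gt0.
  apply: le_trans (small _ s2 _); last by lra.
  apply: (@le_trans _ _ (F 0%R)).
    have e0 : eav F 0%R 0%R = eav (fun=> F 0%R) 0%R 0%R.
      by apply: eq_eav => x; rewrite /cpt !mul0r !addr0.
    by rewrite e0 eav_cst//; exact: nF.2.
  by apply: cutf_submean => //; [exact: ltW|rewrite nrm0 add0r; lra].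
have upper : \int[plane]_y (H y * dind rho (y - z0)%R) <= ((B - al) * ar)%:E.
  rewrite dind_average// EFinM -arE.
  rewrite -(ge0_integralZl plane measurableT (nnm_dind rho).1 (fun y _ => (nnm_dind rho).2 y)) ?lee_fin ?subr_ge0//.
  apply: ge0_le_integral_nonmeasurable => w _; first by rewrite mule_ge0 ?(nnm_dind rho).2.
  have [ws|ws] := ltP (nrm w) rho; last first.
    by rewrite /dind indicE memNset ?mule0//= => h; move: (lt_le_trans h ws); rewrite ltxx.
  apply: lee_wpmul2r; first exact: (nnm_dind rho).2.
  have -> : (B - al = K - (al + n%:R))%R by rewrite /K; ring.
  apply: (key2 _ _ _ _ (H0 _ _) (HF _ _)).
  apply: (@le_trans _ _ (F z0)).
    by rewrite lee_fin; apply: cutf_ge => //; [rewrite /b; lra|rewrite alE].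
  by apply: cutf_submean => //; [exact: nrm_ge0|rewrite /b; rewrite /rho in ws; lra].
rewrite -lee_fin; apply: (le_trans lower); apply: le_trans upper.
apply: ge0_le_integral_nonmeasurable => y _; first by rewrite mule_ge0 ?nH.2 ?(nnm_dind s).2.
apply: lee_wpmul2l; first exact: nH.2.
rewrite subr0 /dind !indicE lee_fin.
have [ys|ys] := ltP (nrm y) s; last first.
  by rewrite memNset ?ler0n//= => h; move: (lt_le_trans h ys); rewrite ltxx.
rewrite !mem_set//=.
by have := nrm_triangle y (- z0)%R; rewrite nrmN /rho; lra.
Qed.

End circle_means.

(** * The growth estimate *)

Section limit.
Local Open Scope ereal_scope.
Context {R : realType}.
Implicit Types (z w y : R * R) (u v V : R * R -> \bar R).

Lemma lt_limn_einf (u : (\bar R)^nat) (c : R) : c%:E < limn_einf u -> \forall n \near \oo, c%:E <= u n.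
Proof.
move=> cu; apply: contrapT => no.
suff : limn_einf u <= c%:E by rewrite leNgt cu.
apply: limn_einf_le => n; apply: contrapT => h; apply: no.
exists n => // m /= nm; rewrite leNgt; apply/negP => mc.
by apply: h; exists m => //; exact: ltW.
Qed.

Lemma measurable_limn_einf d (T : measurableType d) (f : (T -> \bar R)^nat) :
  (forall n, measurable_fun setT (f n)) -> measurable_fun setT (fun x => limn_einf (fun n => f n x)).
Proof.
move=> mf; rewrite (_ : (fun x => _) = (fun x => - limn_esup (fun n => - f n x))); last first.
  by apply/funext => x; rewrite limn_esupN oppeK.
apply: measurableT_comp => //; apply: measurable_fun_limn_esup => n.
exact: measurableT_comp.
Qed.

(** [Lam] is the lower limit of [gapbound] divided by the mass of [ell d], with [d] tending to 0 and
    the truncation level to infinity together; the shifts by [n] cancel between [V] and [v]. It is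
    built before the measure and the weight are chosen, so one majorant serves several weights. The
    strict bounds [c] replace values that semicontinuity only approaches. *)
Lemma limit_bound (b r r0 x : R) v V : (0 <= r)%R -> (r < b)%R -> (0 < r0)%R -> (r0 < b)%R ->
  subh v -> subh V -> (forall z, v z <= V z) -> cmean v r0 = x%:E ->
  exists Lam : R -> \bar R, [/\ measurable_fun setT Lam, (forall t, 0 <= Lam t),
    (forall z (c : R), (nrm z <= r)%R -> v z < c%:E -> V z - c%:E <= Lam (nrm z)) &
    forall d' (T : measurableType d') (nu : {sigma_finite_measure set T -> \bar R})
      (tau gam : T -> R) (Q c : R), measurable_fun setT tau -> measurable_fun setT gam ->
      (forall t, 0 <= gam t)%R -> (0 <= Q)%R ->
      (4 * (b / (b - r)))%:E * \int[nu]_t (gam t)%:E <= Q%:E ->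
      (forall s : R, (0 <= s)%R -> (s < b)%R ->
        \int[nu]_t (gkernel b (tau t) s * (gam t)%:E) <= (Q * (ln b - ln (Num.max s r0)))%:E) ->
      cmean V b < c%:E ->
      \int[nu]_t (Lam (tau t) * (gam t)%:E) <= (Q * (c - x))%:E].
Proof.
move=> r_0 rb r00 r0b sv sV vV xE.
have b0 : (0 < b)%R by lra.
have [v1 _ _] := sv; have [V1 _ _] := sV.
have [B B0 hB] := subh_bounded (b + 1) 0%R sV.
have VB w : (nrm w <= b + 1)%R -> V w <= B%:E by move=> h; apply: hB; rewrite subr0.
pose d0 : R := (Num.min 1 ((b - r) / 8))%R.
have d00 : (0 < d0)%R by rewrite lt_min ltr01 divr_gt0// subr_gt0.
pose d (n : nat) : R := (d0 / n.+2%:R)%R.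
have dp n : (0 < d n)%R by rewrite divr_gt0.
have dd0 n : (d n < d0)%R by rewrite ltr_pdivrMr// ltr_pMr// ltr1n.
have d1 n : (d n < 1)%R by rewrite (lt_le_trans (dd0 n))// ge_min lexx.
have db n : (d n <= (b - r) / 8)%R by rewrite (le_trans (ltW (dd0 n)))// ge_min lexx orbT.
have dsmall (eta : R) : (0 < eta)%R -> \forall n \near \oo, (d n < eta)%R.
  move=> eta0; near=> n; rewrite /d ltr_pdivrMr// mulrC -ltr_pdivrMr//.
  apply: (@le_lt_trans _ _ n%:R); last by rewrite ltr_nat; lia.
  by near: n; exact: nbhs_infty_ger.
pose m (n : nat) : R := fine (\int[plane]_y ell (d n) y).
have m0 n : (0 < m n)%R by rewrite /m; have [a a0 ->] := ell_mass (dp n).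
have mE n : \int[plane]_y ell (d n) y = (m n)%:E by rewrite /m; have [a a0 ->] := ell_mass (dp n).
have dat n := cutf_data n r_0 rb r00 r0b (dp n) (db n) (d1 n) sv sV vV B0 VB.
pose gb n t := gapbound b r (d n) (cutf b n v) (cutf b n V) t.
have mgb n : measurable_fun setT (gb n) := measurable_gapbound (dat n).
have gb0 n t : 0 <= gb n t := gapbound_ge0 (dat n) t.
have mi n : (0 <= (m n)^-1)%R by rewrite invr_ge0 ltW.
pose Phi n t := ((m n)^-1)%:E * gb n t.
have Phi0 n t : 0 <= Phi n t by rewrite mule_ge0// lee_fin.
have mPhi n : measurable_fun setT (Phi n) by exact: measurable_funeM.
pose Lam t := limn_einf (fun n => Phi n t).
have Lam_ge (n0 : nat) (a : \bar R) t : (\forall n \near \oo, a <= Phi n t) -> a <= Lam t.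
  move=> h; apply: limn_einf_ge => c ca; near=> n; rewrite (le_trans (ltW ca))//.
  by near: n.
have Lam0 t : 0 <= Lam t by apply: (Lam_ge 0%N); near=> n.
exists Lam; split => //; first exact: measurable_limn_einf.
- move=> z c zr vc.
  case VzE : (V z) => [a||]; [|by have := V1 z; rewrite VzE|by rewrite leNye].
  have [n0 [eta [eta0 hF]]] := smoothed_le sv vc.
  apply: (Lam_ge 0%N); near=> n.
  have zb : (nrm z <= b)%R by lra.
  have n0n : (n0 <= n)%N by near: n; exact: nbhs_infty_ge.
  have de : (d n < eta)%R by near: n; exact: dsmall.
  have i1 := hF b n (d n) (m n) n0n (dp n) de (mE n).
  have i2 := smoothed_ge n sV zb (dp n) (d1 n) (mE n).
  have i3 : (a + n%:R <= cutf b n V z)%R by apply: cutf_ge => //; [lra|rewrite VzE].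
  have i4 := smoothed_gap_bound (dat n) zr.
  have nl := nnmB z (@nnm_ell R (d n)).
  have sum : \int[plane]_y ((cutf b n V y - cutf b n v y)%:E * ell (d n) (y - z)%R) +
     \int[plane]_y ((cutf b n v y)%:E * ell (d n) (y - z)%R) =
     \int[plane]_y ((cutf b n V y)%:E * ell (d n) (y - z)%R).
    have nE := nnm_E (dat n); have nF := nnm_F (dat n).
    apply: (eq_trans (esym (plane_integralD (nnmM nE nl) (nnmM nF nl)))).
    apply: eq_integral => y _; rewrite -ge0_muleDl; [by rewrite -EFinD subrK|exact: nE.2|exact: nF.2].
  have key (p q s t : \bar R) (c1 c2 : R) : q <= c1%:E -> c2%:E <= s -> p + q = s -> 0 <= q -> p <= t -> (c2 - c1)%:E <= t.
    case: p q s => [p||] [q||] [s||]//=; rewrite ?lee_fin//.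
      by move=> h1 h2; rewrite -EFinD => -[e] _ h; apply: le_trans h; rewrite lee_fin; lra.
    by move=> _ _ _ _; rewrite leye_eq => /eqP ->; rewrite leey.
  have q0 : 0 <= \int[plane]_y ((cutf b n v y)%:E * ell (d n) (y - z)%R).
    by apply: integral_ge0 => y _; rewrite mule_ge0 ?ell_ge0// lee_fin cutf_ge0.
  have := key _ _ _ _ _ _ i1 i2 sum q0 i4.
  rewrite -/(gb n (nrm z)) => i5.
  have i6 : ((a - c) * m n)%:E <= gb n (nrm z).
    apply: le_trans i5; rewrite lee_fin -mulrBl ler_pM2r//; lra.
  rewrite -EFinB /Phi; apply: (@le_trans _ _ (((m n)^-1)%:E * ((a - c) * m n)%:E)).
    by rewrite -EFinM lee_fin mulrC mulfK// gt_eqF.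
  by apply: lee_wpmul2l => //; rewrite lee_fin.
move=> d' T nu tau gam Q c mtau mgam gam0 Q0 hC hK Vc.
have [n0 [eta [eta0 hG]]] := smoothed_mean_le sV b0 (lexx b) Vc.
have mPt n : measurable_fun setT (fun t => Phi n (tau t)) by exact: (measurableT_comp (mPhi n) mtau).
have mgE : measurable_fun setT (fun t => (gam t)%:E) by exact/measurable_EFinP.
apply: (@le_trans _ _ (\int[nu]_t limn_einf (fun n => Phi n (tau t) * (gam t)%:E))).
  apply: ge0_le_integral_nonmeasurable => t _; first by rewrite mule_ge0// lee_fin.
  have := gam0 t; rewrite le_eqVlt => /orP[/eqP <-|gt].
    rewrite mule0; apply: limn_einf_ge => a a0; near=> n.
    by rewrite mule0 ltW.
  apply: limn_einf_ge => a aL.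
  have h : (a / gam t)%:E < Lam (tau t).
    move: aL; case: (Lam (tau t)) (Lam0 (tau t)) => [l||]//= _; last by rewrite ltry.
    by rewrite -EFinM !lte_fin ltr_pdivrMr.
  have := lt_limn_einf h; apply: filterS => n hn.
  apply: (@le_trans _ _ ((a / gam t)%:E * (gam t)%:E)).
    by rewrite -EFinM divfK// gt_eqF.
  by apply: lee_wpmul2r => //; rewrite lee_fin ltW.
apply: (@le_trans _ _ (limn_einf (fun n => \int[nu]_t (Phi n (tau t) * (gam t)%:E)))).
  apply: fatou => //; first by move=> n; exact: emeasurable_funM.
  by move=> n t _; rewrite mule_ge0// lee_fin.
have bound n : (n0 <= n)%N -> (d n < eta)%R -> (- n%:R <= x)%R ->
    \int[nu]_t (Phi n (tau t) * (gam t)%:E) <= (Q * (c - x))%:E.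
  move=> n0n de nx.
  have i1 := hG n (d n) (m n) n0n (dp n) de (mE n).
  have i2 := smoothed_mean_ge n sv (ltW r00) (ltW r0b) (dp n) (d1 n) (mE n).
  have i3 := gapbound_total (dat n) mtau mgE (fun t => gam0 t : 0 <= (gam t)%:E) Q0 hC hK.
  have i4 : (x + n%:R)%:E <= eav (fun y => (cutf b n v y)%:E) r0 0%R.
    rewrite eav_cutf//; last by rewrite nrm0; lra.
    by rewrite lee_fin lerD2r -lee_fin -xE; exact: cmean_le_tr.
  have i5 : ((x + n%:R) * m n)%:E <= \int[plane]_y ((cutf b n v y)%:E * eav (ell (d n)) r0 y).
    apply: le_trans i2; rewrite EFinM; apply: lee_wpmul2r => //; rewrite lee_fin; exact: ltW.
  have -> : \int[nu]_t (Phi n (tau t) * (gam t)%:E) = ((m n)^-1)%:E * \int[nu]_t (gb n (tau t) * (gam t)%:E).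
    rewrite -ge0_integralZl//.
    - by apply: eq_integral => t _; rewrite /Phi muleA.
    - by apply: emeasurable_funM => //; exact: (measurableT_comp (mgb n) mtau).
    - by move=> t _; rewrite mule_ge0// lee_fin.
    - by rewrite lee_fin.
  have key (p q s : \bar R) (c1 c2 : R) : (0 <= c1)%R -> c1%:E <= q -> s <= c2%:E -> 0 <= p -> p + Q%:E * q <= Q%:E * s -> p <= (Q * (c2 - c1))%:E.
    move=> c10 h1 h2 p0 h3.
    have j1 : p + Q%:E * c1%:E <= Q%:E * c2%:E.
      apply: le_trans (le_trans h3 _); first by apply: leeD2l; apply: lee_wpmul2l.
      exact: lee_wpmul2l.
    move: j1; rewrite -!EFinM; case: (p) => [p'||]//=; last by move=> _; rewrite leNye.
    by rewrite -EFinD !lee_fin; lra.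
  have I0 : 0 <= \int[nu]_t (gb n (tau t) * (gam t)%:E).
    by apply: integral_ge0 => t _; rewrite mule_ge0// lee_fin.
  have c10 : (0 <= (x + n%:R) * m n)%R by apply: mulr_ge0; [lra|exact: ltW].
  have := key _ _ _ _ _ c10 i5 i1 I0 i3 => i6.
  apply: (@le_trans _ _ (((m n)^-1)%:E * (Q * ((c + n%:R) * m n - (x + n%:R) * m n))%:E)).
    by apply: lee_wpmul2l => //; rewrite lee_fin.
  rewrite -EFinM lee_fin le_eqVlt; apply/orP; left; apply/eqP; field.
  by rewrite gt_eqF.
have [N _ hN] : \forall n \near \oo, (n0 <= n)%N /\ (d n < eta)%R /\ (- n%:R <= x)%R.
  near=> n; split; first by near: n; exact: nbhs_infty_ge.
  split; first by near: n; exact: dsmall.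
  by rewrite lerNl; near: n; exact: nbhs_infty_ger.
apply: limn_einf_le => n; exists (maxn n N); first exact: leq_maxl.
have [h1 [h2 h3]] := hN (maxn n N) (leq_maxr _ _).
exact: bound.
Unshelve. all: by end_near. Qed.

End limit.

Section growth.
Local Open Scope ereal_scope.
Context {R : realType}.
Implicit Types (z w y : R * R) (u v V : R * R -> \bar R).

(** Only the positive part of [f] matters for an upper bound, so [f] may change sign and be
    nonmeasurable. *)
Lemma integral_le_of_bound d (T : measurableType d) (nu : {measure set T -> \bar R}) (E : set T)
    (f g : T -> \bar R) : (forall t, E t -> 0 <= g t) -> (forall t, E t -> f t <= g t) ->
  \int[nu]_(t in E) f t <= \int[nu]_(t in E) g t.
Proof.
move=> g0 fg; rewrite integralE.
have sub (p q : \bar R) : 0 <= p -> 0 <= q -> p - q <= p.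
  by case: p q => [p||] [q||]//=; rewrite ?leNye// ?leey// !lee_fin => _; lra.
apply: le_trans (sub _ _ _ _) _; [exact: integral_ge0|exact: integral_ge0|].
apply: ge0_le_integral_nonmeasurable => t Et //.
by rewrite funeposE ge_max fg// g0.
Qed.

Lemma null_integral_le0 d (T : measurableType d) (nu : {measure set T -> \bar R}) (E : set T)
    (f : T -> \bar R) : measurable E -> nu E = 0 -> \int[nu]_(t in E) f t <= 0.
Proof.
move=> mE nE; apply: (@le_trans _ _ (\int[nu]_(t in E) +oo)).
  by apply: integral_le_of_bound => t _; rewrite leey.
by rewrite integral_cst// nE mule0.
Qed.

Lemma sub_le_of_all (a L : \bar R) (x : R) : (forall c : R, (x < c)%R -> a - c%:E <= L) -> a - x%:E <= L.
Proof.
move=> h; apply/lee_addgt0Pr => e e0.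
have := h (x + e)%R; rewrite ltrDl => /(_ e0).
by rewrite !leeBlDr// EFinD addeA addeAC.
Qed.

Section abstract.
Context d (T : measurableType d) (nu : {sigma_finite_measure set T -> \bar R}).
Variables (tau : T -> R) (E : set T).
Hypotheses (mtau : measurable_fun setT tau)
  (nu_tau : forall f : R -> \bar R, measurable_fun setT f -> (forall x, 0 <= f x) ->
     \int[nu]_t f (tau t) = \int[lebesgue_measure]_x f x)
  (mE : measurable E) (nu0 : 0 < nu setT).

Definition holder_const (b r m q n : R) : R :=
  (4 * q * (b / (b - r)) * n * m `^ q^-1 * ln (4 * b / m))%R.

(** The factor [q ln (4 b / m)] is at least [ln 4 >= 1], so dropping it only lowers the constant. *)
Lemma holder_const_ge (b r m q n : R) : (0 < r)%R -> (r < b)%R -> (0 < m)%R -> (m <= r)%R ->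
  (1 <= q)%R -> (0 <= n)%R ->
  [/\ (4 * (b / (b - r)) * (m `^ q^-1 * n) <= holder_const b r m q n)%R, (1 <= b / (b - r))%R &
    (0 <= holder_const b r m q n)%R].
Proof.
move=> r0 rb m0 mr q1 n0; have l4 := @ln4_ge R.
have b0 : (0 < b)%R by lra.
have L4 : (ln 4 <= ln (4 * b / m))%R by rewrite ler_ln ?posrE ?divr_gt0 ?mulr_gt0// ler_pdivlMr//; lra.
have br0 : (0 <= b / (b - r))%R by rewrite divr_ge0//; lra.
have mn : (0 <= m `^ q^-1 * n)%R by rewrite mulr_ge0// powR_ge0.
have A0 : (0 <= 4 * (b / (b - r)) * (m `^ q^-1 * n))%R by apply: mulr_ge0 => //; exact: mulr_ge0.
suff hc : (4 * (b / (b - r)) * (m `^ q^-1 * n) <= holder_const b r m q n)%R.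
  by split => //; [rewrite ler_pdivlMr; lra|exact: le_trans hc].
rewrite /holder_const.
rewrite (_ : 4 * q * (b / (b - r)) * n * m `^ q^-1 * ln (4 * b / m) = 4 * (b / (b - r)) * (m `^ q^-1 * n) * (q * ln (4 * b / m)))%R; last by ring.
apply: ler_peMr => //.
have : (ln (4 * b / m) <= q * ln (4 * b / m))%R by rewrite ler_peMl//; lra.
lra.
Qed.

Lemma weight_hyps (g : T -> R) (p : \bar R) (b r m q n : R) :
  measurable_fun E g -> 1 < p ->
  ((p = +oo /\ q = 1%R) \/ (exists p' : R, p = p'%:E /\ (p'^-1 + q^-1 = 1)%R)) ->
  (1 <= q)%R -> Lnorm nu p (EFin \o extend0 E g) = n%:E -> (0 < r)%R -> (r < b)%R ->
  (0 < m)%R -> (m <= r)%R -> nu E = m%:E ->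
  \int[nu]_t `|(extend0 E g t)%:E| <= (m `^ q^-1 * n)%:E /\
  (4 * (b / (b - r)))%:E * \int[nu]_t `|(extend0 E g t)%:E| <= (holder_const b r m q n)%:E.
Proof.
move=> mg p1 pq q1 Nn r0 rb m0 mr nuE.
have n0 : (0 <= n)%R by rewrite -lee_fin -Nn Lnorm_ge0.
have Np : Lnorm nu p (EFin \o extend0 E g) < +oo by rewrite Nn ltry.
have h1 : \int[nu]_t `|(extend0 E g t)%:E| <= (m `^ q^-1 * n)%:E.
  by rewrite EFinM -Nn; exact: gamma_integral (ltW m0) nuE.
split => //; have [h2 h3 _] := holder_const_ge r0 rb m0 mr q1 n0.
apply: (@le_trans _ _ ((4 * (b / (b - r)))%:E * (m `^ q^-1 * n)%:E)).
  by apply: lee_wpmul2l => //; rewrite lee_fin; lra.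
by rewrite -EFinM lee_fin.
Qed.

Variables (b r r0 m : R).
Hypotheses (r00 : (0 < r0)%R) (r0r : (r0 < r)%R) (rb : (r < b)%R) (m0 : (0 < m)%R) (mr : (m <= r)%R)
  (nuE : nu E = m%:E) (Er : forall t, E t -> (0 <= tau t <= r)%R).
Variables (v V : R * R -> \bar R) (x : R).
Hypotheses (sv : subh v) (sV : subh V) (vV : forall z, v z <= V z) (xE : cmean v r0 = x%:E).

(** The quantity [h] stands for a circle supremum, controlled by the gap only on circles where [v]
    is nowhere -oo; the additive [M] leaves room for the term [w^+] of the second inequality. The
    other circles are shown to have negligible radii by a second use of [limit_bound]. *)
Lemma growth_bound (g : T -> R) (p : \bar R) (q n M c : R) (h : T -> \bar R) :
  measurable_fun E g -> 1 < p ->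
  ((p = +oo /\ q = 1%R) \/ (exists p' : R, p = p'%:E /\ (p'^-1 + q^-1 = 1)%R)) ->
  (1 <= q)%R -> Lnorm nu p (EFin \o extend0 E g) = n%:E -> (0 <= M)%R -> cmean V b < c%:E ->
  (forall t, E t -> 0 <= h t) ->
  (forall t L, E t -> 0 <= L -> (forall z, nrm z = tau t -> v z != -oo) ->
     (forall z, nrm z = tau t -> V z - v z <= L) -> h t <= L + M%:E) ->
  \int[nu]_(t in E) (h t * (g t)%:E) <= (holder_const b r m q n * (c - x) + M * (m `^ q^-1 * n))%:E.
Proof.
have r0' := r00; have r0r' := r0r; have rb' := rb; have m0' := m0; have mr' := mr.
have rp : (0 < r)%R by lra.
have bp : (0 < b)%R by lra.
move=> mg p1 pq q1 Nn M0 Vc h0 hL.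
have n0 : (0 <= n)%R by rewrite -lee_fin -Nn Lnorm_ge0.
have r0b : (r0 < b)%R by lra.
have [Lam [mL L0 LV Lint]] := limit_bound (ltW rp) rb r00 r0b sv sV vV xE.
(* [V] may itself be -oo where [v] is, so its gap does not detect such points; with [max(v, 0)] the
   gap is +oo there, which forces [Lam'] to be +oo at that radius. *)
pose V' z := maxe (v z) 0.
have sV' : subh V' by apply: subh_max => //; exact: (subh_cst 0).
have vV' z : v z <= V' z by rewrite /V' le_max lexx.
have [Lam' [mL' L'0 LV' Lint']] := limit_bound (ltW rp) rb r00 r0b sv sV' vV' xE.
have qinf : ((+oo = +oo :> \bar R) /\ (1 = 1 :> R)%R) \/ (exists p' : R, +oo = p'%:E /\ (p'^-1 + 1^-1 = 1)%R) by left.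
have m1 : measurable_fun E (cst 1%R : T -> R) by [].
have [n1 n1E] : exists n1 : R, Lnorm nu +oo (EFin \o extend0 E (cst 1%R)) = n1%:E.
  have : Lnorm nu +oo (EFin \o extend0 E (cst 1%R)) <= 1.
    rewrite unlock /= nu0; apply/ess_sup_inf.ess_supP; apply: nearW => t.
    by rewrite /= /extend0; case: ifP => _; rewrite ?normr1 ?normr0 ?lee_fin.
  have := Lnorm_ge0 nu +oo (EFin \o extend0 E (cst 1%R)).
  by case: (Lnorm _ _ _) => [a||]//=; exists a.
have [c' Vc'] : exists c' : R, cmean V' b < c'%:E.
  have := cmean_lt_pinfty sV' bp; case: (cmean V' b) => [a||]//= _.
    by exists (a + 1)%R; rewrite lte_fin ltrDl.
  by exists 0%R; rewrite ltNyr.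
have mgam (g' : T -> R) : measurable_fun E g' -> measurable_fun setT (fun t => `|extend0 E g' t|)%R.
  by move=> mg'; apply: measurableT_comp => //; exact: measurable_extend0.
have fin' : \int[nu]_t (Lam' (tau t) * (`|extend0 E (cst 1%R) t|)%:E) < +oo.
  have [w1 w2] := weight_hyps m1 (ltry 1 : 1 < +oo) qinf (lexx 1%R) n1E rp rb m0 mr nuE.
  have n10 : (0 <= n1)%R by rewrite -lee_fin -n1E Lnorm_ge0.
  have [w3 w4 w5] := holder_const_ge rp rb m0 mr (lexx 1%R) n10.
  apply: le_lt_trans (Lint' _ T nu tau (fun t => `|extend0 E (cst 1%R) t|)%R (holder_const b r m 1 n1) c' mtau (mgam _ m1) (fun t => normr_ge0 _) _ w2 _ Vc') (ltry _) => //.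
  move=> s s0 sb; apply: (kernel_integral mtau nu_tau mE m1 nu0 (ltry 1 : 1 < +oo) qinf (lexx 1%R) n1E r00 r0r rb m0 mr nuE Er s0 sb).
(* Nothing is known about [h] on exceptional radii, so the majorant is +oo there. As [Lam'] is
   integrable over [E], this does not change the integral. *)
pose Linf t : \bar R := if Lam' t == +oo then +oo else Lam t.
have Linf0 t : 0 <= Linf t by rewrite /Linf; case: ifP.
have mLinf : measurable_fun setT Linf.
  apply: measurable_fun_ifT => //; apply: (measurable_fun_bool true).
  have := measurableC (emeasurable_neq measurableT mL' +oo); rewrite !setTI.
  by congr measurable; apply/seteqP; split => t /=; [move/negP; rewrite negbK|move=> -> ].
have aefin : {ae nu, forall t, E t -> Lam' (tau t) != +oo}.
  have mI : measurable_fun setT (fun t => Lam' (tau t) * (`|extend0 E (cst 1%R) t|)%:E).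
    by apply: emeasurable_funM; [exact: (measurableT_comp mL' mtau)|apply/measurable_EFinP; exact: mgam].
  have I0 t : 0 <= Lam' (tau t) * (`|extend0 E (cst 1%R) t|)%:E by rewrite mule_ge0// lee_fin.
  have : nu.-integrable setT (fun t => Lam' (tau t) * (`|extend0 E (cst 1%R) t|)%:E).
    by apply/integrableP; split => //; under eq_integral do rewrite gee0_abs//.
  move/(integrable_ae measurableT); apply: filterS => t /(_ I) + Et.
  by rewrite /extend0 mem_set//= normr1 mule1; case: (Lam' (tau t)).
pose G t := `|extend0 E g t|%R.
have G0 t : (0 <= G t)%R by exact: normr_ge0.
have mG : measurable_fun setT (fun t => (G t)%:E) by apply/measurable_EFinP; exact: mgam.
have GE t : (G t)%:E = `|(extend0 E g t)%:E| by [].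
have mLt : measurable_fun setT (fun t => Linf (tau t)) by exact: (measurableT_comp mLinf mtau).
have mLamt : measurable_fun setT (fun t => Lam (tau t)) by exact: (measurableT_comp mL mtau).
have s1 : \int[nu]_(t in E) (h t * (g t)%:E) <= \int[nu]_t ((Linf (tau t) + M%:E) * (G t)%:E).
  have -> : \int[nu]_t ((Linf (tau t) + M%:E) * (G t)%:E) = \int[nu]_(t in E) ((Linf (tau t) + M%:E) * (G t)%:E).
    rewrite [RHS]integral_mkcond; apply: eq_integral => t _; rewrite patchE.
    by case: ifPn => // tE; rewrite /G /extend0 (negbTE tE) normr0 mule0.
  apply: integral_le_of_bound => t Et; first by rewrite mule_ge0 ?lee_fin// adde_ge0.
  have -> : G t = `|g t|%R by rewrite /G /extend0 mem_set.
  apply: (@le_trans _ _ (h t * (`|g t|%R)%:E)).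
    by apply: lee_wpmul2l; [exact: h0|rewrite lee_fin ler_norm].
  apply: lee_wpmul2r; first by rewrite lee_fin.
  rewrite /Linf; have [e|fin] := eqVneq (Lam' (tau t)) +oo; first by rewrite /= addye// leey.
  have vfin z : nrm z = tau t -> v z != -oo.
    move=> zt; apply/eqP => vz; move: fin; apply/negP; rewrite negbK.
    have zr : (nrm z <= r)%R by rewrite zt; have /andP[] := Er Et.
    have V'z : V' z = 0 by rewrite /V' vz maxNye.
    have big (c0 : R) : c0%:E <= Lam' (tau t).
      have := LV' z (- c0)%R zr; rewrite vz ltNyr V'z add0e -EFinN opprK zt; exact.
    case E' : (Lam' (tau t)) big => [l||]//= big.
      by have := big (l + 1)%R; rewrite lee_fin; lra.
    by have := big 0%R.
  apply: hL => // z zt; have zr : (nrm z <= r)%R by rewrite zt; have /andP[] := Er Et.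
  have := vfin z zt; have [v1 _ _] := sv; have := v1 z; case vz : (v z) => [a||]//= _ _.
  apply: sub_le_of_all => c0 ac; rewrite -zt; apply: LV => //.
  by rewrite vz lte_fin.
apply: (le_trans s1).
have mM : measurable_fun setT (fun t => M%:E * (G t)%:E) by exact: measurable_funeM.
have -> : \int[nu]_t ((Linf (tau t) + M%:E) * (G t)%:E) = \int[nu]_t (Linf (tau t) * (G t)%:E) + \int[nu]_t (M%:E * (G t)%:E).
  rewrite -ge0_integralD//.
  - by apply: eq_integral => t _; rewrite ge0_muleDl.
  - by move=> t _; rewrite mule_ge0// lee_fin.
  - exact: emeasurable_funM.
  - by move=> t _; rewrite mule_ge0// lee_fin.
have -> : \int[nu]_t (Linf (tau t) * (G t)%:E) = \int[nu]_t (Lam (tau t) * (G t)%:E).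
  apply: ge0_ae_eq_integral => //.
  - exact: emeasurable_funM.
  - exact: emeasurable_funM.
  - by move=> t _; rewrite mule_ge0// lee_fin.
  - by move=> t _; rewrite mule_ge0// lee_fin.
  apply: filterS aefin => t ht _; have [Et|Et] := pselect (E t).
    by rewrite /Linf (negbTE (ht Et)).
  have -> : G t = 0%R by rewrite /G /extend0 memNset// normr0.
  by rewrite !mule0.
have [w1 w2] := weight_hyps mg p1 pq q1 Nn rp rb m0 mr nuE.
have [w3 w4 w5] := holder_const_ge rp rb m0 mr q1 n0.
rewrite EFinD; apply: leeD.
  apply: (Lint _ T nu tau G (holder_const b r m q n) c mtau (mgam _ mg) G0 _ w2 _ Vc) => //.
  move=> s s0 sb; exact: (kernel_integral mtau nu_tau mE mg nu0 p1 pq q1 Nn r00 r0r rb m0 mr nuE Er s0 sb).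
rewrite ge0_integralZl//; last by move=> t _; rewrite lee_fin.
by rewrite EFinM; apply: lee_wpmul2l.
Qed.

End abstract.
End growth.

(** * Circle suprema and differences of circle means *)

Section circles.
Local Open Scope ereal_scope.
Context {R : realType}.
Implicit Types (z w y : R * R) (u v V : R * R -> \bar R).

Lemma cpt0E (s a : R) : cpt 0%R s a = (s * cos a, s * sin a)%R.
Proof. by rewrite /cpt !add0r. Qed.

Lemma CmeanE v (s : R) : s != 0%R -> Cmean v s = cmean v s.
Proof.
move=> /negbTE s0; rewrite /Cmean s0 /cmean; congr (_ * _).
by apply: eq_integral => a _; rewrite cpt0E.
Qed.

Lemma cmean_ge0 (h : R * R -> \bar R) s : (forall z, 0 <= h z) -> 0 <= cmean h s.
Proof.
move=> h0; rewrite mule_ge0 ?lee_fin ?invr_ge0 ?(ltW two_pi_gt0)//.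
exact: integral_ge0.
Qed.

Lemma cmean_cst (c s : R) : cmean (fun=> c%:E) s = c%:E.
Proof.
rewrite /cmean (@circle_mean_bounded _ (fun=> c%:E) `|c|%R)//; last by move=> a; rewrite lee_fin ler_norm.
by rewrite integral_cst//= circ_prob_setT mule1 -!EFinB; congr EFin; ring.
Qed.

(** The means of [v] and [V] are finite, so [v = -oo] only at a null set of angles. There the
    difference [K] is set to 0, which stays below [h] because [h] is nonnegative. *)
Lemma cmean_sub_le v V (h : R * R -> \bar R) (s x y : R) : subh v -> subh V -> (forall z, v z <= V z) ->
  cmean v s = x%:E -> cmean V s = y%:E -> (forall z, 0 <= h z) ->
  (forall z, v z != -oo -> V z - v z <= h z) -> (y - x)%:E <= cmean h s.
Proof.
move=> sv sV vV vx Vy h0 hh.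
have [v1 _ _] := sv; have [V1 _ _] := sV.
have [B B0 hB] := subh_bounded `|s|%R 0%R sV.
have VB a : V (cpt 0%R s a) <= B%:E by apply: hB; rewrite nrm_cptB.
have vB a : v (cpt 0%R s a) <= B%:E by apply: le_trans (VB a).
pose Gv a := B%:E - v (cpt 0%R s a); pose GV a := B%:E - V (cpt 0%R s a).
have Gv0 a : 0 <= Gv a by rewrite subre_ge0.
have GV0 a : 0 <= GV a by rewrite subre_ge0.
have mv : measurable_fun setT (fun a => v (cpt 0%R s a)) := measurable_circle s 0%R (measurable_subh sv).
have mV : measurable_fun setT (fun a => V (cpt 0%R s a)) := measurable_circle s 0%R (measurable_subh sV).
have mGv : measurable_fun setT Gv by exact: emeasurable_funB.
have mGV : measurable_fun setT GV by exact: emeasurable_funB.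
have Iv : \int[circ_prob]_a Gv a = (B - x)%:E.
  have I0 : 0 <= \int[circ_prob]_a Gv a by exact: integral_ge0.
  move: vx; rewrite /cmean (subh_mean sv B0 vB) -/(Gv _); case: integral I0 => [I||]//= _.
  by rewrite -EFinB => -[<-]; congr EFin; ring.
have IV : \int[circ_prob]_a GV a = (B - y)%:E.
  have I0 : 0 <= \int[circ_prob]_a GV a by exact: integral_ge0.
  move: Vy; rewrite /cmean (subh_mean sV B0 VB) -/(GV _); case: integral I0 => [I||]//= _.
  by rewrite -EFinB => -[<-]; congr EFin; ring.
pose K a : \bar R := if Gv a == +oo then 0 else Gv a - GV a.
have Gfin a : Gv a != +oo -> exists2 p : R, v (cpt 0%R s a) = p%:E & exists q : R, V (cpt 0%R s a) = q%:E.
  rewrite /Gv; have := vV (cpt 0%R s a); have := v1 (cpt 0%R s a); have := V1 (cpt 0%R s a).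
  by case: (v _) => [p||]//=; case: (V _) => [q||]//= _ _ _ _; exists p => //; exists q.
have K0 a : 0 <= K a.
  rewrite /K; case: ifPn => // /Gfin [p vp [q Vq]]; rewrite /Gv /GV vp Vq -!EFinB lee_fin.
  by have := vV (cpt 0%R s a); rewrite vp Vq lee_fin; lra.
have Kh a : K a <= h (cpt 0%R s a).
  rewrite /K; case: ifPn => // fin; have [p vp [q Vq]] := Gfin a fin.
  have := hh (cpt 0%R s a); rewrite vp Vq => /(_ isT); apply: le_trans.
  by rewrite /Gv /GV vp Vq -!EFinB lee_fin; lra.
have mE : measurable [set a | Gv a == +oo].
  have := measurableC (emeasurable_neq measurableT mGv +oo); rewrite !setTI.
  by congr measurable; apply/seteqP; split => t /=; [move/negP; rewrite negbK|move=> -> ].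
have mK : measurable_fun setT K.
  apply: measurable_fun_ifT => //; last exact: emeasurable_funB.
  by apply: (measurable_fun_bool true); rewrite setTI.
have KG a : Gv a != +oo -> K a + GV a = Gv a.
  move=> fin; rewrite /K (negbTE fin); have [p vp [q Vq]] := Gfin a fin.
  by rewrite /Gv /GV vp Vq -!EFinB -EFinD; congr EFin; ring.
have ae : {ae @circ_prob R, forall a, setT a -> K a + GV a = Gv a}.
  have : (@circ_prob R).-integrable setT Gv.
    apply/integrableP; split => //.
    by under eq_integral do rewrite gee0_abs//; rewrite Iv ltry.
  move/(integrable_ae measurableT); apply: filterS => a /(_ I) fin _.
  by apply: KG; move: fin; case: (Gv a).
have IK : \int[circ_prob]_a K a + (B - y)%:E = (B - x)%:E.
  rewrite -IV -Iv -ge0_integralD//; apply: ge0_ae_eq_integral => //.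
  - exact: emeasurable_funD.
  - by move=> a _; exact: adde_ge0.
have IKE : \int[circ_prob]_a K a = (y - x)%:E.
  by move: IK; case: integral => [I||]//=; rewrite -EFinD => -[e]; congr EFin; lra.
rewrite -IKE circ_probE// /cmean.
apply: lee_wpmul2l; first by rewrite lee_fin invr_ge0 ltW// two_pi_gt0.
by apply: ge0_le_integral_nonmeasurable.
Qed.

Lemma Msup_ge (f : R * R -> \bar R) z : f z <= Msup f (nrm z).
Proof. by have [a za] := polar z; apply: ereal_sup_ubound; exists a => //; rewrite -za. Qed.

Lemma Msup_le (f : R * R -> \bar R) (t : R) (L : \bar R) : (0 <= t)%R ->
  (forall z, nrm z = t -> f z <= L) -> Msup f t <= L.
Proof.
by move=> t0 fL; apply: ge_ereal_sup => _ [a _ <-]; apply: fL; rewrite nrm_polar ger0_norm.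
Qed.

Lemma Msup_ge0 (f : R * R -> \bar R) (t : R) : (0 <= t)%R -> (forall z, 0 <= f z) -> 0 <= Msup f t.
Proof.
move=> t0 f0; have e : nrm (t, 0%R) = t by rewrite /nrm/= expr0n/= addr0 sqrtr_sqr ger0_norm.
by have := Msup_ge f (t, 0%R); rewrite e; apply: le_trans.
Qed.

Lemma subh_eplus v : subh v -> subh (fun z => eplus (v z)).
Proof. by move=> sv; apply: subh_max => //; exact: (subh_cst 0). Qed.

Lemma eplus_tr0 v z : subh v -> (tr 0 v z)%:E = eplus (v z).
Proof. by case=> v1 _ _; rewrite trE// oppr0. Qed.

Lemma Msup_eplus_fin v (b : R) : subh v -> (0 <= b)%R ->
  exists2 M : R, (0 <= M)%R & Msup (fun z => eplus (v z)) b = M%:E.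
Proof.
move=> sv b0; have [B B0 hB] := subh_bounded b 0%R sv.
have le1 : Msup (fun z => eplus (v z)) b <= B%:E.
  apply: Msup_le => // z zb; rewrite ge_max lee_fin B0 andbT; apply: hB.
  by rewrite subr0 zb.
have ge1 : 0 <= Msup (fun z => eplus (v z)) b.
  by apply: Msup_ge0 => // z; rewrite le_max lexx orbT.
move: le1 ge1; case: (Msup _ _) => [M||]//=; rewrite !lee_fin => _ M0.
by exists M.
Qed.

(** The maximum principle against a constant, for the truncation at level 0, which is [v^+]. *)
Lemma eplus_le_Msup v (b : R) z : subh v -> (0 < b)%R -> (nrm z <= b)%R ->
  eplus (v z) <= Msup (fun z => eplus (v z)) b.
Proof.
move=> sv b0 zb; have [M M0 ME] := Msup_eplus_fin sv (ltW b0).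
have [ut lt_ st] := tr_rsub 0 sv.
have lc : lipconst 0 (fun=> M : R) by move=> w y; rewrite subrr normr0 mul0r.
have := @max_principle R (tr 0 v) (fun=> M) 0 b 0 b0 ut lt_ (lexx 0%R) lc _ _ z zb.
rewrite ME -eplus_tr0// lee_fin addr0; apply.
- move=> w _; have [rho rho0 h] := st w; exists rho => // s hs; split; first exact: h.
  by rewrite /cav avg_cst.
- move=> w wb; rewrite -lee_fin eplus_tr0// -ME -wb.
  exact: (Msup_ge (fun z => eplus (v z))).
Qed.

End circles.

(** * The two inequalities *)

Section final.
Local Open Scope ereal_scope.
Context {R : realType}.
Implicit Types (z y : R * R) (u v V w : R * R -> \bar R).

Lemma le_of_lt_all (I : \bar R) (Q a b y x : R) : (0 <= Q)%R ->
  (forall c : R, (y < c)%R -> I <= (Q * (c - x) + a)%:E) -> (Q * (y - x) + a <= b)%R -> I <= b%:E.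
Proof.
move=> Q0 h hb; apply/lee_addgt0Pr => e e0.
have Q1 : (0 < Q + 1)%R by lra.
have ye : (y < y + e / (Q + 1))%R by rewrite ltrDl divr_gt0.
apply: (le_trans (h _ ye)); rewrite -EFinD lee_fin.
have : (Q * (e / (Q + 1)) <= e)%R.
  by rewrite mulrA ler_pdivrMr// mulrDr mulr1 mulrC lerDl ltW.
lra.
Qed.

Section abstract.
Context d (T : measurableType d) (nu : {sigma_finite_measure set T -> \bar R}).
Variables (tau : T -> R) (E : set T).
Hypotheses (mtau : measurable_fun setT tau)
  (nu_tau : forall f : R -> \bar R, measurable_fun setT f -> (forall x, 0 <= f x) ->
     \int[nu]_t f (tau t) = \int[lebesgue_measure]_x f x)
  (mE : measurable E) (nu0 : 0 < nu setT).
Variables (b r r0 m : R).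
Hypotheses (r00 : (0 < r0)%R) (r0r : (r0 < r)%R) (rb : (r < b)%R) (m0 : (0 < m)%R) (mr : (m <= r)%R)
  (nuE : nu E = m%:E) (Er : forall t, E t -> (0 <= tau t <= r)%R).
Variables (g : T -> R) (p : \bar R) (q n : R).
Hypotheses (mg : measurable_fun E g) (p1 : 1 < p)
  (pq : (p = +oo /\ q = 1%R) \/ (exists p' : R, p = p'%:E /\ (p'^-1 + q^-1 = 1)%R))
  (q1 : (1 <= q)%R) (Nn : Lnorm nu p (EFin \o extend0 E g) = n%:E).

(** The core bound is [C_V(b) - C_v(r0)] for [V = max(u, v)]. Where [v] is finite, [V - v = U^+], so
    [C_V(r0) - C_v(r0) <= C_{U^+}(r0)]; adding and subtracting [C_V(r0)] produces the characteristic
    function. *)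
Lemma delta_subharmonic_growth (U u v : R * R -> \bar R) : subharmonic u -> subharmonic v ->
  (forall z, u z != -oo \/ v z != -oo -> U z = u z - v z) ->
  \int[nu]_(t in E) (eplus (Msup U (tau t)) * (g t)%:E) <=
  (holder_const b r m q n)%:E * (charT u v r0 b + Cmean (fun z => eplus (U z)) r0).
Proof.
have r00' := r00; have r0r' := r0r; have rb' := rb.
move=> su sv UE; have shu := subharmonic_subh su; have shv := subharmonic_subh sv.
pose V z := maxe (u z) (v z).
have shV : subh V by exact: subh_max.
have vV z : v z <= V z by rewrite /V le_max lexx orbT.
have [_ [z0 v0] _ _] := sv.
have V0 : V z0 != -oo by apply: contraNneq v0 => V0; have := vV z0; rewrite V0 leeNy_eq.
have b0 : (0 < b)%R by lra.
have [x xE] := cmean_fin shv v0 r00.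
have [y0 y0E] := cmean_fin shV V0 r00.
have [y yE] := cmean_fin shV V0 b0.
have n0 : (0 <= n)%R by rewrite -lee_fin -Nn Lnorm_ge0.
have r_gt0 : (0 < r)%R by lra.
have [_ _ Q0] := holder_const_ge r_gt0 rb m0 mr q1 n0.
have Uv z : v z != -oo -> U z <= V z - v z.
  move=> vz; rewrite UE; last by right.
  by apply: leeB => //; rewrite /V le_max lexx.
have I1 : \int[nu]_(t in E) (eplus (Msup U (tau t)) * (g t)%:E) <= (holder_const b r m q n * (y - x))%:E.
  apply: (@le_of_lt_all _ (holder_const b r m q n) 0%R _ y x) => //; last by rewrite addr0.
  move=> c yc; have yc' : cmean V b < c%:E by rewrite yE lte_fin.
  rewrite -(mul0r (m `^ q^-1 * n)%R).
  apply: (growth_bound mtau nu_tau mE nu0 r00 r0r rb m0 mr nuE Er shv shV vV xE mg p1 pq q1 Nn (lexx 0%R) yc').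
    by move=> t _; rewrite le_max lexx orbT.
  move=> t L Et L0 vf VL; rewrite adde0 ge_max L0 andbT.
  have /andP[t0 _] := Er Et.
  by apply: Msup_le => // z zt; apply: le_trans (VL z zt); apply: Uv; exact: vf.
apply: (le_trans I1); rewrite EFinM; apply: lee_wpmul2l => //.
have r0n : r0 != 0%R by rewrite gt_eqF.
have bn : b != 0%R by rewrite gt_eqF.
rewrite /charT !CmeanE// yE y0E.
have : (y0 - x)%:E <= cmean (fun z => eplus (U z)) r0.
  apply: (cmean_sub_le shv shV vV xE y0E) => [z|z vz]; first by rewrite le_max lexx orbT.
  rewrite UE; last by right.
  have [v1 _ _] := shv; have := v1 z; move: vz; rewrite /V /eplus.
  case: (v z) => [a||]//= _ _; case: (u z) => [c||]//=.
  - by rewrite -!EFinB -!EFin_max -EFinB lee_fin -subr_ge0 maxr_absE maxr_absE subr0; case: lerP; case: lerP; lra.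
  - by rewrite maxNye -EFinB subrr le_max lexx orbT.
case: (cmean _ _) => [W||]//=; last by move=> _; rewrite addey// leey.
by rewrite -EFinB -EFinD !lee_fin; lra.
Qed.

(** Since [|w| = (w^+ - w) + w^+], the gap costs the constant of the core estimate, and [w^+], at
    most [M] in the disc, costs [M m^{1/q} n]. The latter is at most a quarter of that constant
    times [M], whence [5/4]. *)
Lemma subharmonic_growth w : subharmonic w ->
  \int[nu]_(t in E) (Msup (fun z => `|w z|) (tau t) * (g t)%:E) <=
  (5 / 4 * holder_const b r m q n)%:E * (Msup (fun z => eplus (w z)) b + Cmean (fun z => eminus (w z)) r0).
Proof.
have r00' := r00; have r0r' := r0r; have rb' := rb.
move=> sw; have shw := subharmonic_subh sw.
pose V z := eplus (w z).
have shV : subh V by exact: subh_eplus.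
have vV z : w z <= V z by rewrite /V le_max lexx.
have V0 z : 0 <= V z by rewrite /V le_max lexx orbT.
have [w1 [z0 w0] _ _] := sw.
have Vz0 : V z0 != -oo by apply: contraTneq (V0 z0) => ->.
have b0 : (0 < b)%R by lra.
have [x xE] := cmean_fin shw w0 r00.
have [y0 y0E] := cmean_fin shV Vz0 r00.
have [y yE] := cmean_fin shV Vz0 b0.
have [M M0 ME] := Msup_eplus_fin shw (ltW b0).
have y00 : (0 <= y0)%R by rewrite -lee_fin -y0E; exact: cmean_ge0.
have yM : (y <= M)%R.
  rewrite -lee_fin -yE -(cmean_cst M b) -ME.
  rewrite /cmean; apply: lee_wpmul2l; first by rewrite lee_fin invr_ge0 ltW// two_pi_gt0.
  apply: ge0_le_integral_nonmeasurable => a _ //.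
  rewrite -[X in Msup _ X](_ : nrm (cpt 0%R b a) = b); first exact: (Msup_ge V).
  by rewrite cpt0E nrm_polar ger0_norm// ltW.
have n0 : (0 <= n)%R by rewrite -lee_fin -Nn Lnorm_ge0.
have r_gt0 : (0 < r)%R by lra.
have [Q1 Q2 Q0] := holder_const_ge r_gt0 rb m0 mr q1 n0.
have I1 c : (y < c)%R -> \int[nu]_(t in E) (Msup (fun z => `|w z|) (tau t) * (g t)%:E) <=
    (holder_const b r m q n * (c - x) + M * (m `^ q^-1 * n))%:E.
  move=> yc; have yc' : cmean V b < c%:E by rewrite yE lte_fin.
  apply: (growth_bound mtau nu_tau mE nu0 r00 r0r rb m0 mr nuE Er shw shV vV xE mg p1 pq q1 Nn M0 yc').
    move=> t Et; have /andP[t0 _] := Er Et.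
    by apply: Msup_ge0.
  move=> t L Et L0 vf VL; have /andP[t0 tr] := Er Et.
  apply: Msup_le => // z zt.
  have zb : (nrm z <= b)%R by rewrite zt; lra.
  have := eplus_le_Msup shw b0 zb; rewrite ME; have := VL z zt; rewrite /V /eplus.
  have := vf z zt; have := w1 z; case: (w z) => [a||]//= _ _.
  rewrite -EFin_max -EFinB; case: L L0 {VL} => [L||]//= L0; last by move=> _ _; rewrite addye// leey.
  rewrite -EFinD !lee_fin; rewrite /Num.max; case: ifP => a0; last first.
    have : (0 <= a)%R by rewrite leNgt a0.
    by move=> a0' h1 h2; rewrite ger0_norm//; move: L0; rewrite lee_fin; lra.
  by move=> h1 h2; rewrite ltr0_norm//; lra.
have W0 : 0 <= cmean (fun z => eminus (w z)) r0 by apply: cmean_ge0 => z; rewrite le_max lexx orbT.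
have r0n : r0 != 0%R by rewrite gt_eqF.
rewrite CmeanE// ME.
have : (y0 - x)%:E <= cmean (fun z => eminus (w z)) r0.
  apply: (cmean_sub_le shw shV vV xE y0E) => [z|z vz]; first by rewrite le_max lexx orbT.
  have := w1 z; move: vz; rewrite /V /eplus /eminus.
  case: (w z) => [a||]//= _ _.
  rewrite -!EFin_max -EFinB lee_fin /Num.max; case: ifP => a0; case: ifP => a1; lra.
case: (cmean _ _) W0 => [W||]//= W0.
  rewrite -EFinD -EFinM !lee_fin => yx; rewrite lee_fin in W0.
  apply: (le_of_lt_all Q0 I1).
  set Q := holder_const _ _ _ _ _ in Q1 Q0 *; set G := (m `^ q^-1 * n)%R in Q1 *.
  have G0 : (0 <= G)%R by rewrite mulr_ge0// powR_ge0.
  have GQ : (G <= Q / 4)%R.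
    have : (G <= b / (b - r) * G)%R by rewrite ler_peMl.
    by rewrite ler_pdivlMr//; move: Q1; rewrite -mulrA; lra.
  have h1 : (Q * (y - x) <= Q * (M + W))%R by apply: ler_wpM2l => //; lra.
  have h2 : (M * G <= M * (Q / 4))%R by exact: ler_wpM2l.
  have h3 : (0 <= Q * W)%R by exact: mulr_ge0.
  lra.
(* An infinite mean makes the right side +oo unless the constant is 0. In that case [0 * +oo = 0],
   and the integral itself must be shown nonpositive. *)
move=> _; rewrite addey//.
have : (0 <= 5 / 4 * holder_const b r m q n)%R by rewrite mulr_ge0//; lra.
rewrite le_eqVlt => /predU1P[Qz|Qp]; last by rewrite gt0_muley ?lte_fin// leey.
rewrite -Qz mul0e.
have Qz' : holder_const b r m q n = 0%R by lra.
rewrite Qz' in Q0 I1 Q1.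
apply: (le_of_lt_all (lexx 0%R) I1).
have G0 : (0 <= m `^ q^-1 * n)%R by rewrite mulr_ge0// powR_ge0.
have : (m `^ q^-1 * n <= b / (b - r) * (m `^ q^-1 * n))%R by rewrite ler_peMl.
move: Q1; rewrite -mulrA => Q1 Q3.
have -> : (m `^ q^-1 * n = 0)%R by lra.
lra.
Qed.

End abstract.

(** At [b = k r] the ratio [b / (b - r)] is [k / (k - 1)]; the rest is a regrouping of factors
    around a possibly infinite [X]. *)
Lemma scaled_bound (I X : \bar R) (s A r k m q n : R) : (0 < r)%R -> (1 < k)%R ->
  A = (s * (4 * q * (k / (k - 1))))%R -> I <= (s * holder_const (k * r) r m q n)%:E * X ->
  (r^-1)%:E * I <= A%:E * X * n%:E * (m `^ q^-1 / r * ln (4 * k * r / m))%:E.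
Proof.
move=> r0 k1 -> IX; apply: (@le_trans _ _ ((r^-1)%:E * ((s * holder_const (k * r) r m q n)%:E * X))).
  by apply: lee_wpmul2l => //; rewrite lee_fin invr_ge0 ltW.
rewrite -[leRHS]muleA -EFinM [leRHS]muleAC muleA -!EFinM.
rewrite le_eqVlt; apply/orP; left; apply/eqP; congr (EFin _ * _).
have kr : (k * r - r = r * (k - 1))%R by ring.
rewrite /holder_const kr (_ : 4 * (k * r) = 4 * k * r)%R; last by ring.
by field; apply/andP; split; lra.
Qed.

Lemma conj_ge1 (p : \bar R) (q : R) : 1 < p ->
  ((p = +oo /\ q = 1%R) \/ (exists p' : R, p = p'%:E /\ (p'^-1 + q^-1 = 1)%R)) -> (1 <= q)%R.
Proof.
move=> p1 [[_ ->//]|[p' [pE pq]]]; move: p1; rewrite pE lte_fin => p1.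
have i1 : (0 < p'^-1)%R by rewrite invr_gt0; lra.
have i2 : (p'^-1 < 1)%R by rewrite invf_lt1//; lra.
have q0 : (0 < q^-1)%R by lra.
have qp : (0 < q)%R by rewrite -invr_gt0.
by rewrite leNgt; apply/negP; rewrite -invf_gt1//; lra.
Qed.

Lemma growth_estimates d (T : measurableType d) (nu : {sigma_finite_measure set T -> \bar R})
    (tau : T -> R) (E : set T) (r0 r k m : R) (g : T -> R) (p : \bar R) (q : R)
    (U u v w : R * R -> \bar R) :
  measurable_fun setT tau ->
  (forall f : R -> \bar R, measurable_fun setT f -> (forall x, 0 <= f x) ->
     \int[nu]_t f (tau t) = \int[lebesgue_measure]_x f x) ->
  0 < nu setT -> (0 < r0)%R -> (r0 < r)%R -> (1 < k)%R ->
  measurable E -> (forall t, E t -> (0 <= tau t <= r)%R) ->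
  nu E = m%:E -> (m <= r)%R ->
  1 < p -> ((p = +oo /\ q = 1%R) \/ (exists p' : R, p = p'%:E /\ (p'^-1 + q^-1 = 1)%R)) ->
  measurable_fun E g -> Lnorm nu p (EFin \o extend0 E g) < +oo ->
  subharmonic u -> subharmonic v ->
  (forall z, u z != -oo \/ v z != -oo -> U z = u z - v z) -> subharmonic w ->
  let F := if m == 0%R then 0%R else (m `^ q^-1 / r * ln (4 * k * r / m))%R in
  ((r^-1)%:E * \int[nu]_(t in E) (eplus (Msup U (tau t)) * (g t)%:E)
     <= (4 * q * (k / (k - 1)))%:E * (charT u v r0 (k * r) + Cmean (fun z => eplus (U z)) r0)
        * Lnorm nu p (EFin \o extend0 E g) * F%:E) /\
  ((r^-1)%:E * \int[nu]_(t in E) (Msup (fun z => `|w z|%E) (tau t) * (g t)%:E)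
     <= (5 * q * (k / (k - 1)))%:E
        * (Msup (fun z => eplus (w z)) (k * r) + Cmean (fun z => eminus (w z)) r0)
        * Lnorm nu p (EFin \o extend0 E g) * F%:E).
Proof.
move=> mtau nu_tau nu0 r00 r0r k1 mE Er nuE mr p1 pq mg Lfin su sv UE sw F.
have r_gt0 : (0 < r)%R by lra.
have rb : (r < k * r)%R by rewrite ltr_pMl.
have q1 := conj_ge1 p1 pq.
(* For a null set the right sides are 0 by convention; the logarithmic factor is meaningful only for
   [m > 0]. *)
have [mz|mN] := eqVneq m 0%R.
  have nuE0 : nu E = 0 by rewrite nuE mz.
  rewrite /F mz eqxx !mule0.
  have ri : 0 <= (r^-1)%:E by rewrite lee_fin invr_ge0 ltW.
  by split; apply: mule_ge0_le0 => //; exact: null_integral_le0.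
have m0 : (0 < m)%R by rewrite lt_neqAle eq_sym mN -lee_fin -nuE measure_ge0.
have [n Nn] : exists n : R, Lnorm nu p (EFin \o extend0 E g) = n%:E.
  have := Lnorm_ge0 nu p (EFin \o extend0 E g).
  by move: Lfin; case: (Lnorm _ _ _) => [a||]//=; exists a.
rewrite /F (negbTE mN) Nn; split.
- apply: (@scaled_bound _ _ 1%R) => //; first by rewrite mul1r.
  by rewrite mul1r; exact: (delta_subharmonic_growth mtau nu_tau mE nu0 r00 r0r rb m0 mr nuE Er mg p1 pq q1 Nn su sv UE).
- apply: (@scaled_bound _ _ (5 / 4)%R) => //; first by set x := (k / _)%R; field.
  exact: (subharmonic_growth mtau nu_tau mE nu0 r00 r0r rb m0 mr nuE Er mg p1 pq q1 Nn sw).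
Qed.

End final.

Theorem mainTheorem1 (R : realType) (r0 r k : R) (E : set (LebT R))
  (p : \bar R) (q : R) (g : LebT R -> R) (U u v w : R * R -> \bar R) :
  0 < r0 -> r0 < r -> 1 < k ->
  measurable E -> E `<=` `[0, r] ->
  (1 < p)%E ->
  ((p = +oo%E /\ q = 1) \/ (exists p' : R, p = p'%:E /\ p'^-1 + q^-1 = 1)) ->
  measurable_fun E g -> (Lnorm cmu p (fun x => (if x \in E then g x else 0)%:E) < +oo)%E ->
  canonical_rep U u v ->
  ~ (forall z, U z = +oo%E) -> ~ (forall z, U z = -oo%E) ->
  subharmonic w ->
  ((r^-1)%:E * \int[cmu]_(t in E) (eplus (Msup U t) * (g t)%:E)
     <= (4 * q * (k / (k - 1)))%:E
        * (charT u v r0 (k * r) + Cmean (fun z => eplus (U z)) r0)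
        * Lnorm cmu p (fun x => (if x \in E then g x else 0)%:E) * (factorE E q r k)%:E)%E
  /\
  ((r^-1)%:E * \int[cmu]_(t in E) (Msup (fun z => `|w z|%E) t * (g t)%:E)
     <= (5 * q * (k / (k - 1)))%:E
        * (Msup (fun z => eplus (w z)) (k * r)
           + Cmean (fun z => eminus (w z)) r0)
        * Lnorm cmu p (fun x => (if x \in E then g x else 0)%:E) * (factorE E q r k)%:E)%E.
Proof.
move=> r00 r0r k1 mE Er p1 pq mg Lfin [su sv _ UE] _ _ sw.
have r_ge0 : 0 <= r by apply: ltW; exact: lt_trans r0r.
have muI : cmu (`[0, r] : set (LebT R)) = r%:E.
  by rewrite cmu_lebesgue lebesgue_measure_itv/= lte_fin (lt_trans r00 r0r) oppr0 adde0.
have mI : measurable (`[0, r] : set (LebT R)) by exact: measurable_LebT_set.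
have muEr : (cmu E <= r%:E)%E by rewrite -muI; apply: le_measure; rewrite ?inE.
have muE : cmu E = (mes E)%:E.
  by rewrite /mes fineK// ge0_fin_numE//; exact: le_lt_trans (ltry r).
(* The space of radii is the line with its Lebesgue measurable sets, mapped identically to the Borel
   line. *)
apply: (growth_estimates (@measurable_LebT_id R) _ cmu_setT_gt0 r00 r0r k1 mE _ muE _ p1 pq mg Lfin su sv UE sw).
- exact: integral_cmu.
- by move=> t /Er; rewrite /= in_itv.
- by rewrite -lee_fin -muE.
Qed.
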